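(* If $\phi$ is an even Hecke–Maass cusp form, then \[ {\rm N}(\phi)\ge R_\phi\gg t_\phi , \] with an absolute implied constant, as $t_\phi\to\infty$.
   Context: An even Hecke–Maass cusp form is a real-valued $\phi$ on $\mathbb{H}$ with $y^2(\partial_x^2+\partial_y^2)\phi+(\frac14+t_\phi^2)\phi=0$, $t_\phi>0$, $\mathrm{SL}_2(\mathbb{Z})$-invariant, $\phi(-\bar z)=\phi(z)$, $L^2$-normalized on $\mathbb{X}=\mathrm{SL}_2(\mathbb{Z})\backslash\mathbb{H}$, and an eigenfunction of all Hecke operators. ${\rm N}(\phi)$ is the number of nodal domains (connected components of $\mathbb{X}\setminus\{\phi=0\}$); $R_\phi$ is the number of inert nodal domains, i.e. those $\Omega$ with $\sigma(\Omega)=\Omega$, where $\sigma$ is the isometry of $\mathbb{X}$ induced by $x+iy\mapsto-x+iy$. *)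

(* Defs.v *)
From HB Require Import structures.
From mathcomp Require Import all_boot all_order all_algebra.
From mathcomp Require Import all_classical all_reals all_analysis.
From mathcomp Require Import complex.
From mathcomp Require Import ring.
Set Implicit Arguments.
Unset Strict Implicit.
Unset Printing Implicit Defensive.
Import Order.TTheory GRing.Theory Num.Theory.
Import numFieldNormedType.Exports.
Local Open Scope classical_set_scope.
Local Open Scope quotient_scope.
Local Open Scope ring_scope.

(* The point x + iy is represented by the pair (x, y) : R * R, which carries
   the topology, the differential structure and the Lebesgue measure of the
   plane; R[i] is only used to compute the action of SL_2(Z). *)
Definition upper_half_plane (R : realType) : set (R * R) :=
  [set z | 0 < z.2].
Arguments upper_half_plane : clear implicits.

Definition to_complex (R : realType) (z : R * R) : R[i] := Complex z.1 z.2.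

Definition of_complex (R : realType) (w : R[i]) : R * R :=
  (complex.Re w, complex.Im w).

Definition mobius (R : realType) (g : 'M[int]_2) (z : R * R) : R * R :=
  let w := to_complex z in
  of_complex (((g 0 0)%:~R * w + (g 0 1)%:~R) / ((g 1 0)%:~R * w + (g 1 1)%:~R)).

Definition reflection (R : realType) (z : R * R) : R * R := (- z.1, z.2).

Section ModularSurface.
Context (R : realType).
Local Notation HH := (set_type (upper_half_plane R)).

Definition modular_equiv (z w : HH) : bool :=
  `[< exists g : 'M[int]_2, \det g = 1 /\ set_val w = mobius g (set_val z) >].

Lemma det2 (g : 'M[int]_2) : \det g = g 0 0 * g 1 1 - g 0 1 * g 1 0.
Proof.
rewrite (expand_det_row g 0) !big_ord_recl big_ord0 addr0 /cofactor !det_mx11.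
rewrite !mxE /= expr0 mul1r expr1 mulN1r mulrN.
by congr (g _ _ * g _ _ - g _ _ * g _ _); apply: val_inj.
Qed.

Lemma mobius_den_neq0 (g : 'M[int]_2) (z : R * R) : \det g = 1 -> 0 < z.2 ->
  (g 1 0)%:~R * to_complex z + (g 1 1)%:~R != 0 :> R[i].
Proof.
move=> detg y0; apply/eqP.
rewrite -!(rmorph_int (real_complex R)) /to_complex /= => -[].
rewrite mul0r subr0 !addr0 mul0r addr0 => e1 /eqP.
rewrite mulf_eq0 (gt_eqF y0) orbF intr_eq0 => /eqP c0.
move: e1; rewrite c0 mul0r add0r => /eqP; rewrite intr_eq0 => /eqP d0.
by move: detg; rewrite det2 c0 d0 !mulr0 subr0 => /eqP.
Qed.

Lemma mobius1 (z : R * R) : mobius 1%:M z = z.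
Proof. by rewrite /mobius !mxE /= mul0r add0r addr0 mul1r divr1; case: z. Qed.

Lemma mobiusM (g h : 'M[int]_2) (z : R * R) : \det h = 1 -> 0 < z.2 ->
  mobius (g *m h) z = mobius g (mobius h z).
Proof.
move=> deth y0; have den := mobius_den_neq0 deth y0.
rewrite /mobius; congr of_complex.
have toK w : to_complex (of_complex w) = w :> R[i] by case: w.
rewrite toK !mxE !big_ord_recl !big_ord0 !addr0.
have -> : lift ord0 ord0 = 1 :> 'I_2 by apply: val_inj.
rewrite !rmorphD !rmorphM /=.
move: den; set w := to_complex z; set c := _%:~R; set d := _%:~R => den.
set p := (h 0 0)%:~R; set q := (h 0 1)%:~R.
have E (a b : R[i]) : a * ((p * w + q) / (c * w + d)) + b =
    ((a * p + b * c) * w + (a * q + b * d)) / (c * w + d) by field.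
by rewrite !E -mulf_div divff ?invr_eq0// mulr1.
Qed.

Lemma modular_equivP (z w : HH) :
  reflect (exists g : 'M[int]_2, \det g = 1 /\ set_val w = mobius g (set_val z))
          (modular_equiv z w).
Proof. exact: asboolP. Qed.

Lemma upper_half_planeP (z : HH) : 0 < (set_val z : R * R).2.
Proof. exact: (set_mem (valP z)). Qed.

Lemma modular_equiv_refl : reflexive modular_equiv.
Proof.
by move=> z; apply/modular_equivP; exists 1%:M; rewrite det1 mobius1.
Qed.

Lemma modular_equiv_trans : transitive modular_equiv.
Proof.
move=> w z u /modular_equivP[g [dg eg]] /modular_equivP[h [dh eh]].
apply/modular_equivP; exists (h *m g); rewrite det_mulmx dg dh mulr1; split=> //.
by rewrite mobiusM// ?upper_half_planeP// -eg.
Qed.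

Lemma modular_equiv_symW z w : modular_equiv z w -> modular_equiv w z.
Proof.
move=> /modular_equivP[g [dg eg]]; apply/modular_equivP; exists (\adj g).
have adjg : \adj g *m g = 1%:M by rewrite mul_adj_mx dg.
split; last by rewrite eg -mobiusM// ?upper_half_planeP// adjg mobius1.
by have := congr1 determinant adjg; rewrite det_mulmx dg mulr1 det1.
Qed.

Lemma modular_equiv_sym : symmetric modular_equiv.
Proof. by move=> z w; apply/idP/idP; exact: modular_equiv_symW. Qed.

Definition modular_equiv_rel : equiv_rel HH :=
  EquivRel modular_equiv modular_equiv_refl modular_equiv_sym
    modular_equiv_trans.

Definition modular_surface := quotient_topology {eq_quot modular_equiv_rel}.

HB.instance Definition _ := Topological.on modular_surface.
HB.instance Definition _ := Quotient.on modular_surface.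

Lemma reflection_subproof (z : HH) :
  reflection (set_val z) \in upper_half_plane R.
Proof. by apply/mem_set; exact: upper_half_planeP. Qed.

Definition reflectionH (z : HH) : HH :=
  exist (fun x => x \in upper_half_plane R) _ (reflection_subproof z).

Definition sigma (q : modular_surface) : modular_surface :=
  \pi_modular_surface (reflectionH (repr q)).

(* The function on the quotient induced by phi; meaningful when phi is
   SL_2(Z)-invariant. *)
Definition descend (phi : R * R -> R) (q : modular_surface) : R :=
  phi (set_val (repr q)).

Definition modular_invariant (phi : R * R -> R) :=
  forall (g : 'M[int]_2) (z : R * R), \det g = 1 -> upper_half_plane R z ->
    phi (mobius g z) = phi z.

Lemma pi_modularP (z w : HH) :
  reflect (\pi_modular_surface z = \pi_modular_surface w) (modular_equiv z w).
Proof. by apply: (iffP idP) => /(eqmodP modular_equiv_rel). Qed.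

Lemma repr_modular (z : HH) : modular_equiv (repr (\pi_modular_surface z)) z.
Proof. by apply/pi_modularP; rewrite reprK. Qed.

Lemma descend_pi (phi : R * R -> R) (z : HH) : modular_invariant phi ->
  descend phi (\pi_modular_surface z) = phi (set_val z).
Proof.
move=> inv; have /modular_equivP[g [dg ->]] := repr_modular z.
by rewrite inv//; exact: upper_half_planeP.
Qed.

Lemma sigma_pi (z : HH) :
  sigma (\pi_modular_surface z) = \pi_modular_surface (reflectionH z).
Proof.
apply/pi_modularP; have /modular_equivP[g [dg e]] := repr_modular z.
apply/modular_equivP; exists (\matrix_(i, j) ((-1) ^+ (i + j)%N * g i j)).
split.
  by rewrite -[RHS]dg !det2 !mxE /= expr0 expr1 sqrrN expr1n; ring.
have reflE (w : HH) : set_val (reflectionH w) = reflection (set_val w) by [].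
rewrite !reflE e /mobius /reflection; set u := set_val _.
have conjK (w : R * R) : (- w.1, w.2) = of_complex (- (to_complex w)^*)%C.
  by case: w => a b; congr pair; exact/esym/opprK.
have toC (w : R * R) : to_complex (- w.1, w.2) = (- (to_complex w)^*)%C.
  by case: w => a b; congr Complex; exact/esym/opprK.
rewrite (conjK (of_complex _)) toC; congr of_complex.
have toK w : to_complex (of_complex w) = w :> R[i] by case: w.
rewrite toK !mxE /= !(rmorphM, fmorphV, rmorphD, rmorph_int) /=.
rewrite (_ : (0 + 1 %% 2)%N = 1%N)// (_ : (1 %% 2 + 0)%N = 1%N)//.
by rewrite expr1 !rmorphN1 -mulNr; congr (_ / _); ring.
Qed.

End ModularSurface.

Section MaassForms.
Context (R : realType).

Definition C2_on (A : set (R * R)) (phi : R * R -> R) :=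
  forall z, A z -> forall v w : R * R,
    [/\ derivable phi z v, derivable ('D_v phi) z w &
        {for z, continuous ('D_w ('D_v phi))}].

Definition laplacian (phi : R * R -> R) (z : R * R) : R :=
  'D_(1, 0) ('D_(1, 0) phi) z + 'D_(0, 1) ('D_(0, 1) phi) z.

Definition hecke (n : nat) (phi : R * R -> R) (z : R * R) : R :=
  (Num.sqrt n%:R)^-1 * \sum_(d <- divisors n) \sum_(b < d)
    phi (((n %/ d)%N%:R * z.1 + b%:R) / d%:R, (n %/ d)%N%:R * z.2 / d%:R).

Definition fundamental_domain : set (R * R) :=
  [set z | [/\ 0 < z.2, `|z.1| <= 2^-1 & 1 <= z.1 ^+ 2 + z.2 ^+ 2]].

(* The square of the norm in L^2(SL_2(Z)\H, dx dy / y^2). *)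
Definition L2norm_sq (phi : R * R -> R) : \bar R :=
  (\int[lebesgue_measure \x lebesgue_measure]_(z in fundamental_domain)
    (phi z ^+ 2 / z.2 ^+ 2)%:E)%E.

(* Only the values of phi on the upper half-plane matter.  Vanishing at the
   cusp is not listed: the constant term of phi is a combination of
   y^(1/2 + it) and y^(1/2 - it), which is square integrable at the cusp only
   if it is zero. *)
Record even_hecke_maass_cusp_form (t : R) (phi : R * R -> R) : Prop := {
  maass_regular : C2_on (upper_half_plane R) phi;
  maass_spectral_gt0 : 0 < t;
  maass_eigen : forall z, upper_half_plane R z ->
    z.2 ^+ 2 * laplacian phi z + (4^-1 + t ^+ 2) * phi z = 0;
  maass_modular : modular_invariant phi;
  maass_even : forall z, upper_half_plane R z -> phi (reflection z) = phi z;
  maass_normalized : L2norm_sq phi = 1%E;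
  maass_hecke : forall n : nat, (0 < n)%N -> exists lambda : R,
    forall z, upper_half_plane R z -> hecke n phi z = lambda * phi z
}.

Definition nonvanishing (phi : R * R -> R) : set (modular_surface R) :=
  [set q | descend phi q != 0].

Definition nodal_domains (phi : R * R -> R) : set (set (modular_surface R)) :=
  [set connected_component (nonvanishing phi) q | q in nonvanishing phi].

Definition inert_nodal_domains (phi : R * R -> R) :
    set (set (modular_surface R)) :=
  [set D | nodal_domains phi D /\ @sigma R @` D = D].

(* Cardinalities; [counting] is +oo on infinite sets. *)
Definition num_nodal (phi : R * R -> R) : \bar R :=
  counting (nodal_domains phi).

Definition num_inert (phi : R * R -> R) : \bar R :=
  counting (inert_nodal_domains phi).

End MaassForms.

(* Main.v *)
(* On the line Im z = y expand phi (x, y) = 2 \sum_n c_n(y) cos (2 pi n x).  Each c_n solves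
   c_n'' = ((2 pi n)^2 - (1/4 + t^2) / y^2) c_n, the cusp condition c_0 = 0 follows from square
   integrability, and the Hecke relations give c_n(y) = alpha_n c_1(n y) with |alpha_n| <= n and
   alpha_4 = alpha_2^2 - 1/2.  Put tau = t / (2 pi), the turning point of c_1.  For y between
   0.6 tau and 0.9 tau the coefficient c_1 oscillates with a bounded wavelength, while all c_n
   with n >= 2 are exponentially small.  Since
     |cos (2 pi n x) - cos (2 pi n / 4)| <= n cos (2 pi x)   for |x| <= 1/4,
   at a height y where |c_1(y)| is not small and c_1(y) has the sign of phi (1/4, y), the function
   phi keeps that sign on the whole segment |x| <= 1/4.  On the line x = 1/4 only the even
   coefficients survive, and as alpha_2 and alpha_4 are not both small, one of c_2, c_4 dominates
   on a range of heights of length proportional to tau; there phi (1/4, y) has no zero.  This gives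
   >> t stacked boxes |x| < 1/4, b_i < y < b_{i+1} on whose boundaries phi has one sign s, each
   containing a point (0, p_i) where phi has the sign -s.  The images of the boxes in the modular
   surface trap the nodal domains of these points, which are therefore distinct, and inert since
   (0, p_i) is fixed by the reflection. *)
Require Import Defs.
From HB Require Import structures.
From mathcomp Require Import all_boot all_order all_algebra.
From mathcomp Require Import all_classical all_reals all_analysis.
From mathcomp Require Import measurable_realfun complex ring lra.
Set Implicit Arguments.
Unset Strict Implicit.
Unset Printing Implicit Defensive.
Import Order.TTheory GRing.Theory Num.Theory.
Import numFieldNormedType.Exports.
Local Open Scope classical_set_scope.
Local Open Scope quotient_scope.
Local Open Scope ring_scope.

(** No Bessel function is used: each coefficient is handled through [v'' = q v] with [q] increasing,
    by monotone quantities ([v v'], the energy [v'^2 - q v^2], Wronskians), and square integrability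
    at the cusp selects the decaying solution. The size of [phi] enters through one unit [U], the
    value of [|c_1|] at [11/10 tau], slightly past the turning point. The delicate place is
    [x = 1/4]: there the [c_1] term vanishes and [phi] is exponentially small, so an error measured
    in [U] is useless. On a segment all errors are therefore kept proportional to [cos (2 pi x)]; on
    the vertical line the tail is measured against [c_1 (2 y)] or [c_1 (4 y)]. The heights start at
    [3/5 tau] because [2 * 3/5 > 11/10] puts every [c_n] with [n >= 2] past the turning point, and
    stop at [9/10 tau], where [c_1] still oscillates. With [tau >= 3600] the distances, which are
    multiples of [tau], beat the numerical constants. The boxes lie above height 2, where only
    integer translations identify points, so they stay disjoint in the surface. *)

Section RealCalculus.
Context {R : realType}.
Implicit Types (f g df : R -> R) (a b x y : R).

Lemma der_cst (c x : R) : is_derive x (1 : R) (fun=> c) 0.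
Proof. exact: is_derive_cst. Qed.

Lemma der_id (x : R) : is_derive x (1 : R) (fun y => y) 1.
Proof. exact: is_derive_id. Qed.

Lemma derD f g (l m x : R) : is_derive x (1 : R) f l -> is_derive x (1 : R) g m ->
  is_derive x (1 : R) (fun y => f y + g y) (l + m).
Proof. by move=> df dg; exact: is_deriveD. Qed.

Lemma derN f (l x : R) : is_derive x (1 : R) f l ->
  is_derive x (1 : R) (fun y => - f y) (- l).
Proof. by move=> df; exact: is_deriveN. Qed.

Lemma derB f g (l m x : R) : is_derive x (1 : R) f l -> is_derive x (1 : R) g m ->
  is_derive x (1 : R) (fun y => f y - g y) (l - m).
Proof. by move=> df dg; exact: is_deriveB. Qed.

Lemma derM f g (l m x : R) : is_derive x (1 : R) f l -> is_derive x (1 : R) g m ->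
  is_derive x (1 : R) (fun y => f y * g y) (l * g x + f x * m).
Proof.
move=> df dg; have -> : l * g x + f x * m = f x *: m + g x *: l.
  by rewrite /GRing.scale/= addrC [g x * l]mulrC.
rewrite [X in is_derive _ _ X _](_ : _ = (f : R -> R^o) * g)//.
exact: (is_deriveM df dg).
Qed.

Lemma derMl (c : R) f (l x : R) : is_derive x (1 : R) f l ->
  is_derive x (1 : R) (fun y => c * f y) (c * l).
Proof. by move=> df; exact: is_deriveZ. Qed.

Lemma derX2 f (l x : R) : is_derive x (1 : R) f l ->
  is_derive x (1 : R) (fun y => f y ^+ 2) (2 * f x * l).
Proof.
move=> df; have e : (fun y => f y ^+ 2) = (fun y => f y * f y).
  by apply/funext => y; rewrite expr2.
by rewrite e; apply: (is_derive_eq (derM df df)); ring.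
Qed.

Lemma derV f (l x : R) : f x != 0 -> is_derive x (1 : R) f l ->
  is_derive x (1 : R) (fun y => (f y)^-1) (- (f x ^- 2) * l).
Proof. by move=> fx0 df; apply: (is_derive_eq (is_deriveV fx0 df)). Qed.

Lemma der_inv x : 0 < x -> is_derive x (1 : R) (fun y => y^-1) (- x ^- 2).
Proof.
move=> x0; apply: (is_derive_eq (@derV (fun y => y) 1 x _ (der_id x))).
  by rewrite gt_eqF.
by rewrite mulr1.
Qed.

Lemma der_invX2 x : 0 < x ->
  is_derive x (1 : R) (fun y => (y ^+ 2)^-1) (- (2 / x ^+ 3)).
Proof.
move=> x0; apply: (is_derive_eq (@derV (fun y => y ^+ 2) _ x _ (derX2 (der_id x)))).
  by rewrite expf_neq0// gt_eqF.
by field; rewrite gt_eqF.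
Qed.

Lemma der_comp f g (l m x : R) : is_derive x (1 : R) f l ->
  is_derive (f x) (1 : R) g m -> is_derive x (1 : R) (fun y => g (f y)) (m * l).
Proof.
by move=> df dg; exact: (is_derive1_comp dg df).
Qed.

Lemma der_continuous f (l x : R) : is_derive x (1 : R) f l ->
  {for x, continuous f}.
Proof. by move=> [/derivable1_diffP/differentiable_continuous]. Qed.

Lemma der_within f df a b : (forall x, a <= x <= b -> is_derive x (1 : R) f (df x)) ->
  {within `[a, b], continuous f}.
Proof.
move=> h; apply: derivable_within_continuous => x; rewrite in_itv/= => /h[].
by [].
Qed.

Lemma der_mvt f df a b : a <= b ->
  (forall x, a <= x <= b -> is_derive x (1 : R) f (df x)) ->
  exists2 c, a <= c <= b & f b - f a = df c * (b - a).
Proof.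
move=> ab h; have [||c] := @MVT_segment R f df a b ab.
- by move=> x; rewrite in_itv/= => /andP[ax xb]; apply: h; rewrite !ltW.
- exact: der_within.
by rewrite in_itv/= => ? ?; exists c.
Qed.

Lemma der_nondecr f df a b : a <= b ->
  (forall x, a <= x <= b -> is_derive x (1 : R) f (df x)) ->
  (forall x, a <= x <= b -> 0 <= df x) -> f a <= f b.
Proof.
move=> ab h h0; have [c /h0 c0 e] := der_mvt ab h.
by rewrite -subr_ge0 e mulr_ge0// subr_ge0.
Qed.

Lemma der_nonincr f df a b : a <= b ->
  (forall x, a <= x <= b -> is_derive x (1 : R) f (df x)) ->
  (forall x, a <= x <= b -> df x <= 0) -> f b <= f a.
Proof.
move=> ab h h0; rewrite -lerN2.
apply: (@der_nondecr (fun x => - f x) (fun x => - df x) a b) => //.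
  by move=> x /h; exact: derN.
by move=> x /h0; rewrite oppr_ge0.
Qed.

Lemma der_interior_max f df a b c : a < c < b ->
  (forall x, a <= x <= b -> is_derive x (1 : R) f (df x)) ->
  (forall x, a <= x <= b -> f x <= f c) -> df c = 0.
Proof.
move=> /andP[ac cb] h hm.
have hc : a <= c <= b by rewrite !ltW.
have /(_ _ _ _)[] := @derive1_at_max R f a b c (le_trans (ltW ac) (ltW cb)).
- by move=> t; rewrite in_itv/= => /andP[at_ tb]; case: (h t) => //; rewrite !ltW.
- by rewrite in_itv/= ac cb.
- by move=> t; rewrite in_itv/= => /andP[at_ tb]; apply: hm; rewrite !ltW.
by move=> _ e2; have [_ <-] := h c hc; rewrite e2.
Qed.

Lemma ctsM f g : continuous f -> continuous g -> continuous (fun x => f x * g x).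
Proof. by move=> cf cg x; exact: (continuousM (cf x) (cg x)). Qed.

Lemma ctsD f g : continuous f -> continuous g -> continuous (fun x => f x + g x).
Proof. by move=> cf cg x; exact: (continuousD (cf x) (cg x)). Qed.

Lemma ctsB f g : continuous f -> continuous g -> continuous (fun x => f x - g x).
Proof. by move=> cf cg x; exact: (continuousB (cf x) (cg x)). Qed.

Lemma cts_comp f g : continuous f -> continuous g -> continuous (fun x => g (f x)).
Proof. by move=> cf cg x; exact: (continuous_comp (cf x) (cg (f x))). Qed.

Lemma cts_cst (c : R) : continuous (fun _ : R => c).
Proof. exact: cst_continuous. Qed.

Lemma ctsX f n : continuous f -> continuous (fun x => f x ^+ n).
Proof. by move=> cf; apply: (cts_comp cf (@exprn_continuous _ n)). Qed.

Lemma cts_norm f : continuous f -> continuous (fun x => `|f x|).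
Proof. by move=> cf; apply: (cts_comp cf (@norm_continuous _ _)). Qed.

Lemma cts_sum (I : Type) (r : seq I) (F : I -> R -> R) :
  (forall i, continuous (F i)) -> continuous (fun x => \sum_(i <- r) F i x).
Proof.
move=> cF; elim: r => [|i r IH].
  rewrite (_ : (fun x => _) = fun=> 0); first exact: cts_cst.
  by apply/funext => x; rewrite big_nil.
rewrite (_ : (fun x => _) = fun x => F i x + \sum_(j <- r) F j x); first exact: ctsD.
by apply/funext => x; rewrite big_cons.
Qed.

Lemma ln_unbounded (M a : R) : exists2 y, a <= y & M <= ln y.
Proof.
exists (Num.max a (expR M)); first by rewrite le_max lexx.
rewrite -{1}(expRK M) ler_ln ?posrE ?expR_gt0// ?le_max ?lexx ?orbT//.
by rewrite lt_max expR_gt0 orbT.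
Qed.

End RealCalculus.

(** * Decay past the turning point for solutions that are square integrable at the cusp *)

Section BesselEquation.
Context {R : realType} (k mu : R) (v v1 S : R -> R).
Implicit Types (a b y m kap : R).
Hypotheses (k0 : 0 <= k) (mu0 : 0 < mu).

Definition pot (y : R) := k ^+ 2 - mu / y ^+ 2.

Hypothesis dv : forall y : R, 0 < y -> is_derive y (1 : R) v (v1 y).
Hypothesis dv1 : forall y : R, 0 < y -> is_derive y (1 : R) v1 (pot y * v y).

Lemma pot_nondecr a b : 0 < a -> a <= b -> pot a <= pot b.
Proof.
move=> a0 ab; have b0 : 0 < b by exact: lt_le_trans ab.
rewrite lerB// ler_wpM2l ?(ltW mu0)// lef_pV2 ?posrE ?exprn_gt0//.
by rewrite ler_sqr ?nnegrE ?(ltW a0) ?(ltW b0).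
Qed.

Lemma der_pot y : 0 < y -> is_derive y (1 : R) pot (2 * mu / y ^+ 3).
Proof.
move=> y0; apply: (is_derive_eq (derB (der_cst (k ^+ 2) y) (derMl mu (der_invX2 y0)))).
by field; rewrite gt_eqF.
Qed.

Let P y := v y * v1 y.

Lemma der_mom y : 0 < y -> is_derive y (1 : R) P (v1 y ^+ 2 + pot y * v y ^+ 2).
Proof.
by move=> y0; apply: (is_derive_eq (derM (dv y0) (dv1 y0))); ring.
Qed.

Lemma mom_nondecr a b : 0 < a -> a <= b -> 0 <= pot a -> P a <= P b.
Proof.
move=> a0 ab Qa.
apply: (@der_nondecr _ P (fun y => v1 y ^+ 2 + pot y * v y ^+ 2)) => //.
  by move=> y /andP[ay _]; apply: der_mom; exact: lt_le_trans ay.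
move=> y /andP[ay _]; rewrite addr_ge0 ?sqr_ge0// mulr_ge0 ?sqr_ge0//.
exact: le_trans (pot_nondecr a0 ay).
Qed.

Lemma der_sq y : 0 < y -> is_derive y (1 : R) (fun y => v y ^+ 2) (2 * P y).
Proof.
by move=> y0; apply: (is_derive_eq (derX2 (dv y0))); rewrite /P; ring.
Qed.

Lemma der_sq1 y : 0 < y ->
  is_derive y (1 : R) (fun y => v1 y ^+ 2) (2 * pot y * P y).
Proof.
by move=> y0; apply: (is_derive_eq (derX2 (dv1 y0))); rewrite /P; ring.
Qed.

(** Gronwall: [G = v^2 + v1^2] satisfies [|G'| <= C G] to the right of [a], so [G y * expR (C * y)]
    is nondecreasing and a zero of [G] at [b] forces one at [a]. *)
Lemma ode_unique a b : 0 < a -> a <= b -> v b = 0 -> v1 b = 0 -> v a = 0.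
Proof.
move=> a0 ab vb v1b.
pose C := 1 + k ^+ 2 + mu / a ^+ 2.
have CQ y : a <= y -> `|1 + pot y| <= C.
  move=> ay; rewrite ler_norml /C; apply/andP; split.
    have := pot_nondecr a0 ay; rewrite /pot.
    have := sqr_ge0 k; lra.
  have y0 : 0 < y by exact: lt_le_trans ay.
  have : 0 <= mu / y ^+ 2 by rewrite divr_ge0 ?ltW ?exprn_gt0.
  have : 0 <= mu / a ^+ 2 by rewrite divr_ge0 ?ltW ?exprn_gt0.
  rewrite /pot; lra.
pose G y := v y ^+ 2 + v1 y ^+ 2.
have dG y : 0 < y -> is_derive y (1 : R) G (2 * (1 + pot y) * P y).
  by move=> y0; apply: (is_derive_eq (derD (der_sq y0) (der_sq1 y0))); ring.
have dE y : is_derive y (1 : R) (fun y => expR (C * y)) (C * expR (C * y)).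
  apply: (is_derive_eq (der_comp (derMl C (der_id y)) (is_derive_expR _))); ring.
have : G a * expR (C * a) <= G b * expR (C * b).
  apply: (@der_nondecr _ (fun y => G y * expR (C * y))
     (fun y => 2 * (1 + pot y) * P y * expR (C * y) + G y * (C * expR (C * y)))) => //.
    by move=> y /andP[ay _]; exact: (derM (dG y (lt_le_trans a0 ay)) (dE y)).
  move=> y /andP[ay _].
  rewrite mulrA -mulrDl mulr_ge0 ?expR_ge0//.
  have {}CQ := CQ _ ay.
  have CP : `|2 * (1 + pot y) * P y| <= G y * C.
    rewrite normrM normrM ger0_norm// mulrAC mulrC [leRHS]mulrC.
    apply: ler_pM => //.
    rewrite /G /P normrM -(real_normK (num_real (v y))) -(real_normK (num_real (v1 y))).
    by rewrite -subr_ge0 (_ : _ - _ = (`|v y| - `|v1 y|) ^+ 2) ?sqr_ge0//; ring.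
  by move: CP; rewrite ler_norml => /andP[]; lra.
rewrite {2}/G vb v1b !expr0n/= addr0 mul0r pmulr_lle0 ?expR_gt0// /G.
move=> h; apply/eqP; rewrite -sqrf_eq0 eq_le sqr_ge0 andbT.
by apply: le_trans h; rewrite lerDl sqr_ge0.
Qed.

(** The derivative is [- pot' * v^2 <= 0] whatever the sign of [pot], so the energy transports a
    lower bound from the turning point back into the oscillating range. *)
Lemma energy_nonincr a b : 0 < a -> a <= b ->
  v1 b ^+ 2 - pot b * v b ^+ 2 <= v1 a ^+ 2 - pot a * v a ^+ 2.
Proof.
move=> a0 ab.
apply: (@der_nonincr _ (fun y => v1 y ^+ 2 - pot y * v y ^+ 2)
   (fun y => - (2 * mu / y ^+ 3) * v y ^+ 2)) => //.
  move=> y /andP[ay _]; have y0 : 0 < y by exact: lt_le_trans ay.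
  by apply: (is_derive_eq (derB (der_sq1 y0) (derM (der_pot y0) (der_sq y0)))); ring.
move=> y /andP[ay _]; have y0 : 0 < y by exact: lt_le_trans ay.
rewrite mulNr oppr_le0 mulr_ge0 ?sqr_ge0// divr_ge0 ?exprn_ge0 ?ltW//.
by rewrite mulr_gt0.
Qed.

(* [S] is an antiderivative of [v^2 / y^2]; its boundedness is the square
   integrability at the cusp. *)
Hypothesis dS : forall y : R, 1 < y -> is_derive y (1 : R) S (v y ^+ 2 / y ^+ 2).
Hypothesis S01 : forall y, 1 < y -> 0 <= S y <= 1.

(** Where [pot >= 0], [P = v v1] is nondecreasing. A positive value [d] would persist, force
    [v^2 >= 2 d (y - b)] and make the integral of [v^2 / y^2] grow like [2 d ln y]. *)
Lemma mom_le0 a : 0 < a -> 0 <= pot a -> P a <= 0.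
Proof.
move=> a0 Qa; rewrite leNgt; apply/negP => d0.
set d := P a in d0.
pose b := Num.max a 2.
have ab : a <= b by rewrite /b le_max lexx.
have b2 : 2 <= b by rewrite /b le_max lexx orbT.
have b0 : 0 < b by lra.
have Qb : 0 <= pot b by exact: le_trans (pot_nondecr a0 ab).
have Pd y : b <= y -> d <= P y.
  by move=> yb; apply: mom_nondecr => //; exact: le_trans yb.
have sq y : b <= y -> 2 * d * (y - b) <= v y ^+ 2.
  move=> yb; rewrite -subr_ge0.
  have : v b ^+ 2 - 2 * d * (b - b) <= v y ^+ 2 - 2 * d * (y - b).
    apply: (@der_nondecr _ (fun y => v y ^+ 2 - 2 * d * (y - b))
        (fun y => 2 * P y - 2 * d)) => //.
      move=> z /andP[bz _]; have z0 : 0 < z by exact: lt_le_trans bz.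
      apply: (is_derive_eq (derB (der_sq z0)
         (derMl (2 * d) (derB (der_id z) (der_cst b z))))); ring.
    by move=> z /andP[/Pd]; lra.
  by apply: le_trans; rewrite subrr mulr0 subr0 sqr_ge0.
(* At this [y], comparing [S] with [2 d (ln y + b / y)], an antiderivative of [2 d (y - b) / y^2],
   gives [S y >= 2]. *)
have [y yb ly] := ln_unbounded (ln b + 1 + d^-1) b.
have y1 : 1 < y by lra.
have : S b - 2 * d * (ln b + b / b) <= S y - 2 * d * (ln y + b / y).
  apply: (@der_nondecr _ (fun y => S y - 2 * d * (ln y + b / y))
      (fun y => v y ^+ 2 / y ^+ 2 - 2 * d * (y^-1 + b * - y ^- 2))) => //.
    move=> z /andP[bz _]; have z1 : 1 < z by lra.
    have z0 : 0 < z by lra.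
    exact: (derB (dS z1) (derMl (2 * d) (derD (is_derive1_ln z0) (derMl b (der_inv z0))))).
  move=> z /andP[bz _]; have z0 : 0 < z by lra.
  rewrite (_ : _ - _ = (v z ^+ 2 - 2 * d * (z - b)) / z ^+ 2); last first.
    by field; rewrite gt_eqF.
  by rewrite divr_ge0 ?sqr_ge0// subr_ge0 sq.
have /andP[_ Sy] := S01 y1.
have /andP[Sb _] := S01 (lt_le_trans (ltr1n _ 2) b2 : 1 < b).
rewrite divff ?gt_eqF//.
have : 0 <= b / y by rewrite divr_ge0 ?ltW//; lra.
move=> by0 h.
have : d * (ln b + 1 + d^-1) <= d * ln y by rewrite ler_wpM2l// ltW.
rewrite mulrDr divff ?gt_eqF//.
have : 0 <= d * (b / y) by rewrite mulr_ge0// ltW.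
lra.
Qed.

Lemma sq_nonincr a b : 0 < a -> a <= b -> 0 <= pot a -> v b ^+ 2 <= v a ^+ 2.
Proof.
move=> a0 ab Qa.
apply: (@der_nonincr _ (fun y => v y ^+ 2) (fun y => 2 * P y)) => //.
  by move=> y /andP[ay _]; apply: der_sq; exact: lt_le_trans ay.
move=> y /andP[ay _]; have y0 : 0 < y by exact: lt_le_trans ay.
by rewrite pmulr_rle0// mom_le0// (le_trans Qa)// pot_nondecr.
Qed.

Lemma sq1_nonincr a b : 0 < a -> a <= b -> 0 <= pot a -> v1 b ^+ 2 <= v1 a ^+ 2.
Proof.
move=> a0 ab Qa.
apply: (@der_nonincr _ (fun y => v1 y ^+ 2) (fun y => 2 * pot y * P y)) => //.
  by move=> y /andP[ay _]; apply: der_sq1; exact: lt_le_trans ay.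
move=> y /andP[ay _]; have y0 : 0 < y by exact: lt_le_trans ay.
have Qy : 0 <= pot y by rewrite (le_trans Qa)// pot_nondecr.
by rewrite mulr_ge0_le0// ?mom_le0// mulr_ge0.
Qed.

(** The expression is [P'], and a positive lower bound on it would make [P] positive after a finite
    distance, against [mom_le0]. Both bounds on [v1 / v] below contradict this. *)
Lemma mom_growth m a : 0 < a -> 0 <= pot a -> 0 < m ->
  ~ (forall y, a <= y -> m <= v1 y ^+ 2 + pot y * v y ^+ 2).
Proof.
move=> a0 Qa m0 h.
pose y := a + (1 - P a) / m.
have Pa : P a <= 0 by exact: mom_le0.
have ay : a <= y by rewrite lerDl divr_ge0// ?ltW//; lra.
have y0 : 0 < y by exact: lt_le_trans ay.
have : P a - m * a <= P y - m * y.
  apply: (@der_nondecr _ (fun y => P y - m * y)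
    (fun y => v1 y ^+ 2 + pot y * v y ^+ 2 - m)) => //.
    move=> z /andP[az _]; have z0 : 0 < z by exact: lt_le_trans az.
    by apply: (is_derive_eq (derB (der_mom z0) (derMl m (der_id z)))); rewrite mulr1.
  by move=> z /andP[/h]; rewrite subr_ge0.
rewrite {2}/y mulrDr mulrCA divff ?gt_eqF// mulr1.
have : P y <= 0 by apply: mom_le0 => //; rewrite (le_trans Qa)// pot_nondecr.
lra.
Qed.

(** A positive value of [kap^2 v^2 - v1^2] could only increase, since its derivative is
    [2 (pot - kap^2) * - P >= 0], and it bounds [P'] from below. *)
Lemma log_deriv_ge kap a : 0 < a -> 0 <= pot a -> kap ^+ 2 <= pot a ->
  kap ^+ 2 * v a ^+ 2 <= v1 a ^+ 2.
Proof.
move=> a0 Qa kQ; rewrite leNgt; apply/negP; rewrite -subr_gt0 => m0.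
apply: (mom_growth a0 Qa m0) => y ay; have y0 : 0 < y by exact: lt_le_trans ay.
have Qy := pot_nondecr a0 ay.
have : kap ^+ 2 * v a ^+ 2 - v1 a ^+ 2 <= kap ^+ 2 * v y ^+ 2 - v1 y ^+ 2.
  apply: (@der_nondecr _ (fun y => kap ^+ 2 * v y ^+ 2 - v1 y ^+ 2)
    (fun y => 2 * (pot y - kap ^+ 2) * - P y)) => //.
    move=> z /andP[az _]; have z0 : 0 < z by exact: lt_le_trans az.
    by apply: (is_derive_eq (derB (derMl _ (der_sq z0)) (der_sq1 z0))); ring.
  move=> z /andP[az _]; have z0 : 0 < z by exact: lt_le_trans az.
  have Qz := pot_nondecr a0 az.
  rewrite mulr_ge0 ?oppr_ge0 ?mom_le0//; last exact: le_trans Qz.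
  by rewrite mulr_ge0// subr_ge0 (le_trans kQ).
move/le_trans; apply.
have := sqr_ge0 (v1 y).
have : kap ^+ 2 * v y ^+ 2 <= pot y * v y ^+ 2.
  by rewrite ler_wpM2r ?sqr_ge0// (le_trans kQ).
lra.
Qed.

Lemma log_deriv_le a : 0 < a -> 0 <= pot a -> v1 a ^+ 2 <= k ^+ 2 * v a ^+ 2.
Proof.
move=> a0 Qa; rewrite leNgt; apply/negP; rewrite -subr_gt0 => m0.
apply: (mom_growth a0 Qa m0) => y ay; have y0 : 0 < y by exact: lt_le_trans ay.
have Qy : 0 <= pot y by rewrite (le_trans Qa)// pot_nondecr.
have : v1 a ^+ 2 - k ^+ 2 * v a ^+ 2 <= v1 y ^+ 2 - k ^+ 2 * v y ^+ 2.
  apply: (@der_nondecr _ (fun y => v1 y ^+ 2 - k ^+ 2 * v y ^+ 2)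
    (fun y => 2 * (mu / y ^+ 2) * - P y)) => //.
    move=> z /andP[az _]; have z0 : 0 < z by exact: lt_le_trans az.
    by apply: (is_derive_eq (derB (der_sq1 z0) (derMl _ (der_sq z0)))); rewrite /pot; ring.
  move=> z /andP[az _]; have z0 : 0 < z by exact: lt_le_trans az.
  rewrite mulr_ge0 ?oppr_ge0 ?mom_le0//; last by rewrite (le_trans Qa)// pot_nondecr.
  by rewrite mulr_ge0// divr_ge0 ?ltW ?exprn_gt0.
move/le_trans; apply.
have : 0 <= k ^+ 2 * v y ^+ 2 by rewrite mulr_ge0 ?sqr_ge0.
have : 0 <= pot y * v y ^+ 2 by rewrite mulr_ge0 ?sqr_ge0.
lra.
Qed.

Lemma der_expR (c y : R) :
  is_derive y (1 : R) (fun y => expR (c * y)) (c * expR (c * y)).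
Proof.
apply: (is_derive_eq (der_comp (derMl c (der_id y)) (is_derive_expR _))); ring.
Qed.

Lemma der_sq_exp (c y : R) : 0 < y -> is_derive y (1 : R)
  (fun y => v y ^+ 2 * expR (c * y)) ((2 * P y + c * v y ^+ 2) * expR (c * y)).
Proof.
move=> y0; apply: (is_derive_eq (derM (der_sq y0) (der_expR c y))); ring.
Qed.

Lemma expRB_ratio (c a b : R) : expR (- (c * (b - a))) = expR (c * a) / expR (c * b).
Proof. by rewrite -expRN -expRD; congr expR; ring. Qed.

Lemma sq_decay kap a b : 0 < a -> a <= b -> 0 <= kap -> kap ^+ 2 <= pot a ->
  v b ^+ 2 <= expR (- (2 * kap * (b - a))) * v a ^+ 2.
Proof.
move=> a0 ab kap0 kQ.
have Qa : 0 <= pot a by apply: le_trans kQ; rewrite sqr_ge0.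
rewrite expRB_ratio mulrAC ler_pdivlMr ?expR_gt0// [leRHS]mulrC.
apply: (@der_nonincr _ (fun y => v y ^+ 2 * expR (2 * kap * y))
  (fun y => (2 * P y + 2 * kap * v y ^+ 2) * expR (2 * kap * y))) => //.
  by move=> y /andP[ay _]; apply: der_sq_exp; exact: lt_le_trans ay.
move=> y /andP[ay _]; have y0 : 0 < y by exact: lt_le_trans ay.
have Qy := pot_nondecr a0 ay.
rewrite pmulr_lle0 ?expR_gt0// -mulrA -mulrDr pmulr_rle0//.
(* This is [kap |v| <= |v1|] multiplied by [|v|], the sign of [P] being known; it is checked after
   squaring. *)
suff : kap * v y ^+ 2 <= - P y by lra.
have Py : P y <= 0 by apply: mom_le0 => //; exact: le_trans Qy.
have kv : 0 <= kap * v y ^+ 2 by rewrite mulr_ge0 ?sqr_ge0.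
rewrite -ler_sqr ?nnegrE ?oppr_ge0//.
rewrite sqrrN /P (_ : (kap * _) ^+ 2 = v y ^+ 2 * (kap ^+ 2 * v y ^+ 2)); last by ring.
rewrite exprMn ler_wpM2l ?sqr_ge0//.
by apply: log_deriv_ge => //; exact: le_trans Qy.
Qed.

Lemma sq_decay_le a b : 0 < a -> a <= b -> 0 <= pot a ->
  expR (- (2 * k * (b - a))) * v a ^+ 2 <= v b ^+ 2.
Proof.
move=> a0 ab Qa.
rewrite expRB_ratio mulrAC ler_pdivrMr ?expR_gt0// [leLHS]mulrC.
apply: (@der_nondecr _ (fun y => v y ^+ 2 * expR (2 * k * y))
  (fun y => (2 * P y + 2 * k * v y ^+ 2) * expR (2 * k * y))) => //.
  by move=> y /andP[ay _]; apply: der_sq_exp; exact: lt_le_trans ay.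
move=> y /andP[ay _]; have y0 : 0 < y by exact: lt_le_trans ay.
have Qy : 0 <= pot y by rewrite (le_trans Qa)// pot_nondecr.
rewrite mulr_ge0 ?expR_ge0// -mulrA -mulrDr mulr_ge0//.
suff : - P y <= k * v y ^+ 2 by lra.
have Py : P y <= 0 by exact: mom_le0.
have kv : 0 <= k * v y ^+ 2 by rewrite mulr_ge0 ?sqr_ge0.
rewrite -ler_sqr ?nnegrE ?oppr_ge0//.
rewrite sqrrN /P (_ : (k * _) ^+ 2 = v y ^+ 2 * (k ^+ 2 * v y ^+ 2)); last by ring.
rewrite exprMn ler_wpM2l ?sqr_ge0//.
exact: log_deriv_le.
Qed.

(** By [log_deriv_le] the zero is double; uniqueness then kills [v] to the left of [b], and
    monotonicity of [v^2] kills it to the right. *)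
Lemma zero_vanishes b : 0 < b -> 0 <= pot b -> v b = 0 -> forall a, 0 < a -> v a = 0.
Proof.
move=> b0 Qb vb a a0; have [ab|/ltW ba] := leP a b.
  apply: (ode_unique a0 ab vb); apply/eqP; rewrite -sqrf_eq0 eq_le sqr_ge0 andbT.
  by rewrite (le_trans (log_deriv_le b0 Qb))// vb expr0n mulr0.
apply/eqP; rewrite -sqrf_eq0 eq_le sqr_ge0 andbT.
by rewrite (le_trans (sq_nonincr b0 ba Qb))// vb expr0n.
Qed.

End BesselEquation.

(** * Sign changes and critical points below the turning point *)

Section Oscillation.
Context {R : realType} (k mu : R) (v v1 : R -> R).
Implicit Types (a b c y kap : R).
Hypotheses (mu0 : 0 < mu).
Let q := @pot R k mu.

Hypothesis dv : forall y : R, 0 < y -> is_derive y (1 : R) v (v1 y).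
Hypothesis dv1 : forall y : R, 0 < y -> is_derive y (1 : R) v1 (q y * v y).

(* The Wronskian of [v] with [sin (kap (y - a))] is monotone. *)
Lemma sturm_zero a kap : 0 < a -> 0 < kap -> kap ^+ 2 <= - q (a + pi / kap) ->
  (forall y, a <= y <= a + pi / kap -> 0 <= v y) -> v a = 0.
Proof.
move=> a0 kap0 kq v0; set b := a + pi / kap in kq v0.
have ab : a <= b by rewrite lerDl divr_ge0 ?pi_ge0 ?ltW.
pose s y := sin (kap * (y - a)); pose s' y := kap * cos (kap * (y - a)).
have darg y : is_derive y (1 : R) (fun y => kap * (y - a)) kap.
  by apply: (is_derive_eq (derMl kap (derB (der_id y) (der_cst a y)))); ring.
have ds y : is_derive y (1 : R) s (s' y).
  by apply: (is_derive_eq (der_comp (darg y) (is_derive_sin _))); rewrite mulrC.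
have ds' y : is_derive y (1 : R) s' (- kap ^+ 2 * s y).
  apply: (is_derive_eq (derMl kap (der_comp (darg y) (is_derive_cos _)))).
  by rewrite /s; ring.
have : v1 b * s b - v b * s' b <= v1 a * s a - v a * s' a.
  apply: (@der_nonincr _ (fun y => v1 y * s y - v y * s' y)
    (fun y => (q y + kap ^+ 2) * (v y * s y))) => //.
    move=> y /andP[ay _]; have y0 : 0 < y by exact: lt_le_trans ay.
    by apply: (is_derive_eq (derB (derM (dv1 y0) (ds y)) (derM (dv y0) (ds' y)))); ring.
  move=> y /andP[ay yb]; have y0 : 0 < y by exact: lt_le_trans ay.
  rewrite mulr_le0_ge0//.
    by have := pot_nondecr k mu0 y0 yb; rewrite -/q; lra.
  rewrite mulr_ge0 ?v0 ?ay ?yb//.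
  apply: sin_ge0_pi; rewrite mulr_ge0 ?subr_ge0 ?(ltW kap0)//=.
  by rewrite mulrC -ler_pdivlMr// lerBlDl.
rewrite /s /s' subrr mulr0 sin0 cos0 mulr0 mulr1.
have -> : kap * (b - a) = pi by rewrite /b; field; rewrite gt_eqF.
rewrite sinpi cospi mulr0 !sub0r mulrN1 mulrN opprK => h.
have va := v0 a; have vb := v0 b; rewrite !lexx ab in va vb.
have {}va := va isT; have {}vb := vb isT.
apply/eqP; rewrite eq_le va andbT -(pmulr_lle0 _ kap0).
have : 0 <= v b * kap by rewrite mulr_ge0 ?(ltW kap0).
lra.
Qed.

(** If [v >= 0] throughout, [sturm_zero] started at a quarter of the interval gives a zero there. It
    is an interior minimum, so [v1] vanishes too, against the positive energy. *)
Lemma sturm_neg a kap : 0 < a -> 0 < kap -> kap ^+ 2 <= - q (a + 2 * pi / kap) ->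
  (forall y, a <= y <= a + 2 * pi / kap -> 0 < v1 y ^+ 2 - q y * v y ^+ 2) ->
  exists2 y, a <= y <= a + 2 * pi / kap & v y < 0.
Proof.
move=> a0 kap0 kq H; apply: contrapT => hn.
have v0 y : a <= y <= a + 2 * pi / kap -> 0 <= v y.
  by move=> hy; rewrite leNgt; apply/negP => vy; apply: hn; exists y.
have pk : 0 < pi / kap by rewrite divr_gt0 ?pi_gt0.
have e2 : 2 * pi / kap = 2 * (pi / kap) by ring.
rewrite e2 in kq H v0.
pose c := a + pi / kap / 2.
have ac : a < c by rewrite /c; lra.
have c0 : 0 < c by exact: lt_trans ac.
have cb : c + pi / kap < a + 2 * (pi / kap) by rewrite /c; lra.
have vc : v c = 0.
  apply: (@sturm_zero c kap) => //.
    have h0 : 0 < c + pi / kap by lra.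
    have := pot_nondecr k mu0 h0 (ltW cb); rewrite -/q; lra.
  by move=> y /andP[cy yb]; apply: v0; apply/andP; split; lra.
have v1c : v1 c = 0.
  apply/eqP; rewrite -oppr_eq0; apply/eqP.
  apply: (@der_interior_max _ (fun y => - v y) (fun y => - v1 y) a (c + pi / kap)).
  - by apply/andP; split => //; lra.
  - by move=> y /andP[ay _]; apply: derN; apply: dv; exact: lt_le_trans ay.
  - move=> y /andP[ay yb]; rewrite vc oppr0 oppr_le0 v0//.
    by apply/andP; split => //; lra.
have /H : a <= c <= a + 2 * (pi / kap) by apply/andP; split; lra.
by rewrite vc v1c !expr0n/= mulr0 subr0 ltxx.
Qed.

End Oscillation.

Section CriticalPoints.
Context {R : realType} (k mu : R).
Implicit Types (a b c y kap : R).
Hypotheses (mu0 : 0 < mu).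
Let q := @pot R k mu.

Lemma sturm_pos (v v1 : R -> R) a kap :
  (forall y : R, 0 < y -> is_derive y (1 : R) v (v1 y)) ->
  (forall y : R, 0 < y -> is_derive y (1 : R) v1 (q y * v y)) ->
  0 < a -> 0 < kap -> kap ^+ 2 <= - q (a + 2 * pi / kap) ->
  (forall y, a <= y <= a + 2 * pi / kap -> 0 < v1 y ^+ 2 - q y * v y ^+ 2) ->
  exists2 y, a <= y <= a + 2 * pi / kap & 0 < v y.
Proof.
move=> dv dv1 a0 kap0 kq H.
have dv' (y : R) : 0 < y -> is_derive y (1 : R) (fun y => - v y) (- v1 y).
  by move=> y0; apply: derN; exact: dv.
have dv1' (y : R) : 0 < y -> is_derive y (1 : R) (fun y => - v1 y) (q y * - v y).
  by move=> y0; rewrite mulrN; apply: derN; exact: dv1.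
have [|y hy] := sturm_neg mu0 dv' dv1' a0 kap0 kq.
  by move=> y /H; rewrite !sqrrN.
by rewrite oppr_lt0; exists y.
Qed.

(** Three consecutive windows of length [2 pi / kap] contain a negative, a positive and a negative
    value; the maximum between the two negative ones is positive, hence interior. *)
Lemma critical_pos (v v1 : R -> R) a kap :
  (forall y : R, 0 < y -> is_derive y (1 : R) v (v1 y)) ->
  (forall y : R, 0 < y -> is_derive y (1 : R) v1 (q y * v y)) ->
  0 < a -> 0 < kap -> kap ^+ 2 <= - q (a + 6 * pi / kap) ->
  (forall y, a <= y <= a + 6 * pi / kap -> 0 < v1 y ^+ 2 - q y * v y ^+ 2) ->
  exists c, [/\ a <= c <= a + 6 * pi / kap, v1 c = 0 & 0 < v c].
Proof.
move=> dv dv1 a0 kap0.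
have e2 : 2 * pi / kap = 2 * (pi / kap) by ring.
have -> : 6 * pi / kap = 6 * (pi / kap) by ring.
set L := pi / kap in e2 *; have L0 : 0 < L by rewrite divr_gt0 ?pi_gt0.
move=> kq H.
have kq' y : 0 < y -> y <= a + 6 * L -> kap ^+ 2 <= - q y.
  by move=> y0 yb; have := pot_nondecr k mu0 y0 yb; rewrite -/q; lra.
have neg z : a <= z -> z <= a + 4 * L -> exists2 y, z <= y <= z + 2 * L & v y < 0.
  move=> az za; have := @sturm_neg _ k mu v v1 mu0 dv dv1 z kap.
  rewrite e2; apply => //; [lra|apply: kq'; lra|].
  by move=> y /andP[zy yz]; apply: H; apply/andP; split; lra.
have [||y1 /andP[ay1 y1b] vy1] := neg a; [lra|lra|].
have [||y3 /andP[ay3 y3b] vy3] := neg (a + 4 * L); [lra|lra|].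
have [y2 /andP[ay2 y2b] vy2] : exists2 y, a + 2 * L <= y <= a + 2 * L + 2 * L & 0 < v y.
  have := @sturm_pos v v1 (a + 2 * L) kap dv dv1.
  rewrite e2; apply => //; [lra|apply: kq'; lra|].
  by move=> y /andP[zy yz]; apply: H; apply/andP; split; lra.
have y13 : y1 <= y3 by lra.
have dv13 y : y1 <= y <= y3 -> is_derive y (1 : R) v (v1 y).
  by move=> /andP[yy _]; apply: dv; lra.
have [c] := EVT_max y13 (der_within dv13).
rewrite in_itv/= => /andP[y1c cy3] cmax.
have vc : 0 < v c.
  by rewrite (lt_le_trans vy2)// cmax// in_itv/=; apply/andP; split; lra.
exists c; split => //; first by apply/andP; split; lra.
have cmax' y : y1 <= y <= y3 -> v y <= v c by move=> hy; apply: cmax; rewrite in_itv.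
apply: (der_interior_max _ dv13 cmax').
rewrite !lt_neqAle y1c cy3 !andbT; apply/andP; split.
  by apply/eqP => e; move: vc; rewrite -e ltNge (ltW vy1).
by apply/eqP => e; move: vc; rewrite e ltNge (ltW vy3).
Qed.

Lemma critical_sign (s : bool) (v v1 : R -> R) a kap :
  (forall y : R, 0 < y -> is_derive y (1 : R) v (v1 y)) ->
  (forall y : R, 0 < y -> is_derive y (1 : R) v1 (q y * v y)) ->
  0 < a -> 0 < kap -> kap ^+ 2 <= - q (a + 6 * pi / kap) ->
  (forall y, a <= y <= a + 6 * pi / kap -> 0 < v1 y ^+ 2 - q y * v y ^+ 2) ->
  exists c, [/\ a <= c <= a + 6 * pi / kap, v1 c = 0 & 0 < (-1) ^+ s * v c].
Proof.
move=> dv dv1 a0 kap0 kq H; case: s.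
  have dv' (y : R) : 0 < y -> is_derive y (1 : R) (fun y => - v y) (- v1 y).
    by move=> y0; apply: derN; exact: dv.
  have dv1' (y : R) : 0 < y -> is_derive y (1 : R) (fun y => - v1 y) (q y * - v y).
    by move=> y0; rewrite mulrN; apply: derN; exact: dv1.
  have [|c [h1 h2 h3]] := critical_pos dv' dv1' a0 kap0 kq.
    by move=> y /H; rewrite !sqrrN.
  exists c; split => //; last by rewrite mulN1r.
  by apply/eqP; rewrite -oppr_eq0 h2.
have [c [h1 h2 h3]] := @critical_pos v v1 a kap dv dv1 a0 kap0 kq H.
by exists c; split => //; rewrite mul1r.
Qed.

End CriticalPoints.

(** * Vanishing of the constant term *)

Section ConstantTerm.
Context {R : realType} (t : R) (v v1 S : R -> R).
Hypothesis t0 : 0 < t.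
Let mu := 4^-1 + t ^+ 2.
Hypothesis dv : forall y : R, 0 < y -> is_derive y (1 : R) v (v1 y).
Hypothesis dv1 : forall y : R, 0 < y -> is_derive y (1 : R) v1 (pot 0 mu y * v y).
Hypothesis dS : forall y : R, 1 < y -> is_derive y (1 : R) S (v y ^+ 2 / y ^+ 2).
Hypothesis S01 : forall y : R, 1 < y -> 0 <= S y <= 1.

(* In the variable [s = ln y], the function [g = v / sqrt y] satisfies
   [g'' + t^2 g = 0]; [G] is its (constant) energy and [g g'] is bounded, while
   square integrability bounds the integral of [g^2]. *)
Lemma constant_term_eq0 (y : R) : 0 < y -> v y = 0.
Proof.
move=> y_gt0.
pose G (y : R) := y * v1 y ^+ 2 - v y * v1 y + mu * (v y ^+ 2 / y).
have potE (z : R) : 0 < z -> pot 0 mu z = - (mu / z ^+ 2).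
  by move=> _; rewrite /pot expr0n/= sub0r.
have dG (z : R) : 0 < z -> is_derive z (1 : R) G 0.
  move=> z0; apply: (is_derive_eq (derD (derB (derM (der_id z) (derX2 (dv1 z0)))
     (derM (dv z0) (dv1 z0))) (derMl mu (derM (derX2 (dv z0)) (der_inv z0))))).
  by rewrite potE//; field; rewrite gt_eqF.
have Gcst a b : 0 < a -> a <= b -> G a = G b.
  move=> a0 ab; apply/eqP; rewrite eq_le; apply/andP; split.
    by apply: (@der_nondecr _ G (fun=> 0)) => // z /andP[az _]; apply: dG; exact: lt_le_trans az.
  by apply: (@der_nonincr _ G (fun=> 0)) => // z /andP[az _]; apply: dG; exact: lt_le_trans az.
(* Completing the square leaves the coefficient [mu - 1/4 = t^2 > 0], so [G] controls [v^2]. *)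
have sosE z : 0 < z -> G z = z * (v1 z - v z / (2 * z)) ^+ 2 + t ^+ 2 * (v z ^+ 2 / z).
  by move=> z0; rewrite /G /mu; field; rewrite gt_eqF.
have Gge z : 0 < z -> t ^+ 2 * (v z ^+ 2 / z) <= G z.
  by move=> z0; rewrite sosE// lerDr mulr_ge0 ?sqr_ge0// ltW.
pose P (z : R) := v z * v1 z - v z ^+ 2 * z^-1 / 2.
have PG z : 0 < z -> 2 * t * P z <= G z.
  move=> z0; rewrite -subr_ge0.
  rewrite (_ : _ - _ = (z * (v1 z - v z / (2 * z)) - t * v z) ^+ 2 / z).
    by rewrite divr_ge0 ?sqr_ge0// ltW.
  by rewrite sosE// /P; field; rewrite gt_eqF.
have dP (z : R) : 0 < z -> is_derive z (1 : R) P (G z / z - 2 * t ^+ 2 * (v z ^+ 2 / z ^+ 2)).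
  move=> z0; apply: (is_derive_eq (derB (derM (dv z0) (dv1 z0))
     (derM (derM (derX2 (dv z0)) (der_inv z0)) (der_cst (2^-1) z)))).
  by rewrite potE// /G /mu; field; rewrite gt_eqF.
have main : G y <= 0.
  rewrite leNgt; apply/negP => g0; set g := G y in g0.
  pose b := Num.max y 2.
  have yb : y <= b by rewrite /b le_max lexx.
  have b2 : 2 <= b by rewrite /b le_max lexx orbT.
  have b0 : 0 < b by lra.
  have Gg z : b <= z -> G z = g by move=> bz; rewrite /g -(Gcst y z)//; exact: le_trans bz.
  (* Chosen so that [g ln Y] exceeds by [g] all that the bounds [P Y <= g / (2 t)] and [S Y <= 1]
     allow. *)
  pose C := ln b + (g / (2 * t) - P b + 2 * t ^+ 2) / g + 1.
  have [Y bY lY] := ln_unbounded C b.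
  have : P b + 2 * t ^+ 2 * S b - g * ln b <= P Y + 2 * t ^+ 2 * S Y - g * ln Y.
    apply: (@der_nondecr _ (fun z => P z + 2 * t ^+ 2 * S z - g * ln z) (fun=> 0)) => //.
    move=> z /andP[bz _]; have z1 : 1 < z by lra.
    have z0 : 0 < z by lra.
    apply: (is_derive_eq (derB (derD (dP z z0) (derMl (2 * t ^+ 2) (dS z1)))
       (derMl g (is_derive1_ln z0)))).
    by rewrite Gg//; field; rewrite gt_eqF.
  have PY : P Y <= g / (2 * t).
    rewrite ler_pdivlMr ?mulr_gt0// mulrC -(Gg Y)//; apply: PG; lra.
  have /andP[_ SY] : 0 <= S Y <= 1 by apply: S01; lra.
  have /andP[Sb _] : 0 <= S b <= 1 by apply: S01; lra.
  have tt : 0 < 2 * t ^+ 2 by rewrite mulr_gt0// exprn_gt0.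
  have h1 : 2 * t ^+ 2 * S Y <= 2 * t ^+ 2 by rewrite ler_piMr// ltW.
  have h2 : 0 <= 2 * t ^+ 2 * S b by rewrite mulr_ge0// ltW.
  have : g * C <= g * ln Y by rewrite ler_wpM2l// ltW.
  have -> : g * C = g * ln b + (g / (2 * t) - P b + 2 * t ^+ 2) + g.
    by rewrite /C; field; rewrite !gt_eqF.
  lra.
apply/eqP; rewrite -sqrf_eq0 eq_le sqr_ge0 andbT.
have := le_trans (Gge y y_gt0) main.
by rewrite pmulr_rle0 ?exprn_gt0// pmulr_lle0 ?invr_gt0.
Qed.

End ConstantTerm.

(** * Integrals over one period, through antiderivatives *)

Section UnitIntegral.
Context {R : realType}.
Implicit Types (f g F : R -> R) (a b s : R).
Local Notation mu := (@lebesgue_measure R).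

Definition int01 f : R := \int[mu]_(x in `[0, 1]) f x.

Lemma continuous_integrable f a b : continuous f ->
  mu.-integrable `[a, b] (EFin \o f).
Proof.
move=> cf; apply: continuous_compact_integrable; first exact: segment_compact.
exact: continuous_subspaceT.
Qed.

Lemma int_antider f F a b : a < b -> continuous f ->
  (forall x : R, a <= x <= b -> is_derive x (1 : R) F (f x)) ->
  \int[mu]_(x in `[a, b]) f x = F b - F a.
Proof.
move=> ab cf dF; rewrite /Rintegral (@continuous_FTC2 _ f F)//.
- exact: continuous_subspaceT.
- split.
  + by move=> x; rewrite in_itv/= => /andP[ax xb]; case: (dF x) => //; rewrite !ltW.
  + apply: cvg_at_right_filter; apply: (@der_continuous _ _ (f a)).
    by apply: dF; rewrite lexx ltW.
  + apply: cvg_at_left_filter; apply: (@der_continuous _ _ (f b)).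
    by apply: dF; rewrite lexx ltW.
- move=> x; rewrite in_itv/= => /andP[ax xb].
  have h : a <= x <= b by rewrite !ltW.
  by rewrite derive1E; have [_ ->] := dF x h.
Qed.

(** The base point lies strictly to the left so that the derivative is two-sided; the uses take
    [a = -1], which covers [[0, 1]] and [[- 1/2, 1/2]]. *)
Lemma antider_exists f a : continuous f ->
  exists F, forall x : R, a < x -> is_derive x (1 : R) F (f x).
Proof.
move=> cf; exists (fun x => \int[mu]_(t in `[a, x]) f t) => x ax.
have xx : x < x + 1 by rewrite ltrDl.
have [d1 d2] := @continuous_FTC1_closed R f a x (x + 1) xx
  (continuous_integrable _ _ cf) ax (cf x).
by split; [exact: d1|rewrite -derive1E; exact: d2].
Qed.

Lemma int01_antider f F : continuous f ->
  (forall x : R, 0 <= x <= 1 -> is_derive x (1 : R) F (f x)) -> int01 f = F 1 - F 0.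
Proof. by move=> cf dF; apply: int_antider. Qed.

Lemma eq_int01 f g : (forall x, 0 <= x <= 1 -> f x = g x) -> int01 f = int01 g.
Proof.
by move=> fg; apply: eq_Rintegral => x; rewrite inE/= in_itv/=; exact: fg.
Qed.

Lemma int01D f g : continuous f -> continuous g ->
  int01 (fun x => f x + g x) = int01 f + int01 g.
Proof. by move=> cf cg; rewrite /int01 RintegralD//; exact: continuous_integrable. Qed.

Lemma int01B f g : continuous f -> continuous g ->
  int01 (fun x => f x - g x) = int01 f - int01 g.
Proof. by move=> cf cg; rewrite /int01 RintegralB//; exact: continuous_integrable. Qed.

Lemma int01Z (c : R) f : continuous f -> int01 (fun x => c * f x) = c * int01 f.
Proof. by move=> cf; rewrite /int01 RintegralZl//; exact: continuous_integrable. Qed.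

Lemma int01_cst (c : R) : int01 (fun=> c) = c.
Proof.
have dF (x : R) : 0 <= x <= 1 -> is_derive x (1 : R) (fun x => c * x) c.
  by move=> _; apply: (is_derive_eq (derMl c (der_id x))); rewrite mulr1.
have cc : continuous (fun _ : R => c) by exact: cst_continuous.
by rewrite (int01_antider cc dF) mulr1 mulr0 subr0.
Qed.

Lemma int01_sum (I : Type) (r : seq I) (F : I -> R -> R) :
  (forall i, continuous (F i)) ->
  int01 (fun x => \sum_(i <- r) F i x) = \sum_(i <- r) int01 (F i).
Proof.
move=> cF; elim: r => [|i r IH].
  by under [in LHS]eq_fun do rewrite big_nil; rewrite big_nil int01_cst.
under [in LHS]eq_fun do rewrite big_cons.
by rewrite big_cons int01D// ?IH//; exact: cts_sum.
Qed.

Lemma le_int01 f g : continuous f -> continuous g ->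
  (forall x, 0 <= x <= 1 -> f x <= g x) -> int01 f <= int01 g.
Proof.
by move=> cf cg fg; apply: le_Rintegral => //; exact: continuous_integrable.
Qed.

Lemma int01_norm_le f (M : R) : continuous f ->
  (forall x, 0 <= x <= 1 -> `|f x| <= M) -> `|int01 f| <= M.
Proof.
move=> cf fM; rewrite ler_norml; apply/andP; split.
  rewrite -[leLHS]int01_cst; apply: le_int01 => //; first exact: cst_continuous.
  by move=> x /fM; rewrite ler_norml => /andP[].
rewrite -[leRHS]int01_cst; apply: le_int01 => //; first exact: cst_continuous.
by move=> x /fM; rewrite ler_norml => /andP[].
Qed.

Section Periodic.
Variable f : R -> R.
Hypotheses (cf : continuous f) (pf : forall x, f (x + 1) = f x).

Lemma periodic_nat x n : f (x + n%:R) = f x.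
Proof.
by elim: n => [|n IH]; rewrite ?addr0// -natr1 addrA pf.
Qed.

Lemma affine_continuous (c s : R) : continuous (fun x : R => f (c * x + s)).
Proof.
move=> x; apply: (@continuous_comp _ _ _ (fun x => c * x + s) f); last exact: cf.
by apply: continuousD; [exact: mulrl_continuous|exact: cst_continuous].
Qed.

Lemma der_affine F (c s x : R) : (forall x : R, -1 < x -> is_derive x (1 : R) F (f x)) ->
  -1 < c * x + s ->
  is_derive x (1 : R) (fun x => F (c * x + s)) (c * f (c * x + s)).
Proof.
move=> dF h; have dl : is_derive x (1 : R) (fun x => c * x + s) c.
  by apply: (is_derive_eq (derD (derMl c (der_id x)) (der_cst s x))); ring.
by apply: (is_derive_eq (der_comp dl (dF _ h))); rewrite mulrC.
Qed.

Lemma int01_affine F (c s : R) : (forall x : R, -1 < x -> is_derive x (1 : R) F (f x)) ->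
  0 < c -> -1 < s -> int01 (fun x => f (c * x + s)) = c^-1 * (F (c + s) - F s).
Proof.
move=> dF c0 s1.
have dG (x : R) : 0 <= x <= 1 ->
    is_derive x (1 : R) (fun x => c^-1 * F (c * x + s)) (f (c * x + s)).
  move=> /andP[x0 _]; have h : -1 < c * x + s.
    by have : 0 <= c * x; [rewrite mulr_ge0// ltW|lra].
  apply: (is_derive_eq (derMl c^-1 (der_affine dF h))).
  by rewrite mulrA mulVf ?mul1r// gt_eqF.
rewrite (int01_antider _ dG); last exact: affine_continuous.
by rewrite mulr1 mulr0 add0r mulrBr.
Qed.

Lemma antider_period F (s : R) : (forall x : R, -1 < x -> is_derive x (1 : R) F (f x)) ->
  0 <= s -> F (1 + s) - F s = F 1 - F 0.
Proof.
move=> dF s0.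
have dD (x : R) : 0 <= x <= s -> is_derive x (1 : R) (fun x => F (1 * x + 1) - F (1 * x + 0)) 0.
  move=> /andP[x0 _]; have h1 : -1 < 1 * x + 1 by lra.
  have h2 : -1 < 1 * x + 0 by lra.
  apply: (is_derive_eq (derB (der_affine dF h1) (der_affine dF h2))).
  by rewrite !mul1r addr0 pf subrr.
have [c _] := der_mvt s0 dD.
rewrite mul0r !mul1r !addr0 add0r [s + 1]addrC => h.
by apply/eqP; rewrite -subr_eq0 h.
Qed.

Lemma int01_shift (s : R) : 0 <= s -> int01 (fun x => f (x + s)) = int01 f.
Proof.
move=> s0; have [F dF] := antider_exists (-1) cf.
have e (u : R) : (fun x => f (x + u)) = (fun x => f (1 * x + u)).
  by apply/funext => x; rewrite mul1r.
rewrite e int01_affine//; last by lra.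
rewrite invr1 mul1r antider_period// -[in RHS](funext (fun x => congr1 f (addr0 x))).
by rewrite e int01_affine// ?invr1 ?mul1r ?addr0// ltrN10.
Qed.

Lemma int01_dilate (a : nat) : (0 < a)%N -> int01 (fun x => f (a%:R * x)) = int01 f.
Proof.
move=> a0; have [F dF] := antider_exists (-1) cf.
have e (u : R) : (fun x => f (u * x)) = (fun x => f (u * x + 0)).
  by apply/funext => x; rewrite addr0.
rewrite e int01_affine// ?ltr0n ?ltrN10//.
rewrite -[in RHS](funext (fun x => congr1 f (mul1r x))).
rewrite e int01_affine// ?ltr0n ?ltrN10// !addr0 invr1 mul1r.
have -> : F a%:R - F 0 = a%:R * (F 1 - F 0).
  elim: a {a0} => [|a IH]; first by rewrite mul0r subrr.
  rewrite -natr1 mulrDl mul1r -IH -(antider_period dF (ler0n _ a)) addrC.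
  rewrite [1 + _]addrC; ring.
by rewrite mulKf// pnatr_eq0 -lt0n.
Qed.

End Periodic.

(** The point [x'] is chosen before [f], so that one [x'] can serve a slice of [phi] and [cosn 1] at
    the same time. *)
Lemma even_periodic_reduce (x : R) : exists2 x', 0 <= x' <= 2^-1 &
  forall f : R -> R, (forall x, f (x + 1) = f x) -> (forall x, f (- x) = f x) -> f x = f x'.
Proof.
wlog x0 : x / 0 <= x.
  move=> H; have [/H//|/ltW x0] := leP 0 x.
  have [|x' hx' hf] := H (- x); first by rewrite oppr_ge0.
  by exists x' => // f pf ef; rewrite -ef; exact: hf.
have /andP[h1 h2] := truncn_itv x0; set n := Num.truncn x in h1 h2.
rewrite -natr1 in h2.
have e (f : R -> R) : (forall x, f (x + 1) = f x) -> f x = f (x - n%:R).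
  by move=> pf; rewrite -[RHS](periodic_nat pf _ n) subrK.
have [h3|h3] := leP (x - n%:R) 2^-1.
  by exists (x - n%:R) => [|f pf _]; [apply/andP; split; lra|exact: e].
exists (1 - (x - n%:R)) => [|f pf ef]; first by apply/andP; split; lra.
by rewrite e// -ef -[LHS]pf addrC.
Qed.

Lemma int01_split f (d : nat) : continuous f -> (0 < d)%N ->
  int01 (fun x => \sum_(b < d) f ((x + b%:R) / d%:R)) = d%:R * int01 f.
Proof.
move=> cf d0; have [F dF] := antider_exists (-1) cf.
have dn : (d%:R : R) != 0 by rewrite pnatr_eq0 -lt0n.
have e (b : nat) : (fun x => f ((x + b%:R) / d%:R)) = (fun x => f (d%:R^-1 * x + b%:R / d%:R)).
  by apply/funext => x; congr f; rewrite mulrDl [d%:R^-1 * x]mulrC.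
rewrite int01_sum; last by move=> b; rewrite e; exact: affine_continuous.
under eq_bigr => b _.
  rewrite e (int01_affine cf dF) ?invr_gt0 ?ltr0n//; last first.
    by rewrite (lt_le_trans (ltrN10 _))// divr_ge0.
  rewrite invrK -[X in F (X + _)]mul1r -mulrDl [1 + _]addrC natr1.
  over.
rewrite -mulr_sumr -(big_mkord xpredT (fun b : nat => F (b.+1%:R / d%:R) - F (b%:R / d%:R))).
have dF' (x : R) : 0 <= x <= 1 -> is_derive x (1 : R) F (f x).
  by move=> /andP[x0 _]; apply: dF; lra.
by rewrite telescope_sumr// divff// mul0r (int01_antider cf dF').
Qed.

End UnitIntegral.

Section UnderIntegral.
Context {R : realType} (f f' : R -> R -> R).
Local Notation mu := (@lebesgue_measure R).

Lemma der_int01 (y : R) (u v M : R) : u < y < v ->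
  (forall z, u < z < v -> continuous (f z)) ->
  (forall z x : R, u < z < v -> 0 <= x <= 1 -> is_derive z (1 : R) (fun z => f z x) (f' z x)) ->
  (forall z x, u < z < v -> 0 <= x <= 1 -> `|f' z x| <= M) ->
  is_derive y (1 : R) (fun y => int01 (f y)) (int01 (f' y)).
Proof.
move=> uyv cf df bf.
have mB : measurable (`[0, 1]%classic : set (measurableTypeR R)) by [].
have Iy : (`]u, v[%classic : set R) y by rewrite /= in_itv.
have M0 : 0 <= M.
  by apply: le_trans (bf y 0 uyv _); rewrite ?normr_ge0// lexx ler01.
have h1 x : `]u, v[%classic x -> mu.-integrable `[0, 1] (EFin \o f x).
  by rewrite /= in_itv/= => hx; apply: continuous_integrable; exact: cf.
have h2 x z : `]u, v[%classic x -> (`[0, 1]%classic : set R) z -> derivable (f ^~ z) x 1.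
  by rewrite /= !in_itv/= => hx hz; case: (df x z hx hz).
have pE x z : `]u, v[%classic x -> (`[0, 1]%classic : set R) z -> partial1of2 f x z = f' x z.
  by rewrite /= !in_itv/= => hx hz; rewrite partial1of2E; case: (df x z hx hz).
have h3 x z : `]u, v[%classic x -> (`[0, 1]%classic : set R) z ->
    `|partial1of2 f x z| <= (cst M) z.
  by move=> hx hz; rewrite pE//; apply: bf; rewrite ?in_itv//; move: hx hz; rewrite /= !in_itv.
have iM : mu.-integrable `[0, 1] (EFin \o (cst M : R -> R)).
  by apply: continuous_integrable; exact: cst_continuous.
have d1 := @derivable_under_integral R _ _ mu f _ mB y u v Iy h1 h2 (cst M) (fun=> M0) iM h3.
have d2 := @differentiation_under_integral R _ _ mu f _ mB y u v Iy h1 h2 (cst M) (fun=> M0) iM h3.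
split; first exact: d1.
rewrite -derive1E d2; apply: eq_Rintegral => x; rewrite inE => hx.
exact: pE.
Qed.

End UnderIntegral.

(** * Recovering a function from geometrically decaying cosine coefficients *)

Section CosineSeries.
Context {R : realType}.
Implicit Types (f g h : R -> R) (x : R) (n m k N : nat).

Definition cosn n x : R := cos (2 * pi * n%:R * x).

Lemma cosn_continuous n : continuous (@cosn n).
Proof.
move=> x; apply: (@continuous_comp _ _ _ (fun x => 2 * pi * n%:R * x) cos).
  exact: mulrl_continuous.
exact: continuous_cos.
Qed.

Lemma cosn0 x : cosn 0 x = 1.
Proof. by rewrite /cosn mulr0 mul0r cos0. Qed.

Lemma cos_period_nat (a : R) n : cos (a + 2 * pi * n%:R) = cos a.
Proof.
elim: n => [|n IH]; first by rewrite mulr0 addr0.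
rewrite -natr1 (_ : a + _ = (a + 2 * pi * n%:R) + pi *+ 2) ?cosD2pi//; ring.
Qed.

Lemma sin_period_nat (a : R) n : sin (a + 2 * pi * n%:R) = sin a.
Proof.
elim: n => [|n IH]; first by rewrite mulr0 addr0.
rewrite -natr1 (_ : a + _ = (a + 2 * pi * n%:R) + pi *+ 2) ?sinD2pi//; ring.
Qed.

Lemma cosnD1 n x : cosn n (x + 1) = cosn n x.
Proof. by rewrite /cosn mulrDr mulr1 cos_period_nat. Qed.

Lemma cosnN n x : cosn n (- x) = cosn n x.
Proof. by rewrite /cosn mulrN cosN. Qed.

Lemma cosn_le1 n x : `|cosn n x| <= 1.
Proof. by rewrite ler_norml cos_geN1 cos_le1. Qed.

Lemma cosn_mulS m x : cosn 1 x * cosn m.+1 x = (cosn m.+2 x + cosn m x) / 2.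
Proof.
rewrite /cosn; set b := 2 * pi * 1%:R * x.
have -> : 2 * pi * m.+2%:R * x = 2 * pi * m.+1%:R * x + b by rewrite /b -[m.+2%:R]natr1; ring.
have -> : 2 * pi * m%:R * x = 2 * pi * m.+1%:R * x - b by rewrite /b -[m.+1%:R]natr1; ring.
by rewrite cosD cosB; field.
Qed.

Lemma int01_cosn n : (0 < n)%N -> int01 (@cosn n) = 0.
Proof.
move=> n0; have c0 : 2 * pi * n%:R != 0 :> R.
  by rewrite !mulf_neq0// ?gt_eqF ?pi_gt0 ?ltr0n.
have dF (x : R) : 0 <= x <= 1 -> is_derive x (1 : R)
    (fun x => (2 * pi * n%:R)^-1 * sin (2 * pi * n%:R * x)) (cosn n x).
  move=> _; apply: (is_derive_eq (derMl _ (der_comp (derMl (2 * pi * n%:R) (der_id x)) (is_derive_sin _)))).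
  by rewrite /cosn mulr1 mulrCA mulVf// mulr1.
rewrite (int01_antider (@cosn_continuous n) dF) mulr1 mulr0.
by have := sin_period_nat 0 n; rewrite add0r sin0 => ->; rewrite subrr.
Qed.

Lemma cosn_mul n m x : (m <= n)%N -> cosn n x * cosn m x = (cosn (n + m) x + cosn (n - m) x) / 2.
Proof.
move=> mn; rewrite /cosn natrD natrB//.
have -> : 2 * pi * (n%:R + m%:R) * x = 2 * pi * n%:R * x + 2 * pi * m%:R * x by ring.
have -> : 2 * pi * (n%:R - m%:R) * x = 2 * pi * n%:R * x - 2 * pi * m%:R * x by ring.
by rewrite cosD cosB; field.
Qed.

Lemma cosn_orthogonal n m : (0 < n)%N ->
  int01 (fun x => cosn n x * cosn m x) = (n == m)%:R / 2.
Proof.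
move=> n0; wlog mn : n m n0 / (m <= n)%N.
  move=> H; case: (leqP m n) => [|/ltnW nm]; first exact: H.
  case: m nm => [|m] nm; first by rewrite leqn0 in nm; rewrite (eqP nm) in n0.
  rewrite eq_sym -(H m.+1 n)//; congr int01; apply/funext => x; exact: mulrC.
under eq_fun do rewrite (cosn_mul _ mn) mulrC.
rewrite int01Z; last first.
  by apply: ctsD; exact: cosn_continuous.
rewrite int01D; [|exact: cosn_continuous..].
rewrite int01_cosn ?addn_gt0 ?n0// add0r mulrC; congr (_ / _).
case: eqP => [->|/eqP nm]; first by rewrite subnn (_ : cosn 0 = fun=> 1) ?int01_cst//; apply/funext; exact: cosn0.
by rewrite int01_cosn// subn_gt0 ltn_neqAle eq_sym nm.
Qed.

Definition fcoef f n : R := int01 (fun x => f x * cosn n x).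

Lemma fcoef_fun_continuous f n : continuous f -> continuous (fun x => f x * cosn n x).
Proof. by move=> cf; apply: ctsM => //; exact: cosn_continuous. Qed.

(** Each factor [cosn 1] raises the highest frequency by one only. Through [fcoef_poly], a function
    whose low coefficients vanish integrates to zero against the weights of [int01_le_peak]. *)
Lemma fcoef_cos_pow f M : continuous f -> (forall n, (n < M)%N -> fcoef f n = 0) ->
  forall j m, (j + m < M)%N -> int01 (fun x => f x * cosn 1 x ^+ j * cosn m x) = 0.
Proof.
move=> cf h; elim=> [|j IH] m jm.
  by rewrite -[RHS](h m jm); congr int01; apply/funext => x; rewrite expr0 mulr1.
have cj i : continuous (fun x => f x * cosn 1 x ^+ j * cosn i x).
  by apply: ctsM; [apply: ctsM => //; apply: ctsX|]; exact: cosn_continuous.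
case: m jm => [|m] jm.
  rewrite -[RHS](IH 1) ?addn1//; last by rewrite addn0 in jm.
  by congr int01; apply/funext => x; rewrite cosn0 exprSr mulr1 !mulrA.
have -> : (fun x => f x * cosn 1 x ^+ j.+1 * cosn m.+1 x) =
    (fun x => 2^-1 * (f x * cosn 1 x ^+ j * cosn m.+2 x + f x * cosn 1 x ^+ j * cosn m x)).
  apply/funext => x; rewrite exprSr -mulrA -[_ * _ * cosn m.+1 x]mulrA cosn_mulS; ring.
rewrite int01Z; last by apply: ctsD; exact: cj.
rewrite int01D// !IH ?addr0 ?mulr0//; last by rewrite addnS -addSn.
by apply: leq_trans jm; rewrite addnS ltnS addSnnS ltnW// addnS.
Qed.

Lemma fcoef_poly f (q : {poly R}) : continuous f ->
  (forall n, (n < size q)%N -> fcoef f n = 0) -> int01 (fun x => f x * q.[cosn 1 x]) = 0.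
Proof.
move=> cf h; have -> : (fun x => f x * q.[cosn 1 x]) =
    (fun x => \sum_(i < size q) q`_i * (f x * cosn 1 x ^+ i * cosn 0 x)).
  apply/funext => x; rewrite horner_coef mulr_sumr; apply: eq_bigr => i _.
  by rewrite cosn0 mulr1; ring.
have cj i : continuous (fun x => f x * cosn 1 x ^+ i * cosn 0 x).
  by apply: ctsM; [apply: ctsM => //; apply: ctsX|]; exact: cosn_continuous.
rewrite int01_sum; last first.
  by move=> i; apply: ctsM; [exact: cts_cst|exact: cj].
rewrite big1// => i _; rewrite int01Z// (fcoef_cos_pow cf h) ?mulr0//.
by rewrite addn0.
Qed.

Lemma expr_unbounded (z C : R) : 1 < z -> exists k : nat, C < z ^+ k.
Proof.
move=> z1; have bern k : 1 + k%:R * (z - 1) <= z ^+ k.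
  elim: k => [|k IH]; first by rewrite mul0r addr0 expr0.
  have zk : 1 <= z ^+ k by apply: exprn_ege1; exact: ltW.
  rewrite exprS -natr1; have : (z - 1) * 1 <= (z - 1) * z ^+ k.
    by rewrite ler_wpM2l// subr_ge0 ltW.
  nra.
exists (Num.bound `|C / (z - 1)|); apply: lt_le_trans (bern _).
have : C / (z - 1) < (Num.bound `|C / (z - 1)|)%:R.
  by apply: le_lt_trans (ler_norm _) _; apply: archi_boundP.
by rewrite ltr_pdivrMr ?subr_gt0//; lra.
Qed.

Lemma int01_gt0 f x0 : continuous f -> (forall x, 0 <= f x) -> 0 <= x0 < 1 -> 0 < f x0 ->
  0 < int01 f.
Proof.
move=> cf f0 /andP[x00 x01] fx.
have [F dF] := antider_exists (-1) cf.
have dF' (a b : R) : 0 <= a -> forall x : R, a <= x <= b -> is_derive x (1 : R) F (f x).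
  by move=> a0 x /andP[ax _]; apply: dF; lra.
have : \forall y \near x0, 0 < f y.
  exact: (cvgr_gt _ (cf x0)).
move=> /nbhs_ballP[e /= e0 he].
pose b := Num.min (x0 + e / 2) 1.
have xb : x0 < b by rewrite lt_min x01 andbT ltrDl divr_gt0.
have b1 : b <= 1 by rewrite ge_min lexx orbT.
have be : b <= x0 + e / 2 by rewrite ge_min lexx.
rewrite (int01_antider cf (dF' 0 1 (lexx _))).
have h1 : F 0 <= F x0 by apply: (der_nondecr x00 (dF' _ _ (lexx _))) => x _.
have h2 : F b <= F 1 by apply: (der_nondecr b1 (dF' _ _ _)) => [|x _//]; lra.
have [c /andP[xc cb] e2] := der_mvt (ltW xb) (dF' x0 b x00).
have : 0 < F b - F x0.
  rewrite e2 mulr_gt0 ?subr_gt0//; apply: he; rewrite /ball/= distrC ger0_norm; lra.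
lra.
Qed.

(** As [k] grows the weights concentrate on the points with the same cosine as [x0], where [g] takes
    the value [g x0] by parity and periodicity. They are polynomials in [cosn 1], as [fcoef_poly]
    requires, and the factor [1/4] keeps them in [[0, 1]]. *)
Lemma int01_le_peak g x0 (T : R) : continuous g -> (forall x, g (x + 1) = g x) ->
  (forall x, g (- x) = g x) -> 0 <= x0 <= 2^-1 ->
  (forall k, int01 (fun x => g x * (1 - (cosn 1 x - cosn 1 x0) ^+ 2 / 4) ^+ k) <=
     T * int01 (fun x => (1 - (cosn 1 x - cosn 1 x0) ^+ 2 / 4) ^+ k)) ->
  g x0 <= T.
Proof.
move=> cg pg eg /andP[x00 x0h] H; rewrite leNgt; apply/negP => gT.
pose h x := g x - T; pose m := h x0 / 2.
have m0 : 0 < m by rewrite divr_gt0// subr_gt0.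
have ch : continuous h by apply: ctsB => //; exact: cts_cst.
pose D x := cosn 1 x - cosn 1 x0.
have cD : continuous D by apply: ctsB; [exact: cosn_continuous|exact: cts_cst].
have cND : continuous (fun x => `|D x|) by exact: cts_norm.
pose p x := 1 - D x ^+ 2 / 4.
have cp k : continuous (fun x => p x ^+ k).
  by apply: ctsX; apply: ctsB; [exact: cts_cst|apply: ctsM; [exact: ctsX|exact: cts_cst]].
have D2 x : `|D x| <= 2.
  apply: le_trans (ler_normB _ _) _.
  have := cosn_le1 1 x; have := cosn_le1 1 x0; lra.
(* far from [x0] in the variable [cos], where [h] may be small *)
have [d /andP[d0 d1] hd] : exists2 d : R, 0 < d <= 1 &
    forall x, 0 <= x <= 1 -> `|D x| < d -> m <= h x.
  pose K := `[0, 1]%classic `&` [set x | h x <= m].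
  have cK : compact K.
    have cA : closed K.
      apply: closedI; first exact: interval_closed.
      by apply: (@closed_comp _ _ h [set y | y <= m]) => [x _|]; [exact: ch|exact: closed_le].
    by apply: (subclosed_compact cA (@segment_compact _ 0 1)) => x [].
  have [K0|/set0P/negP/negPn/eqP K0] := pselect (K !=set0); last first.
    exists 1; first by rewrite ltr01 lexx.
    move=> x x01 _; rewrite leNgt; apply/negP => hx.
    have : K x by split; [rewrite /= in_itv|exact: ltW].
    by rewrite K0.
  have [|c cK' cmin] := @compact_EVT_min _ R (fun x => `|D x|) K K0 cK.
    exact: continuous_subspaceT.
  move: cK'; rewrite inE => -[]; rewrite /= in_itv/= => /andP[c0 c1] hc.
  have Dc : 0 < `|D c|.
    rewrite normr_gt0 subr_eq0; apply/negP => /eqP.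
    rewrite /cosn mulr1 => e.
    have pi0 := pi_gt0 R.
    have inj (u w : R) : 0 <= u <= 2^-1 -> 0 <= w <= 2^-1 ->
        cos (2 * pi * u) = cos (2 * pi * w) -> u = w.
      move=> /andP[u0 u1] /andP[w0 w1] /cos_inj e'.
      have p2 : 0 < 2 * pi :> R by lra.
      apply: (mulfI (lt0r_neq0 p2)); apply: e'; rewrite in_itv/=; apply/andP; split; try nra.
    have hx0 : h c = h x0.
      have [c2|c2] := leP c 2^-1.
        by congr h; apply: inj => //; apply/andP.
      have e1 : 1 - c = x0.
        apply: inj; [by apply/andP; split; lra|by apply/andP|].
        have -> : 2 * pi * (1 - c) = - (2 * pi * c) + 2 * pi * 1%:R by ring.
        by rewrite cos_period_nat cosN e.
      by rewrite -e1 /h -(eg c) -(pg (- c)) [- c + 1]addrC.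
    have h0 : 0 < h x0 by rewrite subr_gt0.
    by move: hc; rewrite /= hx0 /m; lra.
  exists (Num.min `|D c| 1); first by rewrite lt_min Dc ltr01 ge_min lexx orbT.
  move=> x x01; rewrite lt_min => /andP[hx _]; rewrite leNgt; apply/negP => hxm.
  have : x \in K by rewrite inE; split; [rewrite /= in_itv|exact: ltW].
  by move=> /cmin; rewrite leNgt hx.
(* A continuous bump in place of the indicator function of [|D| <= d / 2], so that only continuous
   functions are integrated. *)
pose chi x := Num.max 0 (d / 2 - `|D x|).
have cchi : continuous chi.
  move=> x; apply: (@continuous_max _ _ (fun=> 0) (fun x => d / 2 - `|D x|)).
    exact: cst_continuous.
  by apply: continuousB; [exact: cst_continuous|exact: cND].
have chi0 x : 0 <= chi x by rewrite le_max lexx.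
pose X := int01 chi.
have X0 : 0 < X.
  apply: (@int01_gt0 chi x0) => //; first by apply/andP; split => //; lra.
  by rewrite lt_max /D subrr normr0 subr0 divr_gt0// orbT.
have [B hB] : exists B : R, forall x, 0 <= x <= 1 -> `|h x| <= B.
  have cNh : continuous (fun x => `|h x|) by exact: cts_norm.
  have [c _ hc] := EVT_max ler01 (continuous_subspaceT cNh).
  by exists `|h c| => x x01; apply: hc; rewrite in_itv.
have B0 : 0 <= B by apply: le_trans (hB 0 _); rewrite ?normr_ge0// lexx ler01.
pose r := 1 - d ^+ 2 / 16; pose s := 1 - d ^+ 2 / 4.
have d21 : d ^+ 2 <= 1 by rewrite expr_le1// ltW.
have d20 : 0 < d ^+ 2 by rewrite exprn_gt0.
have s0 : 0 < s by rewrite /s; lra.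
have rs : 1 < r / s by rewrite ltr_pdivlMr// /r /s; lra.
have sqD x : D x ^+ 2 = `|D x| ^+ 2 by rewrite real_normK ?num_real.
have p01 x : 0 <= p x <= 1.
  have : `|D x| ^+ 2 <= 2 ^+ 2 by rewrite ler_sqr ?nnegrE.
  by rewrite /p sqD; have := sqr_ge0 `|D x|; lra.
have [k] := expr_unbounded (B / (2 * m / d * X)) rs.
have c0 : 0 < 2 * m / d * X by rewrite mulr_gt0// divr_gt0// mulr_gt0.
rewrite ltr_pdivrMr// expr_div_n mulrAC ltr_pdivlMr ?exprn_gt0// => hk.
have : 2 * m / d * r ^+ k * X - B * s ^+ k <= 0; last by lra.
have -> : 2 * m / d * r ^+ k * X - B * s ^+ k =
    int01 (fun x => 2 * m / d * r ^+ k * chi x - B * s ^+ k).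
  rewrite int01B; [|by apply: ctsM => //; exact: cts_cst|exact: cts_cst].
  by rewrite int01Z// int01_cst.
have : int01 (fun x => h x * p x ^+ k) <= 0.
  have -> : (fun x => h x * p x ^+ k) = (fun x => g x * p x ^+ k - T * p x ^+ k).
    by apply/funext => x; rewrite mulrBl.
  rewrite int01B; [|exact: ctsM|by apply: ctsM => //; exact: cts_cst].
  rewrite int01Z; last exact: cp.
  by rewrite subr_le0; exact: H.
apply: le_trans; apply: le_int01.
- by apply: ctsB; [apply: ctsM => //|]; exact: cts_cst.
- exact: ctsM.
move=> x x01; have /andP[px0 px1] := p01 x.
have Bs : 0 <= B * s ^+ k by rewrite mulr_ge0// exprn_ge0// ltW.
have [Dd|Dd] := ltP `|D x| d.
  have hm := hd x x01 Dd.
  have hp0 : 0 <= h x * p x ^+ k by rewrite mulr_ge0 ?exprn_ge0//; lra.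
  have [D2d|D2d] := leP `|D x| (d / 2).
    have cd : chi x <= d / 2.
      by rewrite /chi ge_max; apply/andP; split; [|have := normr_ge0 (D x)]; lra.
    have rp : r ^+ k <= p x ^+ k.
      have r0 : 0 <= r by rewrite /r; lra.
      apply: lerXn2r; rewrite ?nnegrE//.
      have : `|D x| ^+ 2 <= (d / 2) ^+ 2 by rewrite ler_sqr ?nnegrE//; lra.
      by rewrite /p sqD /r; lra.
    have : 2 * m / d * r ^+ k * chi x <= m * r ^+ k.
      have -> : m * r ^+ k = 2 * m / d * r ^+ k * (d / 2) by field; rewrite gt_eqF.
      apply: ler_wpM2l => //; apply: mulr_ge0; first by apply: divr_ge0; lra.
      by apply: exprn_ge0; rewrite /r; lra.
    have : m * r ^+ k <= h x * p x ^+ k.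
      by apply: ler_pM => //; [exact: ltW|apply: exprn_ge0; rewrite /r; lra].
    lra.
  have -> : chi x = 0.
    by apply/eqP; rewrite eq_le chi0 andbT /chi ge_max lexx/=; lra.
  by rewrite mulr0; lra.
have -> : chi x = 0.
  by apply/eqP; rewrite eq_le chi0 andbT /chi ge_max lexx/=; lra.
rewrite mulr0 sub0r.
have ps : p x ^+ k <= s ^+ k.
  apply: lerXn2r; rewrite ?nnegrE//; first exact: ltW.
  have : d ^+ 2 <= `|D x| ^+ 2 by rewrite ler_sqr ?nnegrE// ltW.
  by rewrite /p sqD /s; lra.
have := hB x x01; rewrite ler_norml => /andP[hB1 _].
have : - B * s ^+ k <= - B * p x ^+ k by rewrite !mulNr lerN2 ler_wpM2l.
have : - B * p x ^+ k <= h x * p x ^+ k by rewrite ler_wpM2r// exprn_ge0.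
by rewrite mulNr; lra.
Qed.

End CosineSeries.

Section FourierTail.
Context {R : realType}.
Implicit Types (f : R -> R) (x rho C : R) (n m k N M : nat).

Lemma geometric_tail rho N M : 0 <= rho < 1 ->
  \sum_(N <= n < M) rho ^+ n <= rho ^+ N / (1 - rho).
Proof.
move=> /andP[r0 r1]; have [NM|MN] := leqP N M; last first.
  by rewrite big_geq ?(ltnW MN)// divr_ge0 ?exprn_ge0// subr_ge0 ltW.
rewrite ler_pdivlMr ?subr_gt0//.
suff -> : (\sum_(N <= n < M) rho ^+ n) * (1 - rho) = rho ^+ N - rho ^+ M.
  by rewrite lerBlDr lerDl exprn_ge0.
rewrite mulr_suml -(opprB (rho ^+ M)) -telescope_sumr// -sumrN; apply: eq_bigr => i _.
by rewrite exprSr; ring.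
Qed.

(** The factor 2 also multiplies the term [n = 0], so this is the Fourier partial sum of functions
    with [fcoef f 0 = 0]. *)
Definition fsum (a : nat -> R) N x : R := \sum_(n < N) 2 * a n * cosn n x.

Lemma fsum_continuous (a : nat -> R) N : continuous (fsum a N).
Proof.
elim: N => [|N IH].
  by rewrite (_ : fsum a 0 = fun=> 0); [exact: cts_cst|apply/funext => x; rewrite /fsum big_ord0].
rewrite (_ : fsum a N.+1 = fun x => fsum a N x + 2 * a N * cosn N x).
  by apply: ctsD => //; apply: ctsM; [exact: cts_cst|exact: cosn_continuous].
by apply/funext => x; rewrite /fsum big_ord_recr.
Qed.

Lemma fsumD (a : nat -> R) N x : fsum a N (x + 1) = fsum a N x.
Proof. by apply: eq_bigr => i _; rewrite cosnD1. Qed.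

Lemma fsumN (a : nat -> R) N x : fsum a N (- x) = fsum a N x.
Proof. by apply: eq_bigr => i _; rewrite cosnN. Qed.

Lemma fcoefB_fsum f M m : continuous f -> fcoef f 0 = 0 -> (m < M)%N ->
  fcoef (fun x => f x - fsum (fcoef f) M x) m = 0.
Proof.
move=> cf f0 mM; have cS := @fsum_continuous (fcoef f) M.
have cc n := @cosn_continuous R n.
rewrite /fcoef; under eq_fun do rewrite mulrBl.
rewrite int01B; [|exact: ctsM..].
have -> : int01 (fun x => fsum (fcoef f) M x * cosn m x) =
    \sum_(n < M) 2 * fcoef f n * int01 (fun x => cosn n x * cosn m x).
  rewrite (_ : (fun x => _) = fun x => \sum_(n < M) 2 * fcoef f n * (cosn n x * cosn m x)); last first.
    by apply/funext => x; rewrite /fsum mulr_suml; apply: eq_bigr => n _; rewrite mulrA.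
  rewrite int01_sum; last first.
    by move=> n; apply: ctsM; [exact: cts_cst|exact: ctsM].
  by apply: eq_bigr => n _; rewrite int01Z//; exact: ctsM.
rewrite (bigD1 (Ordinal mM))//= big1 ?addr0; last first.
  move=> n; rewrite -val_eqE/= => nm; case: (posnP n) => [->|n0].
    by rewrite f0 mulr0 mul0r.
  by rewrite cosn_orthogonal// (negbTE nm) mul0r mulr0.
case: (posnP m) => [->|m0]; first by rewrite -/(fcoef f 0) f0 mulr0 mul0r subr0.
by rewrite cosn_orthogonal// eqxx /fcoef mul1r -mulrA mulrCA divff ?mulr1 ?subrr// pnatr_eq0.
Qed.

(** Against a polynomial weight in [cosn 1], [f] has the same integral as its partial sum of any
    high enough order [M], and that sum exceeds the [N]-th by at most the geometric tail.
    [int01_le_peak] turns this averaged bound into one at [x]. *)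
Lemma le_fourier_tail f C rho N x : continuous f -> (forall x, f (x + 1) = f x) ->
  (forall x, f (- x) = f x) -> fcoef f 0 = 0 -> 0 <= rho < 1 -> 0 <= C ->
  (forall n, (N <= n)%N -> `|fcoef f n| <= C * rho ^+ n) -> 0 <= x <= 2^-1 ->
  f x - fsum (fcoef f) N x <= 2 * C * rho ^+ N / (1 - rho).
Proof.
move=> cf pf ef f0 r01 C0 hC x01.
set T := 2 * C * rho ^+ N / (1 - rho).
have /andP[r0 r1] := r01.
have cS M := @fsum_continuous (fcoef f) M.
have ST M y : (N <= M)%N -> fsum (fcoef f) M y - fsum (fcoef f) N y <= T.
  move=> NM; rewrite /fsum -!(big_mkord xpredT (fun n => 2 * fcoef f n * cosn n y)).
  rewrite (big_cat_nat (leq0n N) NM)/= addrAC subrr add0r.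
  rewrite /T -mulrA; apply: le_trans (ler_wpM2l _ (geometric_tail N M r01)); last by rewrite mulr_ge0.
  rewrite mulr_sumr !big_nat; apply: ler_sum => n /andP[Nn _].
  rewrite -!mulrA ler_wpM2l//; apply: le_trans (hC n Nn).
  apply: le_trans (ler_norm _) _; rewrite normrM ler_piMr//.
  exact: cosn_le1.
apply: (@int01_le_peak R (fun x => f x - fsum (fcoef f) N x)) => //.
- exact: ctsB.
- by move=> y; rewrite pf fsumD.
- by move=> y; rewrite ef fsumN.
move=> k; set p := fun y => _ ^+ k.
pose q : {poly R} := (1 - ('X - (cosn 1 x)%:P) ^+ 2 * (4^-1)%:P) ^+ k.
have qE y : q.[cosn 1 y] = p y by rewrite /q /p !(hornerE, horner_exp).
have cp : continuous p.
  rewrite /p; apply: ctsX; apply: ctsB; first exact: cts_cst.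
  apply: ctsM; last exact: cts_cst.
  by apply: ctsX; apply: ctsB; [exact: cosn_continuous|exact: cts_cst].
have p0 y : 0 <= p y.
  rewrite /p exprn_ge0//.
  have := cosn_le1 1 y; have := cosn_le1 1 x; rewrite !ler_norml => /andP[h1 h2] /andP[h3 h4].
  have h5 : cosn 1 y - cosn 1 x <= 2 by lra.
  have h6 : -2 <= cosn 1 y - cosn 1 x by lra.
  nra.
pose M := maxn N (size q).
have NM : (N <= M)%N by rewrite leq_maxl.
have e : (fun y => (f y - fsum (fcoef f) N y) * p y) =
    (fun y => (f y - fsum (fcoef f) M y) * p y +
              (fsum (fcoef f) M y - fsum (fcoef f) N y) * p y).
  by apply/funext => y; ring.
rewrite e int01D; [|by apply: ctsM => //; exact: ctsB..].
have -> : int01 (fun y => (f y - fsum (fcoef f) M y) * p y) = 0.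
  rewrite -[RHS](@fcoef_poly R (fun y => f y - fsum (fcoef f) M y) q).
  - by congr int01; apply/funext => y; rewrite qE.
  - exact: ctsB.
  - by move=> n nq; apply: fcoefB_fsum => //; apply: leq_trans nq _; rewrite leq_maxr.
rewrite add0r -int01Z//; apply: le_int01.
- by apply: ctsM => //; exact: ctsB.
- by apply: ctsM => //; exact: cts_cst.
- by move=> y _; rewrite ler_wpM2r// ST.
Qed.

Lemma fourier_tail f C rho N x : continuous f -> (forall x, f (x + 1) = f x) ->
  (forall x, f (- x) = f x) -> fcoef f 0 = 0 -> 0 <= rho < 1 -> 0 <= C ->
  (forall n, (N <= n)%N -> `|fcoef f n| <= C * rho ^+ n) -> 0 <= x <= 2^-1 ->
  `|f x - fsum (fcoef f) N x| <= 2 * C * rho ^+ N / (1 - rho).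
Proof.
move=> cf pf ef f0 r01 C0 hC x01.
pose g y := - f y.
have gE n : fcoef g n = - fcoef f n.
  rewrite -mulN1r -int01Z; last by apply: ctsM => //; exact: cosn_continuous.
  by congr int01; apply/funext => y; rewrite mulN1r mulNr.
rewrite ler_norml; apply/andP; split; last exact: le_fourier_tail.
rewrite lerNl opprB.
have -> : fsum (fcoef f) N x - f x = g x - fsum (fcoef g) N x.
  rewrite /fsum -sumrN addrC; congr (_ + _); apply: eq_bigr => n _; rewrite gE; ring.
apply: le_fourier_tail => //.
- by move=> y; apply: continuousN; exact: cf.
- by move=> y; rewrite /g pf.
- by move=> y; rewrite /g ef.
- by rewrite gE f0 oppr0.
- by move=> n Nn; rewrite gE normrN hC.
Qed.

End FourierTail.

(** * Real coordinates for the modular action, and calculus in the plane *)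

Section MobiusAlgebra.
Context {R : realType}.
Implicit Types (g : 'M[int]_2) (z : R * R).

Definition mx2 (a b c d : int) : 'M[int]_2 :=
  \matrix_(i, j) (if i == 0 then if j == 0 then a else b
                  else if j == 0 then c else d).

Lemma det_mx2 a b c d : \det (mx2 a b c d) = a * d - b * c.
Proof. by rewrite det2 !mxE. Qed.

(** This is [|c z + d|^2], by which the action divides the height. *)
Definition mobius_norm g z : R :=
  ((g 1 0)%:~R * z.1 + (g 1 1)%:~R) ^+ 2 + ((g 1 0)%:~R * z.2) ^+ 2.

Lemma mobiusE g z : \det g = 1 -> 0 < z.2 ->
  mobius g z = ((((g 0 0)%:~R * z.1 + (g 0 1)%:~R) * ((g 1 0)%:~R * z.1 + (g 1 1)%:~R)
      + (g 0 0)%:~R * (g 1 0)%:~R * z.2 ^+ 2) / mobius_norm g z,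
    z.2 / mobius_norm g z).
Proof.
move=> dg y0; have den := mobius_den_neq0 dg y0.
have detE : (g 0 0)%:~R * (g 1 1)%:~R - (g 0 1)%:~R * (g 1 0)%:~R = 1 :> R.
  by rewrite -!intrM -intrB -det2 dg.
rewrite /mobius /mobius_norm /to_complex.
move: (g 0 0) (g 0 1) (g 1 0) (g 1 1) detE {den dg} => a b c d detE.
have zE (m : int) : m%:~R = Complex (m%:~R : R) 0 :> R[i].
  by rewrite -(rmorph_int (real_complex R)).
case: z y0 => x y /= y0; rewrite !zE /of_complex /=.
rewrite !mul0r !subr0 !addr0.
move: detE; move: (_ ^+ 2 + _) => N.
move: (a%:~R : R) (b%:~R : R) (c%:~R : R) (d%:~R : R) => A B C D detE.
by congr pair; [ring|rewrite -[y in RHS]mul1r -detE; ring].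
Qed.

Lemma mobius_translate z (n : nat) : 0 < z.2 -> mobius (mx2 1 n 0 1) z = (z.1 + n%:R, z.2).
Proof.
move=> y0; rewrite mobiusE// ?det_mx2 ?mul1r ?mulr0 ?subr0//.
rewrite /mobius_norm !mxE/= !mul0r !add0r mulr0 mul0r addr0 expr0n addr0 !mul1r.
by rewrite expr1n !divr1 mulr1.
Qed.

Lemma mobius_invert z : 0 < z.2 ->
  mobius (mx2 0 (-1) 1 0) z = (- z.1 / (z.1 ^+ 2 + z.2 ^+ 2), z.2 / (z.1 ^+ 2 + z.2 ^+ 2)).
Proof.
move=> y0; rewrite mobiusE// ?det_mx2//.
rewrite /mobius_norm !mxE/= !mul0r !add0r !mul1r !addr0.
by rewrite mulN1r.
Qed.

End MobiusAlgebra.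

Section PlaneCalculus.
Context {R : realType}.
Implicit Types (G : R * R -> R) (x y a b : R).

Lemma der_horizontal G x y : derivable G (x, y) (1, 0) ->
  is_derive x (1 : R) (fun s => G (s, y)) ('D_(1, 0) G (x, y)).
Proof.
move=> dG; have e : (fun h : R => h^-1 *: (G (h *: (1, 0) + (x, y)) - G (x, y))) =
    (fun h : R => h^-1 *: (G (h *: (1 : R) + x, y) - G (x, y))).
  apply/funext => h; congr (_ *: (G _ - _)).
  by rewrite [LHS]surjective_pairing /= scaler0 add0r.
split; first by move: dG; rewrite /derivable e.
by rewrite /derive e.
Qed.

Lemma der_vertical G x y : derivable G (x, y) (0, 1) ->
  is_derive y (1 : R) (fun s => G (x, s)) ('D_(0, 1) G (x, y)).
Proof.
move=> dG; have e : (fun h : R => h^-1 *: (G (h *: (0, 1) + (x, y)) - G (x, y))) =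
    (fun h : R => h^-1 *: (G (x, h *: (1 : R) + y) - G (x, y))).
  apply/funext => h; congr (_ *: (G _ - _)).
  by rewrite [LHS]surjective_pairing /= scaler0 add0r.
split; first by move: dG; rewrite /derivable e.
by rewrite /derive e.
Qed.

Lemma der_lipschitz (f df : R -> R) (M a b : R) :
  (forall s : R, Num.min a b <= s <= Num.max a b -> is_derive s (1 : R) f (df s)) ->
  (forall s, Num.min a b <= s <= Num.max a b -> `|df s| <= M) ->
  `|f b - f a| <= M * `|b - a|.
Proof.
wlog ab : a b / a <= b.
  move=> H h1 h2; have [ab|/ltW ba] := leP a b; first exact: H.
  rewrite distrC [`|b - a|]distrC; apply: (H b a ba).
    by move=> s; rewrite minC maxC; exact: h1.
  by move=> s; rewrite minC maxC; exact: h2.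
rewrite (min_l ab) (max_r ab) => h1 h2.
have [c hc ->] := der_mvt ab h1.
by rewrite normrM ler_wpM2r// h2.
Qed.

Lemma min_max_dist (a b s : R) : Num.min a b <= s <= Num.max a b -> `|a - s| <= `|a - b|.
Proof.
have [ab|/ltW ba] := leP a b => /andP[h1 h2].
  by rewrite !ler0_norm; lra.
by rewrite !ger0_norm; lra.
Qed.

Lemma ball_pairE (z w : R * R) (e : R) : ball z e w <-> `|z.1 - w.1| < e /\ `|z.2 - w.2| < e.
Proof. by []. Qed.

(** [C2_on] provides continuity for second directional derivatives only; this recovers that of the
    first ones and of [phi]. Partials continuous at [z] are bounded near it, and the mean value
    theorem along a horizontal and a vertical segment gives a Lipschitz bound. *)
Lemma continuous_of_partials G :
  (forall z, 0 < z.2 -> derivable G z (1, 0) /\ derivable G z (0, 1)) ->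
  (forall z, 0 < z.2 -> {for z, continuous ('D_(1, 0) G)} /\ {for z, continuous ('D_(0, 1) G)}) ->
  forall z : R * R, 0 < z.2 -> {for z, continuous G}.
Proof.
move=> dG cG z z0; have [c1 c2] := cG z z0.
have bd (H : R * R -> R) : {for z, continuous H} ->
    exists2 r : R, 0 < r & forall w, ball z r w -> `|H w| <= `|H z| + 1.
  move=> /cvgrPdist_lt /(_ 1 ltr01) /nbhs_ballP[r /= r0 hr]; exists r => // w /hr hw.
  have -> : H w = H z - (H z - H w) by ring.
  by apply: le_trans (ler_normB _ _) _; rewrite lerD2l ltW.
have [r1 r10 h1] := bd _ c1; have [r2 r20 h2] := bd _ c2.
pose M := `|'D_(1, 0) G z| + `|'D_(0, 1) G z| + 1.
have M0 : 0 < M by rewrite ltr_wpDl// addr_ge0.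
apply/cvgrPdist_lt => e e0.
pose r := Num.min (Num.min r1 r2) (Num.min z.2 (e / (2 * M))).
have r0 : 0 < r by rewrite !lt_min r10 r20 z0 divr_gt0// mulr_gt0.
have [hr1 hr2 hrz hre] : [/\ r <= r1, r <= r2, r <= z.2 & r <= e / (2 * M)].
  by split; rewrite /r !ge_min lexx ?orbT.
apply: filterS (nbhsx_ballx z r r0) => w /ball_pairE[w1 w2].
have seg1 s : Num.min z.1 w.1 <= s <= Num.max z.1 w.1 -> `|z.1 - s| < r.
  by move=> /min_max_dist hs; exact: le_lt_trans w1.
have seg2 s : Num.min z.2 w.2 <= s <= Num.max z.2 w.2 -> `|z.2 - s| < r.
  by move=> /min_max_dist hs; exact: le_lt_trans w2.
have pos s : `|z.2 - s| < r -> 0 < s.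
  by rewrite ltr_norml => /andP[]; lra.
have k1 : `|G (w.1, w.2) - G (z.1, w.2)| <= M * `|w.1 - z.1|.
  apply: (@der_lipschitz (fun s => G (s, w.2)) (fun s => 'D_(1, 0) G (s, w.2))).
    by move=> s _; apply: der_horizontal; apply: (dG (s, w.2) _).1; exact: pos.
  move=> s /seg1 hs; apply: le_trans (h1 _ _) _.
    by apply/ball_pairE; split => /=; apply: lt_le_trans hr1.
  by rewrite /M lerD2r lerDl.
have k2 : `|G (z.1, w.2) - G (z.1, z.2)| <= M * `|w.2 - z.2|.
  apply: (@der_lipschitz (fun s => G (z.1, s)) (fun s => 'D_(0, 1) G (z.1, s))).
    by move=> s /seg2 hs; apply: der_vertical; apply: (dG (z.1, s) _).2; exact: pos.
  move=> s /seg2 hs; apply: le_trans (h2 _ _) _.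
    by apply/ball_pairE; split => /=; [rewrite subrr normr0|apply: lt_le_trans hr2].
  by rewrite /M lerD2r lerDr.
have -> : G z - G w = - ((G (w.1, w.2) - G (z.1, w.2)) + (G (z.1, w.2) - G (z.1, z.2))).
  by rewrite -!surjective_pairing; ring.
rewrite normrN; apply: le_lt_trans (ler_normD _ _) _.
have Mr : M * r <= e / 2.
  have -> : e / 2 = M * (e / (2 * M)) by field; rewrite gt_eqF.
  by rewrite ler_wpM2l// ltW.
have : M * `|w.1 - z.1| < M * r by rewrite ltr_pM2l// distrC.
have : M * `|w.2 - z.2| < M * r by rewrite ltr_pM2l// distrC.
lra.
Qed.

Lemma bounded_on_rectangle G (a b c d : R) :
  (forall z, 0 < z.2 -> {for z, continuous G}) -> 0 < a ->
  exists M, forall x y, c <= x <= d -> a <= y <= b -> `|G (x, y)| <= M.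
Proof.
move=> cG a0; pose A := `[c, d]%classic `*` `[a, b]%classic.
have [A0|A0] := pselect (A !=set0); last first.
  exists 0 => x y hx hy; exfalso; apply: A0; exists (x, y).
  by split; rewrite /= in_itv.
have cA : compact A by apply: compact_setX; exact: segment_compact.
have cN : {within A, continuous (fun z => `|G z|)}.
  apply: continuous_in_subspaceT => z; rewrite inE => -[_]; rewrite /= in_itv/= => /andP[az _].
  apply: (@continuous_comp _ _ _ G (fun y : R => `|y|)); last exact: norm_continuous.
  by apply: cG; exact: lt_le_trans az.
have [m _ hm] := compact_EVT_max A0 cA cN.
exists `|G m| => x y hx hy; apply: hm; rewrite inE.
by split; rewrite /= in_itv.
Qed.

Lemma continuous_slice G y : (forall z, 0 < z.2 -> {for z, continuous G}) ->
  0 < y -> continuous (fun x => G (x, y)).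
Proof.
move=> cG y0 x; apply: (@continuous_comp _ _ _ (fun x => (x, y)) G); last exact: cG.
exact: (cvg_pair (@cvg_id _ (nbhs x)) (cvg_cst y)).
Qed.

Lemma continuous_slice2 G x y : (forall z, 0 < z.2 -> {for z, continuous G}) ->
  0 < y -> {for y, continuous (fun y => G (x, y))}.
Proof.
move=> cG y0; apply: (@continuous_comp _ _ _ (fun y => (x, y)) G); last exact: cG.
exact: (cvg_pair (cvg_cst x) (@cvg_id _ (nbhs y))).
Qed.

End PlaneCalculus.

(** * The Fourier coefficients of [phi] and their differential equation *)

Section MaassCoefficients.
Context {R : realType} (t : R) (phi : R * R -> R).
Hypothesis maass : even_hecke_maass_cusp_form t phi.
Implicit Types (x y : R) (n : nat).

Definition maass_coef n y : R := fcoef (fun x => phi (x, y)) n.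
Definition maass_coef1 n y : R := fcoef (fun x => 'D_(0, 1) phi (x, y)) n.

Let C2 z (v w : R * R) : 0 < z.2 ->
  [/\ derivable phi z v, derivable ('D_v phi) z w & {for z, continuous ('D_w ('D_v phi))}].
Proof. by move=> z0; exact: (maass_regular maass). Qed.

Lemma partial_continuous (v z : R * R) : 0 < z.2 -> {for z, continuous ('D_v phi)}.
Proof.
apply: continuous_of_partials => {}z z0.
  have [_ h1 _] := C2 v (1, 0) z0; have [_ h2 _] := C2 v (0, 1) z0.
  exact: (conj h1 h2).
have [_ _ h1] := C2 v (1, 0) z0; have [_ _ h2] := C2 v (0, 1) z0.
exact: (conj h1 h2).
Qed.

Lemma maass_continuous (z : R * R) : 0 < z.2 -> {for z, continuous phi}.
Proof.
apply: continuous_of_partials => {}z z0.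
  have [h1 _ _] := C2 (1, 0) (1, 0) z0; have [h2 _ _] := C2 (0, 1) (1, 0) z0.
  exact: (conj h1 h2).
have c1 := @partial_continuous (1, 0) z z0; have c2 := @partial_continuous (0, 1) z z0.
exact: (conj c1 c2).
Qed.

Lemma maass_slice_continuous y : 0 < y -> continuous (fun x => phi (x, y)).
Proof. exact: continuous_slice maass_continuous. Qed.

Lemma maass_periodic x y : 0 < y -> phi (x + 1, y) = phi (x, y).
Proof.
move=> y0; have := @maass_modular _ _ _ maass (mx2 1 1 0 1) (x, y).
by rewrite mobius_translate//; apply => //; rewrite det_mx2.
Qed.

Lemma maass_slice_even x y : 0 < y -> phi (- x, y) = phi (x, y).
Proof. by move=> y0; rewrite -[RHS](maass_even maass (z := (x, y))). Qed.

Lemma der_fcoef (G : R * R -> R) n y :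
  (forall z, 0 < z.2 -> derivable G z (0, 1)) ->
  (forall z, 0 < z.2 -> {for z, continuous G}) ->
  (forall z, 0 < z.2 -> {for z, continuous ('D_(0, 1) G)}) -> 0 < y ->
  is_derive y (1 : R) (fun y => fcoef (fun x => G (x, y)) n)
    (fcoef (fun x => 'D_(0, 1) G (x, y)) n).
Proof.
move=> dG cG cdG y0.
have y2 : 0 < y / 2 by rewrite divr_gt0.
have [M hM] := @bounded_on_rectangle R _ (y / 2) (y + 1) 0 1 cdG y2.
apply: (@der_int01 R (fun z x => G (x, z) * cosn n x)
   (fun z x => 'D_(0, 1) G (x, z) * cosn n x) y (y / 2) (y + 1) M).
- by apply/andP; split; lra.
- move=> z /andP[yz _]; apply: ctsM; last exact: cosn_continuous.
  by apply: continuous_slice => //; lra.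
- move=> z x /andP[yz _] _; have z0 : 0 < z by lra.
  apply: (is_derive_eq (derM (der_vertical (dG (x, z) z0)) (der_cst _ _))).
  by rewrite mulr0 addr0.
- move=> z x /andP[yz zy] hx; rewrite normrM.
  apply: le_trans (hM x z hx _); last by apply/andP; split; lra.
  by rewrite ler_piMr// cosn_le1.
Qed.

Lemma der_maass_coef n y : 0 < y ->
  is_derive y (1 : R) (maass_coef n) (maass_coef1 n y).
Proof.
apply: der_fcoef.
- by move=> z z0; have [h _ _] := C2 (0, 1) (0, 1) z0; exact: h.
- exact: maass_continuous.
- by move=> z; exact: partial_continuous.
Qed.

Lemma partial_periodic x y : 0 < y -> 'D_(1, 0) phi (x + 1, y) = 'D_(1, 0) phi (x, y).
Proof.
move=> y0; have d z (z0 : 0 < z.2) : derivable phi z (1, 0).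
  by have [h _ _] := C2 (1, 0) (1, 0) z0; exact: h.
have [_ <-] := der_horizontal (d (x, y) y0).
have dl : is_derive x (1 : R) (fun s => s + 1) 1.
  by apply: (is_derive_eq (derD (der_id x) (der_cst 1 x))); rewrite addr0.
have := der_comp dl (der_horizontal (d (x + 1, y) y0)).
rewrite mulr1 (_ : (fun s => _) = fun s => phi (s, y)); last first.
  by apply/funext => s; exact: maass_periodic.
by move=> [_ <-].
Qed.

Lemma cD11 (z : R * R) : 0 < z.2 -> {for z, continuous ('D_(1, 0) ('D_(1, 0) phi))}.
Proof. by move=> z0; have [_ _ h] := C2 (1, 0) (1, 0) z0; exact: h. Qed.

(** Both integrations by parts are done in one antiderivative, whose values at [0] and [1] agree by
    periodicity of [phi], of its [x]-derivative and of the trigonometric factors. *)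
Lemma fcoef_laplacian_x n y : 0 < y ->
  fcoef (fun x => 'D_(1, 0) ('D_(1, 0) phi) (x, y)) n = - (2 * pi * n%:R) ^+ 2 * maass_coef n y.
Proof.
move=> y0; set k := 2 * pi * n%:R.
have cxx : continuous (fun x => 'D_(1, 0) ('D_(1, 0) phi) (x, y)).
  exact: continuous_slice cD11 y0.
have cp := maass_slice_continuous y0.
have cc := @cosn_continuous R n.
apply/eqP; rewrite -subr_eq0 -int01Z; last exact: ctsM.
rewrite -int01B; [|exact: ctsM|by apply: ctsM; [exact: cts_cst|exact: ctsM]].
pose sn x := sin (k * x).
have darg (x : R) : is_derive x (1 : R) (fun x => k * x) k.
  by apply: (is_derive_eq (derMl k (der_id x))); rewrite mulr1.
have dsn (x : R) : is_derive x (1 : R) sn (k * cosn n x).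
  by apply: (is_derive_eq (der_comp (darg x) (is_derive_sin _))); rewrite mulrC.
have dcn (x : R) : is_derive x (1 : R) (@cosn R n) (- (k * sn x)).
  by apply: (is_derive_eq (der_comp (darg x) (is_derive_cos _))); rewrite mulrC mulrN.
have dF (x : R) : 0 <= x <= 1 -> is_derive x (1 : R)
    (fun x => 'D_(1, 0) phi (x, y) * cosn n x + k * (phi (x, y) * sn x))
    ('D_(1, 0) ('D_(1, 0) phi) (x, y) * cosn n x - - k ^+ 2 * (phi (x, y) * cosn n x)).
  move=> _.
  have [d1 d2 _] := C2 (z := (x, y)) (1, 0) (1, 0) y0.
  apply: (is_derive_eq (derD (derM (der_horizontal d2) (dcn x))
    (derMl k (derM (der_horizontal d1) (dsn x))))); ring.
rewrite (int01_antider _ dF); last first.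
  by apply: ctsB; [exact: ctsM|apply: ctsM; [exact: cts_cst|exact: ctsM]].
have e1 := partial_periodic 0 y0; have e2 := maass_periodic 0 y0.
have e3 := @cosnD1 R n 0; rewrite add0r in e1, e2, e3.
have e4 : sn 1 = sn 0.
  by rewrite /sn mulr1 mulr0; have := @sin_period_nat R 0 n; rewrite add0r.
by rewrite e1 e2 e3 e4 subrr.
Qed.

Lemma der_maass_coef1 n y : 0 < y ->
  is_derive y (1 : R) (maass_coef1 n)
    (pot (2 * pi * n%:R) (4^-1 + t ^+ 2) y * maass_coef n y).
Proof.
move=> y0.
have d : is_derive y (1 : R) (maass_coef1 n) (fcoef (fun x => 'D_(0, 1) ('D_(0, 1) phi) (x, y)) n).
  apply: der_fcoef => //.
  - by move=> z z0; have [_ h _] := C2 (0, 1) (0, 1) z0; exact: h.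
  - by move=> z; exact: partial_continuous.
  - by move=> z z0; have [_ _ h] := C2 (0, 1) (0, 1) z0; exact: h.
apply: (is_derive_eq d).
have yn : y ^+ 2 != 0 by rewrite expf_neq0// gt_eqF.
have alg (m p a b c : R) : y ^+ 2 * (a + b) + m * p = 0 ->
    b * c = - (m / y ^+ 2) * (p * c) - a * c.
  move=> h; have -> : b = - (m / y ^+ 2) * p - a.
    apply: (mulfI yn); rewrite mulrBr.
    have -> : y ^+ 2 * (- (m / y ^+ 2) * p) = - (m * p) by field; rewrite gt_eqF.
    by apply/eqP; rewrite -subr_eq0 -h; apply/eqP; ring.
  by ring.
have e x := alg _ _ _ _ (cosn n x) (maass_eigen maass (z := (x, y)) y0).
rewrite /= in e.
have cp := maass_slice_continuous y0.
have cc := @cosn_continuous R n.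
rewrite /fcoef (eq_int01 (fun x _ => e x)).
rewrite int01B; first last.
- by apply: ctsM => //; exact: continuous_slice cD11 y0.
- by apply: ctsM; [exact: cts_cst|exact: ctsM].
rewrite int01Z; last exact: ctsM.
rewrite -/(fcoef _ n) -/(maass_coef n y) -/(fcoef _ n) fcoef_laplacian_x// /pot; ring.
Qed.

End MaassCoefficients.

(** * From the norm of [phi] to the square integrability of each coefficient *)

Section PlaneMeasure.
Context {R : realType}.
Local Notation mu := (@lebesgue_measure R).
Local Notation T := (measurableTypeR R).

(** Tonelli asks for measurability in the product sigma-algebra; an open set is a countable union of
    boxes with rational centre and radius. *)
Lemma open_measurable_plane (U : set (R * R)) : open U ->
  measurable (U : set (T * T)%type).
Proof.
move=> oU.
pose box (a b r : rat) : set (R * R) :=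
  `]ratr a - ratr r, ratr a + ratr r[%classic `*` `]ratr b - ratr r, ratr b + ratr r[%classic.
have mbox a b r : measurable (box a b r : set (T * T)%type).
  by apply: measurableX; exact: measurable_itv.
have -> : U = \bigcup_(a : rat) \bigcup_(b : rat) \bigcup_(r : rat)
    (if pselect (box a b r `<=` U) then box a b r else set0).
  apply/seteqP; split; last first.
    by move=> z [a _ [b _ [r _]]]; case: pselect => //= h; exact: h.
  move=> z Uz; have /nbhs_ballP[e /= e0 he] : nbhs z U by exact: open_nbhs_nbhs.
  have [r hr] : exists r : rat, e / 4 < ratr r < e / 2.
    have h : e / 4 < e / 2 by lra.
    by have [r] := rat_in_itvoo h; rewrite in_itv/= => hr; exists r.
  have /andP[r1 r2] := hr.
  have near (x : R) : exists a : rat, x - ratr r < ratr a < x + ratr r.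
    have h : x - ratr r < x + ratr r by lra.
    by have [a] := rat_in_itvoo h; rewrite in_itv/= => ha; exists a.
  have [a /andP[a1 a2]] := near z.1; have [b /andP[b1 b2]] := near z.2.
  exists a => //; exists b => //; exists r => //.
  have bz : box a b r z.
    by split; rewrite /= in_itv/=; apply/andP; split; lra.
  case: pselect => //= h; exfalso; apply: h => w [].
  rewrite /= !in_itv/= => /andP[w1 w2] /andP[w3 w4]; apply: he.
  by split; rewrite /ball/= ltr_norml; apply/andP; split; lra.
apply: bigcupT_measurable_rat => a; apply: bigcupT_measurable_rat => b.
apply: bigcupT_measurable_rat => r.
by case: pselect => h /=; [exact: mbox|exact: measurable0].
Qed.

Lemma continuous_measurable_plane (G : R * R -> R) (U : set (R * R)) : open U ->
  (forall z, U z -> {for z, continuous G}) ->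
  measurable_fun (U : set (T * T)%type) (G : (T * T)%type -> T).
Proof.
move=> oU cG; apply: (measurability _ (RGenOpens.measurableE R)).
move=> _ [_ [a [b ->] <-]]; apply: open_measurable_plane.
rewrite openE => z [Uz Gz]; apply: filterI.
  by apply: open_nbhs_nbhs.
by apply: (cG z Uz); apply: open_nbhs_nbhs; split => //; exact: interval_open.
Qed.

Lemma half_plane_open : open (upper_half_plane R).
Proof.
rewrite openE => z /= z0; apply: filterS (nbhsx_ballx z z.2 z0) => w [_].
by rewrite /ball/= /upper_half_plane/= ltr_norml => /andP[]; lra.
Qed.

End PlaneMeasure.

Section SquareIntegrable.
Context {R : realType} (t : R) (phi : R * R -> R).
Hypothesis maass : even_hecke_maass_cusp_form t phi.
Local Notation mu := (@lebesgue_measure R).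
Local Notation T := (measurableTypeR R).
Implicit Types (x y : R) (n : nat).

Lemma continuous_maass_coef n y : 0 < y -> {for y, continuous (maass_coef phi n)}.
Proof. by move=> y0; exact: der_continuous (der_maass_coef maass n y0). Qed.

(** Integrate [0 <= (phi - c cosn)^2], with [c] the coefficient itself, and use [cosn^2 <= 1]. *)
Lemma maass_coef_sq_le n y : 0 < y ->
  maass_coef phi n y ^+ 2 <= int01 (fun x => phi (x, y) ^+ 2).
Proof.
move=> y0; set c := maass_coef phi n y.
have cp := maass_slice_continuous maass y0.
have cc := @cosn_continuous R n.
have : int01 (fun x => 2 * c * (phi (x, y) * cosn n x)) <=
    int01 (fun x => phi (x, y) ^+ 2 + c ^+ 2).
  apply: le_int01.
  - by apply: ctsM; [exact: cts_cst|exact: ctsM].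
  - by apply: ctsD; [exact: ctsX|exact: cts_cst].
  move=> x _; have k1 : cosn n x ^+ 2 <= 1.
    by rewrite -[leLHS]real_normK ?num_real// expr_le1// cosn_le1.
  have : 0 <= (phi (x, y) - c * cosn n x) ^+ 2 by rewrite sqr_ge0.
  have : c ^+ 2 * cosn n x ^+ 2 <= c ^+ 2 by rewrite ler_piMr// sqr_ge0.
  move: (phi (x, y)) (cosn n x) => p q; nra.
rewrite int01Z; last exact: ctsM.
rewrite int01D; [|exact: ctsX|exact: cts_cst].
rewrite int01_cst -/(fcoef _ n) -/(maass_coef phi n y) -/c.
nra.
Qed.

Lemma int01_sym y : 0 < y ->
  int01 (fun x => phi (x, y) ^+ 2) =
  \int[mu]_(x in `[- 2^-1, 2^-1]) (phi (x, y) ^+ 2).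
Proof.
move=> y0; have cp := @ctsX R _ 2 (maass_slice_continuous maass y0).
have pp x : phi (x + 1, y) ^+ 2 = phi (x, y) ^+ 2 by rewrite (maass_periodic maass).
have [F dF] := antider_exists (-1) cp.
have hh : - 2^-1 < 2^-1 :> R by lra.
have dFs (x : R) : - 2^-1 <= x <= 2^-1 -> is_derive x (1 : R) F (phi (x, y) ^+ 2).
  by move=> /andP[x1 _]; apply: dF; lra.
rewrite (int_antider hh cp dFs).
have dF' (x : R) : 0 <= x <= 1 -> is_derive x (1 : R) F (phi (x, y) ^+ 2).
  by move=> /andP[x0 _]; apply: dF; lra.
rewrite (int01_antider cp dF').
have h2 : 2^-1 <= 1 :> R by lra.
have dG (x : R) : - 2^-1 <= x <= 0 ->
    is_derive x (1 : R) (fun x => F (1 * x + 1) - F (1 * x + 0)) 0.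
  move=> /andP[x0 x1].
  have g1 : -1 < 1 * x + 1 by lra.
  have g2 : -1 < 1 * x + 0 by lra.
  apply: (is_derive_eq (derB (der_affine dF g1) (der_affine dF g2))).
  by rewrite !mul1r addr0 pp subrr.
have h0 : - 2^-1 <= 0 :> R by lra.
have [c _] := der_mvt h0 dG.
rewrite mul0r !mul1r !addr0 add0r (_ : - 2^-1 + 1 = 2^-1); last by lra.
lra.
Qed.

(* The strip of width one above height one lies in the fundamental domain. *)
Lemma maass_coef_mass_le1 n Y : 1 < Y ->
  \int[mu]_(y in `[1, Y]) (maass_coef phi n y ^+ 2 / y ^+ 2) <= 1.
Proof.
move=> Y1.
pose A : set (T * T)%type := `[- 2^-1, 2^-1]%classic `*` `[1, Y]%classic.
pose F (z : T * T) : \bar R := (phi z ^+ 2 / z.2 ^+ 2)%:E.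
have mA : measurable A by apply: measurableX; exact: measurable_itv.
pose FD : set (T * T)%type := @fundamental_domain R.
have mU : measurable (upper_half_plane R : set (T * T)%type).
  exact: open_measurable_plane half_plane_open.
have cfst : continuous (fun z : R * R => z.1) by move=> z; exact: cvg_fst.
have csnd : continuous (fun z : R * R => z.2) by move=> z; exact: cvg_snd.
have mFD : measurable FD.
  have -> : FD = upper_half_plane R `&` ~` [set z | 2^-1 < `|z.1|] `&`
      ~` [set z | z.1 ^+ 2 + z.2 ^+ 2 < 1].
    apply/seteqP; split=> z /=.
      by move=> [h1 h2 h3]; split; [split => //|]; apply/negP; rewrite -leNgt.
    by move=> [[h1 /negP h2] /negP h3]; rewrite -!leNgt in h2 h3; split.
  apply: measurableI; [apply: measurableI => //|]; apply: measurableC;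
    apply: open_measurable_plane.
    apply: (@open_comp _ _ (fun z : R * R => `|z.1|) [set y | 2^-1 < y]); last exact: open_gt.
    move=> z _; apply: (@continuous_comp _ _ _ (fun z : R * R => z.1) (fun y : R => `|y|)).
      exact: cfst.
    exact: norm_continuous.
  apply: (@open_comp _ _ (fun z : R * R => z.1 ^+ 2 + z.2 ^+ 2) [set y | y < 1]); last exact: open_lt.
  move=> z _; apply: (@cvgD _ _ _ (nbhs z)).
    by apply: (@continuous_comp _ _ _ (fun z : R * R => z.1) (fun y : R => y ^+ 2));
      [exact: cfst|exact: exprn_continuous].
  by apply: (@continuous_comp _ _ _ (fun z : R * R => z.2) (fun y : R => y ^+ 2));
      [exact: csnd|exact: exprn_continuous].
have AFD : A `<=` FD.
  move=> z [] /=; rewrite !in_itv/= => /andP[x1 x2] /andP[y1 y2].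
  split; [lra|by rewrite ler_norml x1|].
  have : 0 <= z.1 ^+ 2 by rewrite sqr_ge0.
  have : 1 <= z.2 ^+ 2 by rewrite expr_ge1//; lra.
  lra.
have cF (z : R * R) : 0 < z.2 -> {for z, continuous (fun z => phi z ^+ 2 / z.2 ^+ 2)}.
  move=> z0; apply: (@cvgM _ _ (nbhs z)).
    have cph := @maass_continuous _ _ _ maass z z0.
    exact: (continuous_comp cph (@exprn_continuous _ 2 (phi z))).
  apply: cvgV; first by rewrite expf_neq0// gt_eqF.
  by apply: (@continuous_comp _ _ _ (fun z : R * R => z.2) (fun y : R => y ^+ 2));
      [exact: csnd|exact: exprn_continuous].
have mF : measurable_fun (upper_half_plane R : set (T * T)%type) F.
  apply/measurable_EFinP.
  exact: (continuous_measurable_plane half_plane_open cF).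
have F0 z : (0 <= F z)%E by rewrite lee_fin divr_ge0 ?sqr_ge0.
have mFFD : measurable_fun FD F by apply: measurable_funS mF => // z [].
have mFA : measurable_fun A F by apply: measurable_funS mFFD.
have le1 : (\int[(mu \x mu)%E]_(z in A) F z <= 1)%E.
  rewrite -(maass_normalized maass).
  by apply: ge0_subset_integral.
pose f := F \_ A.
have mf : measurable_fun setT f by apply/(measurable_restrictT F mA).
have f0 z : (0 <= f z)%E by rewrite /f patchE; case: ifP.
pose G (y : T) := (\int[mu]_x f (x, y))%E.
have mG : measurable_fun setT G := measurable_fun_fubini_tonelli_G f mf f0.
have leG y : (((fun y => (maass_coef phi n y ^+ 2 / y ^+ 2)%:E) \_ `[1%R, Y]) y <=
    G y)%E.
  rewrite patchE; case: ifPn => [|_]; last by apply: integral_ge0.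
  rewrite inE/= in_itv/= => hy; have /andP[y1 y2] := hy.
  have y0 : 0 < y by lra.
  have cp := @ctsX R _ 2 (maass_slice_continuous maass y0).
  have -> : G y = (\int[mu]_(x in `[(- 2^-1)%R, 2^-1%R]) (phi (x, y) ^+ 2 / y ^+ 2)%:E)%E.
    rewrite /G [RHS]integral_mkcond; apply: eq_integral => x _.
    rewrite /f !patchE; congr (if _ then _ else _).
    apply/idP/idP; rewrite !inE/=; first by case.
    by move=> hx; split; rewrite /= ?in_itv.
  rewrite -[leRHS]fineK; last first.
    by apply: integrable_fin_num => //; apply: continuous_integrable; apply: ctsM => //; exact: cts_cst.
  rewrite lee_fin -[leRHS]/(\int[mu]_(x in `[(- 2^-1)%R, 2^-1%R]) (phi (x, y) ^+ 2 / y ^+ 2)).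
  rewrite RintegralZr//; last exact: continuous_integrable.
  rewrite ler_pM2r ?invr_gt0 ?exprn_gt0// -int01_sym//.
  exact: maass_coef_sq_le.
have mc : measurable_fun `[1, Y]%classic (fun y => (maass_coef phi n y ^+ 2 / y ^+ 2)%:E).
  apply/measurable_EFinP.
  apply: subspace_continuous_measurable_fun; first exact: measurable_itv.
  apply: continuous_in_subspaceT => y; rewrite inE/= in_itv/= => /andP[y1 _].
  have y0 : 0 < y by lra.
  have cc := continuous_maass_coef (n := n) y0.
  have c2 := continuous_comp cc (@exprn_continuous _ 2 (maass_coef phi n y)).
  apply: (@cvgM _ _ (nbhs y)); first exact: c2.
  by apply: cvgV; [rewrite expf_neq0// gt_eqF|exact: exprn_continuous].
have c0 y : (0 <= (maass_coef phi n y ^+ 2 / y ^+ 2)%:E)%E by rewrite lee_fin divr_ge0 ?sqr_ge0.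
have le : (\int[mu]_(y in `[1%R, Y]) (maass_coef phi n y ^+ 2 / y ^+ 2)%:E <= 1)%E.
  apply: le_trans le1; rewrite [leRHS]integral_mkcond (fubini_tonelli2 f mf f0).
  rewrite integral_mkcond; apply: ge0_le_integral => //.
  - by move=> y _; rewrite patchE; case: ifP.
  - by apply/(measurable_restrictT _ (measurable_itv _)).
have ge : (0 <= \int[mu]_(y in `[1%R, Y]) (maass_coef phi n y ^+ 2 / y ^+ 2)%:E)%E.
  exact: integral_ge0.
rewrite -lee_fin /Rintegral fineK//.
by rewrite ge0_fin_numE// (le_lt_trans le)// ltry.
Qed.

Lemma maass_coef_L2 n : exists S : R -> R,
  (forall y : R, 1 < y -> is_derive y (1 : R) S (maass_coef phi n y ^+ 2 / y ^+ 2)) /\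
  (forall y, 1 < y -> 0 <= S y <= 1).
Proof.
exists (fun Y => \int[mu]_(y in `[1, Y]) (maass_coef phi n y ^+ 2 / y ^+ 2)); split; last first.
  move=> Y Y1; rewrite maass_coef_mass_le1// andbT Rintegral_ge0// => y _.
  by rewrite divr_ge0 ?sqr_ge0.
move=> y y1.
have cc (z : R) : 0 < z -> {for z, continuous (fun y => maass_coef phi n y ^+ 2 / y ^+ 2)}.
  move=> z0; have cc := continuous_maass_coef (n := n) z0.
  have c2 := continuous_comp cc (@exprn_continuous _ 2 (maass_coef phi n z)).
  apply: (@cvgM _ _ (nbhs z)); first exact: c2.
  by apply: cvgV; [rewrite expf_neq0// gt_eqF|exact: exprn_continuous].
have yy : y < y + 1 by rewrite ltrDl.
have y0 : 0 < y by lra.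
have ii : mu.-integrable `[1, y + 1] (EFin \o (fun y => maass_coef phi n y ^+ 2 / y ^+ 2)).
  apply: continuous_compact_integrable; first exact: segment_compact.
  apply: continuous_in_subspaceT => z; rewrite inE/= in_itv/= => /andP[z1 _].
  by apply: cc; lra.
have [d1 d2] := @continuous_FTC1_closed R _ 1 y (y + 1) yy ii y1 (cc y y0).
by split; [exact: d1|rewrite -derive1E; exact: d2].
Qed.

End SquareIntegrable.

(** * Hecke operators on Fourier coefficients *)

Section HeckeRelations.
Context {R : realType} (t : R) (phi : R * R -> R).
Hypothesis maass : even_hecke_maass_cusp_form t phi.
Implicit Types (x y : R) (n d a b m : nat).
Local Notation coef := (maass_coef phi).

Lemma maass_coef0 y : 0 < y -> coef 0 y = 0.
Proof.
have [S [dS S01]] := maass_coef_L2 maass 0.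
apply: (@constant_term_eq0 R t (coef 0) (maass_coef1 phi 0) S) => //.
- exact: (maass_spectral_gt0 maass).
- by move=> z z0; exact: (der_maass_coef maass 0 z0).
- by move=> z z0; have := der_maass_coef1 maass 0 z0; rewrite mulr0.
Qed.

Lemma cos_lt1 a : (1 < a)%N -> cos (2 * pi / a%:R) < 1 :> R.
Proof.
move=> a1; have a0 : (0 : R) < a%:R by rewrite ltr0n; exact: ltnW.
have pi0 := pi_gt0 R.
have -> : 2 * pi / a%:R = pi / a%:R + pi / a%:R :> R by ring.
rewrite cosD.
have : 0 < sin (pi / a%:R) :> R.
  apply: sin_gt0_pi; rewrite divr_gt0//= ltr_pdivrMr//.
  by rewrite ltr_pMr// ltr1n.
have := cos2Dsin2 (pi / a%:R : R).
move: (cos _) (sin _) => c s; nra.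
Qed.

(** The contribution of one divisor [d] to [hecke n] at height [y]: [a] is [n / d] and [h] is the
    slice of [phi] at height [a y / d]. *)
Definition hecke_block (h : R -> R) a d x : R := \sum_(b < d) h ((a%:R * x + b%:R) / d%:R).

Lemma hecke_block_continuous (h : R -> R) a d : continuous h -> continuous (hecke_block h a d).
Proof.
move=> ch; apply: cts_sum => b.
rewrite (_ : (fun x => _) = fun x => h (d%:R^-1 * a%:R * x + b%:R / d%:R)).
  exact: affine_continuous.
by apply/funext => x; congr h; ring.
Qed.

Lemma hecke_block_shift (h : R -> R) a d x : (0 < a)%N -> (0 < d)%N ->
  (forall x, h (x + 1) = h x) -> hecke_block h a d (x + a%:R^-1) = hecke_block h a d x.
Proof.
move=> a0 d0 ph; have an : (a%:R : R) != 0 by rewrite pnatr_eq0 -lt0n.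
have dn : (d%:R : R) != 0 by rewrite pnatr_eq0 -lt0n.
rewrite /hecke_block; pose f b := h ((a%:R * x + b%:R) / d%:R).
rewrite -[RHS](big_mkord xpredT f).
have -> : \sum_(b < d) h ((a%:R * (x + a%:R^-1) + b%:R) / d%:R) = \sum_(0 <= b < d) f b.+1.
  rewrite big_mkord; apply: eq_bigr => b _; rewrite /f; congr h.
  by rewrite -natr1; field; rewrite an dn.
case: d d0 dn @f => // d _ dn f; rewrite big_nat_recr//= [RHS]big_nat_recl//= addrC; congr (_ + _).
rewrite /f -[RHS]ph; congr h; field.
by rewrite -natr1 in dn; move: dn; rewrite addrC.
Qed.

(** The block has period [1/a]. The shift by [1/a] rotates the pair of first cosine and sine
    coefficients by the angle [2 pi / a], and a pair fixed by a nontrivial rotation is zero. *)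
Lemma hecke_block_coef_eq0 (h : R -> R) a d : (1 < a)%N -> (0 < d)%N -> continuous h ->
  (forall x, h (x + 1) = h x) -> fcoef (hecke_block h a d) 1 = 0.
Proof.
move=> a1 d0 ch ph; have a0 : (0 < a)%N by exact: ltnW.
set G := hecke_block h a d.
have an : (a%:R : R) != 0 by rewrite pnatr_eq0 -lt0n.
have cG : continuous G by exact: hecke_block_continuous.
have sG x : G (x + a%:R^-1) = G x by exact: hecke_block_shift.
have pG x : G (x + 1) = G x.
  have sGn k : G (x + k%:R / a%:R) = G x.
    elim: k => [|k IH]; first by rewrite mul0r addr0.
    by rewrite -natr1 mulrDl mul1r addrA sG.
  by have := sGn a; rewrite divff.
pose sn x := sin (2 * pi * 1%:R * x) : R.
have csn : continuous sn.
  by apply: (cts_comp (@mulrl_continuous _ _)); exact: continuous_sin.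
have ccn := @cosn_continuous R 1.
pose al : R := 2 * pi / a%:R.
have shc x : cosn 1 (x + a%:R^-1) = cos al * cosn 1 x - sin al * sn x.
  rewrite /cosn /sn mulrDr (_ : 2 * pi * 1%:R * a%:R^-1 = al) ?cosD; last by rewrite /al; ring.
  by rewrite mulrC [sin _ * sin _]mulrC.
have shs x : sn (x + a%:R^-1) = cos al * sn x + sin al * cosn 1 x.
  rewrite /cosn /sn mulrDr (_ : 2 * pi * 1%:R * a%:R^-1 = al) ?sinD; last by rewrite /al; ring.
  by rewrite mulrC [cos _ * sin _]mulrC.
have psn x : sn (x + 1) = sn x by rewrite /sn mulrDr mulr1 sin_period_nat.
have ai : 0 <= a%:R^-1 :> R by rewrite invr_ge0.
pose I := int01 (fun x => G x * cosn 1 x); pose J := int01 (fun x => G x * sn x).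
have cGc : continuous (fun x => G x * cosn 1 x) by exact: ctsM.
have cGs : continuous (fun x => G x * sn x) by exact: ctsM.
have eI : I = cos al * I - sin al * J.
  rewrite {1}/I -(@int01_shift R (fun x => G x * cosn 1 x) cGc _ _ ai); last first.
    by move=> x; rewrite pG cosnD1.
  rewrite -int01Z// -[sin al * J]int01Z// -int01B; [|by apply: ctsM => //; exact: cts_cst..].
  by congr int01; apply/funext => x; rewrite sG shc; ring.
have eJ : J = cos al * J + sin al * I.
  rewrite {1}/J -(@int01_shift R (fun x => G x * sn x) cGs _ _ ai); last first.
    by move=> x; rewrite pG psn.
  rewrite -int01Z// -[sin al * I]int01Z// -int01D; [|by apply: ctsM => //; exact: cts_cst..].
  by congr int01; apply/funext => x; rewrite sG shs; ring.
have c1 : cos al < 1 by exact: cos_lt1.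
change (I = 0); move: eI eJ c1; move: (cos al) (sin al) I J => c s I J eI eJ c1.
have hI : I * ((1 - c) ^+ 2 + s ^+ 2) = 0.
  have e1 : (1 - c) * I = - (s * J) by rewrite mulrBl mul1r {1}eI; ring.
  have e2 : (1 - c) * J = s * I by rewrite mulrBl mul1r {1}eJ; ring.
  have -> : I * ((1 - c) ^+ 2 + s ^+ 2) = (1 - c) * ((1 - c) * I) + s * (s * I) by ring.
  by rewrite e1 -e2; ring.
move/eqP: hI; rewrite mulf_eq0 => /orP[/eqP//|].
rewrite gt_eqF// ltr_wpDr ?sqr_ge0// exprn_gt0//; lra.
Qed.

Lemma hecke_block_coef1 y d m : 0 < y -> (0 < d)%N ->
  fcoef (hecke_block (fun x => phi (x, y)) 1 d) m = d%:R * coef (d * m)%N y.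
Proof.
move=> y0 d0; have dn : (d%:R : R) != 0 by rewrite pnatr_eq0 -lt0n.
rewrite -(int01_split _ d0); last first.
  by apply: ctsM; [exact: (maass_slice_continuous maass y0)|exact: cosn_continuous].
congr int01; apply/funext => x; rewrite /hecke_block mulr_suml; apply: eq_bigr => b _.
rewrite mul1r; congr (_ * _); rewrite /cosn -[LHS](cos_period_nat _ (b * m)).
by congr cos; rewrite !natrM; field.
Qed.

Lemma heckeE n x y : hecke n phi (x, y) = (Num.sqrt n%:R)^-1 * \sum_(d <- divisors n)
  hecke_block (fun x => phi (x, (n %/ d)%N%:R * y / d%:R)) (n %/ d)%N d x.
Proof. by []. Qed.

Lemma coef_hecke n m y : (0 < n)%N -> 0 < y ->
  fcoef (fun x => hecke n phi (x, y)) m = (Num.sqrt n%:R)^-1 * \sum_(d <- divisors n)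
    fcoef (hecke_block (fun x => phi (x, (n %/ d)%N%:R * y / d%:R)) (n %/ d)%N d) m.
Proof.
move=> n0 y0.
pose F d := hecke_block (fun x => phi (x, (n %/ d)%N%:R * y / d%:R)) (n %/ d)%N d.
have cF d : d \in divisors n -> continuous (F d).
  rewrite -dvdn_divisors// => dn; apply: hecke_block_continuous.
  apply: (maass_slice_continuous maass).
  have d0 := dvdn_gt0 n0 dn.
  by rewrite divr_gt0 ?ltr0n// mulr_gt0// ltr0n divn_gt0// dvdn_leq.
have cc := @cosn_continuous R m.
have -> : (fun x => hecke n phi (x, y)) =
    fun x => (Num.sqrt n%:R)^-1 * \sum_(d <- divisors n) F d x.
  by apply/funext => x; rewrite heckeE.
rewrite /fcoef; move: (Num.sqrt n%:R)^-1 => c; elim: (divisors n) cF => [|d r IH] cF.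
  rewrite big_nil mulr0 -[RHS](int01_cst 0); congr int01; apply/funext => x.
  by rewrite big_nil mulr0 mul0r.
have cd : continuous (F d) by apply: cF; rewrite mem_head.
have cr : continuous (fun x => \sum_(d <- r) F d x).
  elim: r {IH} cF => [|e r IH] cF.
    by rewrite (_ : (fun x => _) = fun=> 0); [exact: cts_cst|apply/funext => x; rewrite big_nil].
  rewrite (_ : (fun x => _) = fun x => F e x + \sum_(d <- r) F d x).
    apply: ctsD; first by apply: cF; rewrite !inE eqxx orbT.
    by apply: IH => i; rewrite inE => /orP[/eqP->|ir]; apply: cF; rewrite !inE ?eqxx// ir !orbT.
  by apply/funext => x; rewrite big_cons.
rewrite big_cons mulrDr -IH; last by move=> i ir; apply: cF; rewrite inE ir orbT.
rewrite -int01Z; last exact: ctsM.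
rewrite -int01D; first last.
- by apply: ctsM => //; apply: ctsM => //; exact: cts_cst.
- by apply: ctsM; [exact: cts_cst|exact: ctsM].
by congr int01; apply/funext => x; rewrite big_cons mulrDr mulrDl mulrA.
Qed.

Lemma fcoefZ_phi m y (l : R) : 0 < y -> fcoef (fun x => l * phi (x, y)) m = l * coef m y.
Proof.
move=> y0; have cp := ctsM (maass_slice_continuous maass y0) (@cosn_continuous R m).
by rewrite -(int01Z l cp); congr int01; apply/funext => x; rewrite mulrA.
Qed.

(** Compare first coefficients at height [n y]: a divisor [d < n] has [a = n / d > 1] and drops out,
    while [d = n] gives [n] times the [n]-th coefficient at height [n y / n = y]. *)
Lemma hecke_coef n (l : R) : (0 < n)%N ->
  (forall z, upper_half_plane R z -> hecke n phi z = l * phi z) ->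
  forall y, 0 < y -> coef n y = l / Num.sqrt n%:R * coef 1 (n%:R * y).
Proof.
move=> n0 hl y y0; have nn : (0 : R) < n%:R by rewrite ltr0n.
have ny : 0 < n%:R * y by rewrite mulr_gt0.
have := coef_hecke 1 n0 ny.
have -> : (fun x => hecke n phi (x, n%:R * y)) = fun x => l * phi (x, n%:R * y).
  by apply/funext => x; rewrite hl.
rewrite fcoefZ_phi// (bigD1_seq n) ?divisors_uniq//=; last by rewrite -dvdn_divisors.
rewrite divnn n0 big1_seq ?addr0; last first.
  move=> d /andP[dn]; rewrite -dvdn_divisors// => dvd.
  have d0 := dvdn_gt0 n0 dvd.
  have y'0 : 0 < (n %/ d)%N%:R * (n%:R * y) / d%:R :> R.
    by rewrite divr_gt0 ?ltr0n// mulr_gt0// ltr0n divn_gt0// dvdn_leq.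
  apply: hecke_block_coef_eq0 => //.
  - rewrite (ltn_divRL _ dvd) mul1n ltn_neqAle dn; exact: (dvdn_leq n0 dvd).
  - exact: (maass_slice_continuous maass y'0).
  - by move=> x; exact: (maass_periodic maass _ y'0).
have -> : 1%:R * (n%:R * y) / n%:R = y :> R by field; rewrite gt_eqF.
rewrite hecke_block_coef1// muln1 => e.
have sn : Num.sqrt n%:R ^+ 2 = n%:R :> R by rewrite sqr_sqrtr// ltW.
have s0 : 0 < Num.sqrt n%:R :> R by rewrite sqrtr_gt0.
have s0' := lt0r_neq0 s0; rewrite mulrAC e.
move: (Num.sqrt _) (coef n y) s0' sn => s c s0' <-.
by field.
Qed.

(** In the second coefficient of [hecke 2] both divisors contribute; this is the source of the
    relation between [al 4] and [al 2]. *)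
Lemma hecke2_coef2 (l : R) :
  (forall z, upper_half_plane R z -> hecke 2 phi z = l * phi z) ->
  forall y, 0 < y -> coef 1 (2 * y) + 2 * coef 4 (y / 2) = Num.sqrt 2 * l * coef 2 y.
Proof.
move=> hl y y0; have := coef_hecke 2 (isT : (0 < 2)%N) y0.
have -> : (fun x => hecke 2 phi (x, y)) = fun x => l * phi (x, y).
  by apply/funext => x; rewrite hl.
rewrite fcoefZ_phi// (_ : divisors 2 = [:: 1; 2]%N)// big_cons big_seq1.
rewrite !divn1 divnn/= hecke_block_coef1 ?divr_gt0 ?mulr_gt0//.
have -> : fcoef (hecke_block (fun x => phi (x, 2%:R * y / 1%:R)) 2 1) 2 = coef 1 (2 * y).
  have y2 : 0 < 2 * y by rewrite mulr_gt0.
  rewrite divr1 /maass_coef /fcoef.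
  rewrite -(@int01_dilate R (fun x => phi (x, 2 * y) * cosn 1 x) _ _ 2)//.
  - congr int01; apply/funext => x; rewrite /hecke_block big_ord1 addr0 divr1.
    by congr (_ * _); rewrite /cosn; congr cos; ring.
  - by apply: ctsM; [exact: (maass_slice_continuous maass y2)|exact: cosn_continuous].
  - by move=> x; rewrite (maass_periodic maass)// cosnD1.
rewrite mul1r => e.
have s0 : 0 < Num.sqrt 2 :> R by rewrite sqrtr_gt0.
by rewrite -mulrA e mulrA divff ?mul1r// gt_eqF.
Qed.

End HeckeRelations.

(** * Boundedness of [phi] and bounds on the Hecke eigenvalues *)

Section HeckeBound.
Context {R : realType} (t : R) (phi : R * R -> R).
Hypothesis maass : even_hecke_maass_cusp_form t phi.
Implicit Types (x y M : R) (n d a b m : nat).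
Local Notation coef := (maass_coef phi).
Local Notation mu := (4^-1 + t ^+ 2).
Local Notation q1 := (pot (2 * pi * 1%:R) mu).

Let t0 : 0 < t := maass_spectral_gt0 maass.

Lemma mu_gt0 : 0 < mu.
Proof. by rewrite addr_gt0 ?exprn_gt0 ?invr_gt0. Qed.

(** Only the positive part of the potential is multiplied by [n^2], so a decay rate for [c_1]
    becomes [n] times that rate for [c_n] at the same height. *)
Lemma pot_scale n y : (0 < n)%N -> 0 < y -> n%:R ^+ 2 * q1 y <= pot (2 * pi * n%:R) mu y.
Proof.
move=> n0 y0; have n1 : (1 : R) <= n%:R ^+ 2 by rewrite expr_ge1// ler1n.
have : 0 <= mu / y ^+ 2 by rewrite divr_ge0 ?exprn_ge0 ?ltW// mu_gt0.
rewrite /pot !exprMn expr1n mulr1.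
have -> : n%:R ^+ 2 * (2 ^+ 2 * pi ^+ 2 - mu / y ^+ 2) =
  2 ^+ 2 * pi ^+ 2 * n%:R ^+ 2 - n%:R ^+ 2 * (mu / y ^+ 2) by ring.
by move=> h; rewrite lerD2l lerN2 ler_peMl.
Qed.

Lemma norm_decay (e p r : R) : `|p| ^+ 2 <= expR (- (2 * e)) * `|r| ^+ 2 -> `|p| <= expR (- e) * `|r|.
Proof.
move=> h; rewrite -ler_sqr ?nnegrE ?mulr_ge0 ?expR_ge0//.
by rewrite exprMn -expRM_natr (_ : - e * 2%:R = - (2 * e))//; ring.
Qed.

Lemma coef_decay n kap y1 y : (0 < n)%N -> 0 < y1 -> y1 <= y -> 0 <= kap ->
  kap ^+ 2 <= q1 y1 ->
  `|coef n y| <= expR (- (kap * n%:R * (y - y1))) * `|coef n y1|.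
Proof.
move=> n0 y10 yy kap0 hk; have [S [dS S01]] := maass_coef_L2 maass n.
apply: norm_decay; rewrite !real_normK ?num_real//.
rewrite (_ : 2 * (kap * n%:R * (y - y1)) = 2 * (kap * n%:R) * (y - y1)); last by ring.
have kap1 : 0 <= kap * n%:R by rewrite mulr_ge0.
have kq : (kap * n%:R) ^+ 2 <= pot (2 * pi * n%:R) mu y1.
  apply: le_trans (pot_scale n0 y10).
  by rewrite exprMn mulrC ler_wpM2l// exprn_ge0.
exact: (@sq_decay R (2 * pi * n%:R) mu (coef n) (maass_coef1 phi n) S mu_gt0
  (der_maass_coef maass n) (der_maass_coef1 maass n) dS S01 _ _ _ y10 yy kap1 kq).
Qed.

Lemma reduce_strip x y : 0 < y -> exists2 x', 0 <= x' <= 2^-1 & phi (x, y) = phi (x', y).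
Proof.
move=> y0; have [x' hx' e] := even_periodic_reduce x; exists x' => //.
by apply: (e (fun x => phi (x, y))) => z; [exact: (maass_periodic maass)|exact: (maass_slice_even maass)].
Qed.

Lemma phi_invert x y : 0 < y ->
  phi (- x / (x ^+ 2 + y ^+ 2), y / (x ^+ 2 + y ^+ 2)) = phi (x, y).
Proof.
move=> y0; have := @maass_modular _ _ _ maass (mx2 0 (-1) 1 0) (x, y).
by rewrite mobius_invert//; apply => //; rewrite det_mx2.
Qed.

(** Induction on [k] with [1 < 2^k y]: a point with [|x| <= 1/2] and [y < 1/2] has
    [x^2 + y^2 <= 1/2], so the inversion at least doubles its height. *)
Lemma bound_all M : (forall x y, 2^-1 <= y -> `|phi (x, y)| <= M) ->
  forall z, upper_half_plane R z -> `|phi z| <= M.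
Proof.
move=> hM [x y] y0.
have [k] : exists k : nat, y^-1 < 2 ^+ k by apply: expr_unbounded; lra.
rewrite /upper_half_plane/= in y0.
rewrite -[ltLHS]mul1r ltr_pdivrMr// => hk.
elim: k x y y0 hk => [|k IH] x y y0 hk.
  by apply: hM; rewrite expr0 mul1r in hk; lra.
have [h|h] := leP 2^-1 y; first exact: hM.
have [x' /andP[h1 h2] ->] := reduce_strip x y0.
rewrite -phi_invert//; set D := x' ^+ 2 + y ^+ 2.
have y2 : 0 < y ^+ 2 by rewrite exprn_gt0.
have D0 : 0 < D by rewrite ltr_wpDl ?sqr_ge0.
have D1 : D <= 2^-1 by rewrite /D; nra.
apply: IH; first by rewrite divr_gt0.
rewrite mulrA ltr_pdivlMr// mul1r.
apply: le_lt_trans D1 _; rewrite exprS in hk; lra.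
Qed.

(** Above [t + 2] the Fourier tail gives the bound, down to [1/2] compactness of a rectangle, and
    below that [bound_all]. *)
Lemma phi_bounded : exists M, forall z, upper_half_plane R z -> `|phi z| <= M.
Proof.
have ht : 0 < t := t0.
pose y1 := t + 1; have y10 : 0 < y1 by rewrite /y1; lra.
(* From [mu <= (t + 1)^2] and [(2 pi)^2 >= 16]. *)
have hq : 2 ^+ 2 <= q1 y1.
  have : mu / y1 ^+ 2 <= 1.
    by rewrite ler_pdivrMr ?exprn_gt0// /y1 mul1r; nra.
  rewrite /pot; have := pi_ge2 R => p2.
  have : 4 <= pi ^+ 2 :> R by rewrite (_ : 4 = 2 ^+ 2) ?ler_sqr ?nnegrE//; [lra|ring].
  rewrite !exprMn expr1n; lra.
have [M1 hM1] := @bounded_on_rectangle R phi y1 y1 0 1 (@maass_continuous _ _ _ maass) y10.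
have c1 n : `|coef n y1| <= M1.
  apply: int01_norm_le; first exact: fcoef_fun_continuous (maass_slice_continuous maass y10).
  move=> x hx; rewrite normrM; apply: le_trans (hM1 x y1 hx _); last by rewrite lexx.
  by rewrite ler_piMr// cosn_le1.
have M10 : 0 <= M1 by apply: le_trans (c1 0%N); rewrite normr_ge0.
have r1 : 0 <= expR (- 2 : R) < 1.
  by apply/andP; split; [exact: expR_ge0|rewrite -[ltRHS]expR0 ltr_expR; lra].
pose M2 : R := 2 * M1 / (1 - expR (- 2 : R)).
have high x y : y1 + 1 <= y -> `|phi (x, y)| <= M2.
  move=> hy; have y0 : 0 < y by lra.
  have [x' hx' ->] := reduce_strip x y0.
  have := @fourier_tail R (fun x => phi (x, y)) M1 (expR (- 2 : R)) 0 x'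
    (maass_slice_continuous maass y0) (fun x => maass_periodic maass x y0)
    (fun x => maass_slice_even maass x y0) (maass_coef0 maass y0) r1 M10.
  rewrite /fsum big_ord0 subr0 expr0 mulr1; apply => // n _.
  case: (posnP n) => [->|n0].
    by rewrite (_ : fcoef _ _ = coef 0 y)// (maass_coef0 maass y0) normr0 expr0 mulr1.
  have y1y : y1 <= y by lra.
  apply: le_trans (coef_decay n0 y10 y1y _ hq) _ => //.
  rewrite mulrC; apply: ler_pM; [exact: normr_ge0|exact: expR_ge0|exact: c1|].
  rewrite -expRM_natr ler_expR mulNr lerN2 -mulrA ler_wpM2l//.
  by rewrite ler_peMr//; lra.
have h2 : 0 < 2^-1 :> R by lra.
have [M3 hM3] := @bounded_on_rectangle R phi 2^-1 (y1 + 1) 0 1 (@maass_continuous _ _ _ maass) h2.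
exists (Num.max M2 M3); apply: bound_all => x y hy.
have y0 : 0 < y by lra.
rewrite le_max; have [h|h] := leP (y1 + 1) y; first by rewrite high.
have [x' /andP[hx1 hx2] ->] := reduce_strip x y0.
by rewrite hM3 ?orbT//; apply/andP; split; lra.
Qed.

Lemma phi_nonzero : exists2 z, upper_half_plane R z & phi z != 0.
Proof.
apply: contrapT => h.
have z0 z : upper_half_plane R z -> phi z = 0.
  by move=> hz; apply: contrapT => /eqP pz; apply: h; exists z.
have := maass_normalized maass; rewrite /L2norm_sq.
rewrite integral0_eq; first by move=> /eqP; rewrite eq_sym onee_eq0.
by move=> z [hz _ _]; rewrite z0// expr0n mul0r.
Qed.

(** A zero there would make [c_1] vanish identically, then every [c_n] by the Hecke relation, then
    [phi], against the normalization. *)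
Lemma coef1_nonzero y : 0 < y -> 0 <= q1 y -> coef 1 y != 0.
Proof.
move=> y0 qy; apply/eqP => u0.
have [S [dS S01]] := maass_coef_L2 maass 1.
have uz := zero_vanishes mu_gt0 (fun z z0 => der_maass_coef maass 1 z0)
  (fun z z0 => der_maass_coef1 maass 1 z0) dS S01 y0 qy u0.
have [[x z] hz /eqP] := phi_nonzero; apply.
rewrite /upper_half_plane/= in hz.
have [x' hx' ->] := reduce_strip x hz.
have cn n : fcoef (fun x => phi (x, z)) n = 0.
  case: (posnP n) => [->|n0]; first exact: (maass_coef0 maass hz).
  have [l hl] := maass_hecke maass n0.
  by rewrite -/(coef n z) (hecke_coef maass n0 hl hz) uz ?mulr0// mulr_gt0// ltr0n.
have r1 : 0 <= (0 : R) < 1 by rewrite lexx ltr01.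
have := @fourier_tail R (fun x => phi (x, z)) 0 0 0 x'
    (maass_slice_continuous maass hz) (fun x => maass_periodic maass x hz)
    (fun x => maass_slice_even maass x hz) (cn 0%N) r1 (lexx _).
rewrite /fsum big_ord0 subr0 !(mulr0, mul0r) => H.
apply/eqP; rewrite -normr_le0; apply: H => // n _.
by rewrite cn normr0 mul0r.
Qed.

Lemma sum_divisors_le n : (0 < n)%N -> (\sum_(d <- divisors n) d <= n * n)%N.
Proof.
move=> n0; apply: (@leq_trans (\sum_(d <- divisors n) n)).
  rewrite !big_seq; apply: leq_sum => d; rewrite -dvdn_divisors// => dn.
  exact: dvdn_leq.
rewrite big_const_seq iter_addn_0 mulnC leq_mul2r; apply/orP; right.
rewrite (_ : count _ _ = size (divisors n)); last by rewrite count_predT.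
rewrite -[leqRHS](size_iota 1 n); apply: uniq_leq_size; first exact: divisors_uniq.
move=> d; rewrite -dvdn_divisors// mem_iota => dn.
by rewrite (dvdn_gt0 n0 dn) add1n ltnS dvdn_leq.
Qed.

Lemma hecke_norm_le n M z : (0 < n)%N -> upper_half_plane R z ->
  (forall z, upper_half_plane R z -> `|phi z| <= M) ->
  `|hecke n phi z| <= (Num.sqrt n%:R)^-1 * (n%:R ^+ 2 * M).
Proof.
move=> n0 z0 hM; have M0 : 0 <= M by apply: le_trans (hM z z0); rewrite normr_ge0.
rewrite /hecke normrM ger0_norm ?invr_ge0 ?sqrtr_ge0// ler_wpM2l ?invr_ge0 ?sqrtr_ge0//.
apply: (@le_trans _ _ (\sum_(d <- divisors n) d%:R * M)).
  apply: le_trans (ler_norm_sum _ _ _) _; rewrite !big_seq; apply: ler_sum => d.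
  rewrite -dvdn_divisors// => dn; have d0 := dvdn_gt0 n0 dn.
  apply: le_trans (ler_norm_sum _ _ _) _.
  apply: (@le_trans _ _ (\sum_(b < d) M)).
    apply: ler_sum => b _; apply: hM; rewrite /upper_half_plane/=.
    by rewrite divr_gt0 ?ltr0n// mulr_gt0// ltr0n divn_gt0// dvdn_leq.
  by rewrite sumr_const card_ord mulr_natl.
rewrite -mulr_suml ler_wpM2r// -natr_sum -natrX ler_nat.
exact: sum_divisors_le.
Qed.

(** Compare the suprema of [|hecke n phi|] and [|phi|]. The bound is crude, but polynomial growth in
    [n] is absorbed by the exponential decay of [c_1]. *)
Lemma hecke_eigenvalue_le n (l : R) : (0 < n)%N ->
  (forall z, upper_half_plane R z -> hecke n phi z = l * phi z) ->
  `|l| <= (Num.sqrt n%:R)^-1 * n%:R ^+ 2.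
Proof.
move=> n0 hl; have [M hM] := phi_bounded.
pose A := [set `|phi z| | z in upper_half_plane R].
have [z1 hz1 nz1] := phi_nonzero.
have Asup : has_sup A.
  split; first by exists `|phi z1|; exists z1.
  by exists M => _ [z hz <-]; exact: hM.
have leS z : upper_half_plane R z -> `|phi z| <= sup A.
  by move=> hz; apply: ub_le_sup; [case: Asup|exists z].
have S0 : 0 < sup A by apply: lt_le_trans (leS _ hz1); rewrite normr_gt0.
rewrite -(ler_pM2r S0) -mulrA; set K := _ * (_ * _).
have hz z : upper_half_plane R z -> `|l| * `|phi z| <= K.
  by move=> hz; rewrite -normrM -hl//; exact: hecke_norm_le.
have [->|l0] := eqVneq l 0.
  by apply: le_trans (hz z1 hz1); rewrite normr0 !mul0r mulr_ge0.
have l1 : 0 < `|l| by rewrite normr_gt0.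
rewrite mulrC -ler_pdivlMr//; apply: ge_sup; first by case: Asup.
by move=> _ [z h <-]; rewrite ler_pdivlMr// mulrC hz.
Qed.

Lemma hecke_coefs : exists al : nat -> R,
  [/\ forall n y, (0 < n)%N -> 0 < y -> coef n y = al n * coef 1 (n%:R * y),
      forall n, (0 < n)%N -> `|al n| <= n%:R &
      al 4 = al 2 ^+ 2 - 2^-1].
Proof.
have [n|l hl] := @choice nat R (fun n l => (0 < n)%N ->
    forall z, upper_half_plane R z -> hecke n phi z = l * phi z).
  by case: (posnP n) => [->|/(maass_hecke maass)[l hl]]; [exists 0|exists l].
exists (fun n => l n / Num.sqrt n%:R).
have sq n : (0 < n)%N -> Num.sqrt n%:R ^+ 2 = n%:R :> R by move=> n0; rewrite sqr_sqrtr.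
have sp n : (0 < n)%N -> 0 < Num.sqrt n%:R :> R by move=> n0; rewrite sqrtr_gt0 ltr0n.
split.
- by move=> n y n0; exact: (hecke_coef maass n0 (hl n n0)).
- move=> n n0; have hs := sp n n0; rewrite normrM normfV (gtr0_norm hs) ler_pdivrMr//.
  apply: le_trans (hecke_eigenvalue_le n0 (hl n n0)) _.
  by rewrite ler_pdivrMl// mulrCA -expr2 sq// expr2.
(* A height where [c_1] is nonzero, so that it can be cancelled from the relation for [hecke 2] at
   [y / 2]. *)
pose y := t + 1; have ht : 0 < t := t0; have y0 : 0 < y by rewrite /y; lra.
have u0 : coef 1 y != 0.
  apply: coef1_nonzero => //.
  have : mu / y ^+ 2 <= 1 by rewrite ler_pdivrMr ?exprn_gt0// /y mul1r; nra.
  rewrite /pot; have := pi_ge2 R => p2.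
  have : 4 <= pi ^+ 2 :> R by rewrite (_ : 4 = 2 ^+ 2) ?ler_sqr ?nnegrE//; [lra|ring].
  rewrite !exprMn expr1n; lra.
have y2 : 0 < y / 2 by lra.
have := hecke2_coef2 maass (hl 2%N isT) y2.
rewrite (hecke_coef maass (isT : (0 < 4)%N) (hl 4%N isT)); last by lra.
rewrite (hecke_coef maass (isT : (0 < 2)%N) (hl 2%N isT))//.
have -> : 2 * (y / 2) = y by field.
have -> : 4%:R * (y / 2 / 2) = y by field.
move: (sq 2%N isT) (sp 2%N isT) (coef 1 y) u0 (l 2%N) (l 4%N).
have -> : Num.sqrt 4%:R = 2 :> R.
  by rewrite (_ : 4%:R = 2 ^+ 2); [rewrite sqrtr_sqr ger0_norm|ring].
move: (Num.sqrt _) => s s2 s0 u u0 l2 l4 e.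
have {}e : 1 + l4 = l2 ^+ 2.
  apply: (mulIf u0); rewrite mulrDl mul1r.
  have -> : l4 * u = 2 * (l4 / 2 * u) by field.
  rewrite e; field; exact: lt0r_neq0.
by rewrite expr_div_n s2 -e; field.
Qed.

End HeckeBound.

(** * The first coefficient on both sides of its turning point *)

Section TransitionRange.
Context {R : realType} (t : R) (phi : R * R -> R).
Hypothesis maass : even_hecke_maass_cusp_form t phi.
Implicit Types (x y : R) (n m : nat).
Local Notation coef := (maass_coef phi).
Local Notation u := (maass_coef phi 1).
Local Notation u1 := (maass_coef1 phi 1).
Local Notation mu := (4^-1 + t ^+ 2).
Local Notation q1 := (pot (2 * pi * 1%:R) mu).
Let tau := t / (2 * pi).
Hypothesis tau_ge : 60 * 60 <= tau.

Let P : R := (2 * pi) ^+ 2.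

Lemma pi_le4 : pi <= 4 :> R.
Proof. by have := @pihalf_lt2 R; lra. Qed.

Lemma P_bounds : 16 <= P <= 64.
Proof.
have h1 := pi_ge2 R; have h2 := pi_le4; rewrite /P; apply/andP; split; nra.
Qed.

Lemma tau_gt0 : 0 < tau. Proof. by move: tau_ge; lra. Qed.

(** The [1/4] in [mu] displaces the turning point from [tau] by a relative amount that [401 / 400]
    covers. *)
Lemma mu_bounds : P * tau ^+ 2 <= mu <= P * (401 / 400 * tau ^+ 2).
Proof.
have e : P * tau ^+ 2 = t ^+ 2.
  by rewrite /P /tau; have := lt0r_neq0 (pi_gt0 R); move: (pi : R) => p p0; field.
have /andP[P1 _] := P_bounds.
have h1 : 10 * 10 <= tau ^+ 2 by have t10 : 10 <= tau; [move: tau_ge; lra|rewrite expr2 ler_pM].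
have h2 : 16 * tau ^+ 2 <= t ^+ 2 by rewrite -e ler_wpM2r// sqr_ge0.
have -> : P * (401 / 400 * tau ^+ 2) = 401 / 400 * t ^+ 2 by rewrite -e; ring.
rewrite e; move: (t ^+ 2) (tau ^+ 2) h1 h2 => w1 w2 h1 h2.
by apply/andP; split; lra.
Qed.

Lemma q1E y : q1 y = P - mu / y ^+ 2.
Proof. by rewrite /pot /P mulr1. Qed.

Lemma q1_ge (th y : R) : 0 < th -> th * tau <= y -> P * (1 - 401 / 400 / th ^+ 2) <= q1 y.
Proof.
move=> th0 hy; have tt := tau_gt0; have /andP[P1 _] := P_bounds.
have tht : 0 < th * tau by rewrite mulr_gt0.
have y0 : 0 < y by exact: lt_le_trans hy.
have /andP[_ m2] := mu_bounds.
rewrite q1E mulrBr mulr1 lerD2l lerN2 ler_pdivrMr ?exprn_gt0//.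
apply: le_trans m2 _; rewrite -[leRHS]mulrA ler_wpM2l//; first by move: P1; lra.
have c0 : 0 <= 401 / 400 :> R by lra.
move: (401 / 400) c0 => c c0; rewrite -[leRHS]mulrA ler_wpM2l//.
rewrite mulrC ler_pdivlMr ?exprn_gt0// -exprMn mulrC ler_sqr ?nnegrE ?(ltW y0)//.
by rewrite ltW.
Qed.

Lemma q1_le (th y : R) : 0 < y -> 0 < th -> y <= th * tau -> q1 y <= P * (1 - (th ^+ 2)^-1).
Proof.
move=> y0 th0 hy; have tt := tau_gt0; have /andP[P1 _] := P_bounds.
have /andP[m1 _] := mu_bounds.
rewrite q1E mulrBr mulr1 lerD2l lerN2 ler_pdivlMr ?exprn_gt0//.
apply: le_trans m1; rewrite -[leLHS]mulrA ler_wpM2l//; first by move: P1; lra.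
rewrite mulrC ler_pdivrMr ?exprn_gt0// -exprMn mulrC ler_sqr ?nnegrE ?(ltW y0)//.
by rewrite mulr_ge0// ltW.
Qed.

(* [tau] is the turning point of [u]; just beyond it the decay rate is already 3 / 2. *)
Let yb := 11 / 10 * tau.

Lemma q1_yb : (3 / 2) ^+ 2 <= q1 yb.
Proof.
have h : 0 < 11 / 10 :> R by lra.
have := q1_ge h (lexx yb); have /andP[P1 _] := P_bounds.
lra.
Qed.

Lemma u_neq0 y : yb <= y -> u y != 0.
Proof.
move=> hy; have tt := tau_gt0.
have yb0 : 0 < yb by rewrite /yb mulr_gt0.
apply: (coef1_nonzero maass); first exact: lt_le_trans hy.
by have := pot_nondecr (2 * pi * 1%:R) (mu_gt0 maass) yb0 hy; have := q1_yb; lra.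
Qed.

Lemma u_decay y y' : yb <= y -> y <= y' ->
  `|u y'| <= expR (- (3 / 2 * (y' - y))) * `|u y|.
Proof.
move=> hy yy; have tt := tau_gt0.
have yb0 : 0 < yb by rewrite /yb mulr_gt0.
have y0 : 0 < y by exact: lt_le_trans hy.
have k0 : 0 <= 3 / 2 :> R by lra.
have := @coef_decay R t phi maass 1 (3 / 2) y y' isT y0 yy k0.
rewrite [3 / 2 * 1%:R]mulr1; apply.
by have := pot_nondecr (2 * pi * 1%:R) (mu_gt0 maass) yb0 hy; have := q1_yb; lra.
Qed.

(** [12/5 = 4 * 3/5] is where [c_4] reads [c_1]. In the variable of [c_4] the rate is
    [4 * 3/2 pi = 6 pi], above the rate [2 * 2 pi] to which [u_decay_le] limits [c_2]. *)
Lemma u_decay4 y y' : 12 / 5 * tau <= y -> y <= y' ->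
  `|u y'| <= expR (- (3 / 2 * pi * (y' - y))) * `|u y|.
Proof.
move=> hy yy; have tt := tau_gt0; have /andP[P1 _] := P_bounds.
have th0 : 0 < 12 / 5 :> R by lra.
have y0 : 0 < y by apply: lt_le_trans hy; rewrite mulr_gt0.
have k0 : 0 <= 3 / 2 * pi :> R by rewrite mulr_ge0// ?pi_ge0.
have := @coef_decay R t phi maass 1 (3 / 2 * pi) y y' isT y0 yy k0.
rewrite [3 / 2 * pi * 1%:R]mulr1; apply.
have := q1_ge th0 hy.
have -> : (3 / 2 * pi) ^+ 2 = 9 / 16 * P by rewrite /P; field.
lra.
Qed.

Lemma u_decay_le y y' : yb <= y -> y <= y' ->
  expR (- (2 * pi * (y' - y))) * `|u y| <= `|u y'|.
Proof.
move=> hy yy; have tt := tau_gt0.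
have yb0 : 0 < yb by rewrite /yb mulr_gt0.
have y0 : 0 < y by exact: lt_le_trans hy.
have [S [dS S01]] := maass_coef_L2 maass 1.
have qy : 0 <= q1 y.
  by have := pot_nondecr (2 * pi * 1%:R) (mu_gt0 maass) yb0 hy; have := q1_yb; lra.
have k0 : 0 <= 2 * pi * 1%:R :> R by rewrite !mulr_ge0// pi_ge0.
have := @sq_decay_le R (2 * pi * 1%:R) mu u u1 S k0 (mu_gt0 maass)
  (der_maass_coef maass 1) (der_maass_coef1 maass 1) dS S01 y y' y0 yy qy.
rewrite mulr1 -[u y ^+ 2]real_normK ?num_real// -[u y' ^+ 2]real_normK ?num_real//.
rewrite (_ : - (2 * (2 * pi) * (y' - y)) = - (2 * pi * (y' - y)) * 2%:R); last by ring.
rewrite expRM_natr -exprMn ler_sqr ?nnegrE ?mulr_ge0 ?expR_ge0//.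
Qed.

(* The energy [u'^2 - q u^2] decreases, and at the turning point it is [u'^2]. *)
Lemma u_energy y : 0 < y -> y <= 9 / 10 * tau ->
  9 / 4 * u yb ^+ 2 <= u1 y ^+ 2 - q1 y * u y ^+ 2.
Proof.
move=> y0 hy; have tt := tau_gt0; have /andP[P1 _] := P_bounds.
have /andP[m1 m2] := mu_bounds.
have k94 : 9 / 4 <= (3 / 2) ^+ 2 :> R by lra.
(* The exact turning point, between [9/10 tau] and [yb]. *)
pose y00 := Num.sqrt (mu / P).
have P0 : 0 < P by lra.
have sq : y00 ^+ 2 = mu / P by rewrite sqr_sqrtr// divr_ge0 ?ltW// (mu_gt0 maass).
have y000 : 0 < y00 by rewrite sqrtr_gt0 divr_gt0// (mu_gt0 maass).
have q0 : q1 y00 = 0 by rewrite q1E sq invf_div mulrCA divff ?mulr1 ?subrr// gt_eqF// (mu_gt0 maass).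
have l1 : y <= y00.
  apply: (le_trans hy); rewrite -ler_sqr ?nnegrE ?(ltW y000)//; last by rewrite mulr_ge0// ltW.
  rewrite sq ler_pdivlMr// mulrC exprMn; apply: le_trans m1; rewrite ler_wpM2l ?(ltW P0)//.
  by have := sqr_ge0 tau; lra.
have l2 : y00 <= yb.
  rewrite -ler_sqr ?nnegrE ?(ltW y000)//; last by rewrite mulr_ge0// ltW.
  rewrite sq ler_pdivrMr// mulrC exprMn; apply: (le_trans m2); rewrite ler_wpM2l ?(ltW P0)//.
  by have := sqr_ge0 tau; lra.
have [S [dS S01]] := maass_coef_L2 maass 1.
have q0' : 0 <= q1 y00 by rewrite q0.
have yb0 : 0 < yb by exact: lt_le_trans l2.
have h1 := @energy_nonincr R (2 * pi * 1%:R) mu u u1 (mu_gt0 maass)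
  (der_maass_coef maass 1) (der_maass_coef1 maass 1) y y00 y0 l1.
have h2 := @sq1_nonincr R (2 * pi * 1%:R) mu u u1 S (mu_gt0 maass)
  (der_maass_coef maass 1) (der_maass_coef1 maass 1) dS S01 y00 yb y000 l2 q0'.
have qb := q1_yb; have qb0 : 0 <= q1 yb by apply: le_trans qb; exact: sqr_ge0.
have h3 := @log_deriv_ge R (2 * pi * 1%:R) mu u u1 S (mu_gt0 maass)
  (der_maass_coef maass 1) (der_maass_coef1 maass 1) dS S01 (3 / 2) yb yb0 qb0 qb.
have e0 (a b q : R) : q = 0 -> a <= a - q * b by move=> ->; rewrite mul0r subr0.
apply: le_trans (le_trans h3 (le_trans h2 (le_trans (e0 _ _ _ q0) h1))).
by apply: ler_wpM2r k94; exact: sqr_ge0.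
Qed.

Let U := `|u yb|.

Lemma U_gt0 : 0 < U.
Proof. by rewrite normr_gt0; exact: u_neq0. Qed.

(* Every window of length 12 pi contains a critical point of [u] of given sign. *)
Lemma u_good (s : bool) a : 3 / 5 * tau <= a -> a + 16 <= 9 / 10 * tau ->
  exists y, [/\ a <= y <= a + 16, 0 < (-1) ^+ s * u y & U / 8 <= `|u y|].
Proof.
move=> ha hb; have tt := tau_gt0; have /andP[P1 P2] := P_bounds.
have k0 : 0 < 3 / 2 :> R by lra.
have a0 : 0 < a by apply: lt_le_trans ha; rewrite mulr_gt0.
(* The window of [critical_sign] for [kap = 3/2] has length [4 pi]. *)
have e16 : 6 * pi / (3 / 2) <= 16 :> R by have := pi_le4; lra.
have e0 : 0 < 6 * pi / (3 / 2) :> R by have := pi_gt0 R; lra.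
have qq : (3 / 2) ^+ 2 <= - q1 (a + 6 * pi / (3 / 2)).
  have h : a + 6 * pi / (3 / 2) <= 9 / 10 * tau by lra.
  have h0 : 0 < a + 6 * pi / (3 / 2) by lra.
  have h9 : 0 < 9 / 10 :> R by lra.
  by have := q1_le h0 h9 h; lra.
have UU : 0 < U ^+ 2 by rewrite exprn_gt0// U_gt0.
have eU : U ^+ 2 = u yb ^+ 2 by rewrite /U real_normK ?num_real.
have [y /andP[y1 y2]|c [/andP[c1 c2] d0 sc]] := critical_sign (mu_gt0 maass) s
  (der_maass_coef maass 1) (der_maass_coef1 maass 1) a0 k0 qq.
  have := @u_energy y; rewrite -eU => H.
  by apply: (lt_le_trans _ (H _ _)); lra.
exists c; split => //; first by apply/andP; split; lra.
have c0 : 0 < c by lra.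
have := @u_energy c c0; rewrite d0 expr0n/= sub0r -eU => H.
have {}H := H ltac:(lra).
have hc : 3 / 5 * tau <= c by lra.
have h6 : 0 < 3 / 5 :> R by lra.
have qc := q1_ge h6 hc.
(* At a critical point the energy is [- q1 u^2], so this gives [u^2 >= 9/512 U^2], more than
   [U^2 / 64]. *)
have : - q1 c <= 128 by move: P2 qc; lra.
move=> qc2; rewrite -ler_sqr ?nnegrE ?divr_ge0 ?normr_ge0//.
rewrite real_normK ?num_real// expr_div_n.
have := sqr_ge0 (u c); move: (u c ^+ 2) (q1 c) H qc2 => w q H qc2 w0.
have : - q * w <= 128 * w by rewrite ler_wpM2r.
move: H; rewrite mulNr; lra.
Qed.

End TransitionRange.

(** * Comparison with the line [x = 1/4], and tails of the expansion *)

Section QuarterLine.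
Context {R : realType}.
Implicit Types (x : R) (n : nat).

Lemma cosn1_quarter : cosn 1 (4^-1 : R) = 0.
Proof.
rewrite /cosn (_ : 2 * pi * 1%:R * 4^-1 = pi / 2) ?cos_pihalf//.
by move: (pi : R) => p; field.
Qed.

Lemma cosnSS_quarter n : cosn n.+2 (4^-1 : R) = - cosn n (4^-1 : R).
Proof. by have := @cosn_mulS R n 4^-1; rewrite cosn1_quarter mul0r; lra. Qed.

(** Induction on two consecutive [n] through [cosn (n + 2) = 2 cosn 1 cosn (n + 1) - cosn n], whose
    product term is zero at [1/4]. *)
Lemma cosn_quarter_dist n x : 0 <= cosn 1 x ->
  `|cosn n x - cosn n 4^-1| <= n%:R * cosn 1 x.
Proof.
move=> c0; suff [] : `|cosn n x - cosn n 4^-1| <= n%:R * cosn 1 x /\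
    `|cosn n.+1 x - cosn n.+1 4^-1| <= n.+1%:R * cosn 1 x by [].
elim: n => [|n [IH1 IH2]].
  by rewrite !cosn0 subrr normr0 mul0r lexx cosn1_quarter subr0 mul1r ger0_norm.
split => //; have := cosn_mulS n x.
have -> : cosn n.+2 x - cosn n.+2 4^-1 =
    2 * ((cosn n.+2 x + cosn n x) / 2) - (cosn n x - cosn n 4^-1).
  by rewrite cosnSS_quarter; field.
move=> <-; apply: le_trans (ler_normB _ _) _.
have k1 : `|2 * (cosn 1 x * cosn n.+1 x)| <= 2 * cosn 1 x.
  rewrite normrM ger0_norm// ler_wpM2l// normrM (ger0_norm c0) ler_piMr//.
  exact: cosn_le1.
apply: le_trans (lerD k1 IH1) _.
by rewrite -[n.+2%:R]natr1 -[n.+1%:R]natr1; lra.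
Qed.

(** Lets the truncation order tend to infinity in [barrier_sign]: near [x = 1/4] no fixed truncation
    error would be small enough. *)
Lemma le_of_geometric (a b K r : R) : 0 <= r < 1 -> 0 <= K ->
  (forall N, (1 < N)%N -> a <= b + K * r ^+ N) -> a <= b.
Proof.
move=> /andP[r0 r1] K0 h; rewrite leNgt; apply/negP => ba.
have [r00|rn] := eqVneq r 0.
  by have := h 2%N isT; rewrite r00 expr0n mulr0 addr0 leNgt ba.
have rp : 0 < r by rewrite lt_def rn.
have [k hk] := @expr_unbounded R r^-1 (K / (a - b)) ltac:(by rewrite invf_gt1).
have ab : 0 < a - b by rewrite subr_gt0.
have := h k.+2 isT; rewrite -lerBlDl leNgt => /negP; apply.
apply: (@le_lt_trans _ _ (K * r ^+ k)).
  by rewrite ler_wpM2l// -[k.+2]addn2 exprD ler_piMr ?exprn_ge0// expr_le1// ltW.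
by move: hk; rewrite exprVn ltr_pdivrMr// mulrC ltr_pdivlMr ?exprn_gt0.
Qed.

Lemma sign_constant (f : R -> R) a b : {within `[a, b], continuous f} ->
  (forall y, a <= y <= b -> f y != 0) ->
  exists s : bool, forall y, a <= y <= b -> 0 < (-1) ^+ s * f y.
Proof.
move=> cf fn; have [ab|ba] := leP a b; last first.
  by exists false => y /andP[h1 h2]; lra.
have fa := fn a; rewrite lexx ab in fa; have {}fa := fa isT.
have key (g : R -> R) : {within `[a, b], continuous g} ->
    (forall y, a <= y <= b -> g y != 0) -> 0 < g a -> forall y, a <= y <= b -> 0 < g y.
  move=> cg gn ga y /andP[ay yb]; rewrite ltNge; apply/negP => gy.
  have cg' : {within `[a, y], continuous g}.
    by apply: continuous_subspaceW cg; apply: subset_itvl; rewrite bnd_simp.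
  have [|c] := @IVT R g a y 0 ay cg'.
    by rewrite ge_min le_max gy (ltW ga) orbT.
  rewrite in_itv/= => /andP[ac cy] gc; have := gn c.
  by rewrite ac (le_trans cy yb) gc eqxx => /(_ isT).
have [f0|f0] := ltP 0 (f a).
  by exists false => y hy; rewrite mul1r; apply: key hy.
exists true => y hy; rewrite mulN1r.
apply: (key (fun y => - f y)) => //.
- by move=> z; apply: continuousN; exact: cf.
- by move=> z hz; rewrite oppr_eq0 fn.
- by rewrite oppr_gt0 lt_neqAle fa.
Qed.

End QuarterLine.

Section Barriers.
Context {R : realType} (t : R) (phi : R * R -> R).
Hypothesis maass : even_hecke_maass_cusp_form t phi.
Implicit Types (x y z : R) (n m : nat).
Local Notation coef := (maass_coef phi).
Local Notation u := (maass_coef phi 1).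
Let tau := t / (2 * pi).
Hypothesis tau_ge : 60 * 60 <= tau.
Let yb := 11 / 10 * tau.
Let U := `|u yb|.

Lemma expR_small (x : R) n : 63 * n%:R <= x -> expR (- x) <= 64^-1 ^+ n.
Proof.
move=> hx; apply: (@le_trans _ _ (expR (- 63 * n%:R))).
  by rewrite ler_expR mulNr lerN2.
rewrite expRM_natr; apply: lerXn2r; rewrite ?nnegrE ?expR_ge0 ?invr_ge0//.
rewrite expRN lef_pV2 ?posrE ?expR_gt0//.
by have := expR_ge1Dx (63 : R); lra.
Qed.

(** The exponent [126 n] gives [64^(-2 n)]; one [2^n] absorbs the bound on [al n], another the
    factor [n], and [32^(-n)] remains with room to spare. The reference height [z] is free because
    the unit is [U] on segments but the far smaller [u (2 y)] or [u (4 y)] on the line [x = 1/4]. *)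
Lemma coef_far n y z : (0 < n)%N -> 0 < y -> yb <= z -> z <= n%:R * y ->
  126 * n%:R <= 3 / 2 * (n%:R * y - z) -> n%:R * `|coef n y| <= `|u z| * 32^-1 ^+ n.
Proof.
move=> n0 y0 hz hny hexp; have [al [h1 h2 _]] := hecke_coefs maass.
rewrite (h1 n y n0 y0) normrM.
have hd := u_decay maass tau_ge hz hny.
have he : expR (- (3 / 2 * (n%:R * y - z))) <= 64^-1 ^+ (n + n).
  apply: expR_small; rewrite natrD; move: hexp; move: (3 / 2 * _) => w; lra.
have n2 : n%:R <= 2 ^+ n :> R by rewrite -natrX ler_nat ltnW// ltn_expl.
have {}hd : `|u (n%:R * y)| <= 64^-1 ^+ (n + n) * `|u z|.
  by apply: (le_trans hd); exact: ler_wpM2r.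
have e : 32^-1 ^+ n = 2 ^+ n * (2 ^+ n * (64^-1 ^+ (n + n) * 32 ^+ n)) :> R.
  by rewrite exprD -!exprMn; congr (_ ^+ n); field.
have g32 : 1 <= 32 ^+ n :> R by rewrite expr_ge1//; lra.
have p64 : 0 <= 64^-1 ^+ (n + n) :> R by rewrite exprn_ge0// invr_ge0.
have hal := h2 n n0.
pose g : R := 64^-1 ^+ (n + n) * 32 ^+ n.
have step : `|al n| * `|u (n%:R * y)| <= 2 ^+ n * (g * `|u z|).
  apply: ler_pM => //; first exact: le_trans n2.
  by apply: (le_trans hd); apply: ler_wpM2r => //; rewrite /g ler_peMr.
have -> : `|u z| * 32^-1 ^+ n = 2 ^+ n * (2 ^+ n * (g * `|u z|)).
  by rewrite e -/g mulrC -!mulrA.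
by apply: ler_pM.
Qed.

Lemma coef_tail N y z : 3 / 5 * tau <= y -> yb <= z -> (2 <= N)%N ->
  (forall n, (N <= n)%N -> z <= n%:R * y /\ 126 * n%:R <= 3 / 2 * (n%:R * y - z)) ->
  forall n, (N <= n)%N -> `|coef n y| <= `|u z| * 32^-1 ^+ n.
Proof.
move=> hy hz N2 h n Nn; have [h1 h2] := h n Nn.
have n0 : (0 < n)%N by apply: leq_trans Nn; exact: ltnW.
have tt : 0 < tau by move: tau_ge; lra.
have y0 : 0 < y by apply: lt_le_trans hy; rewrite mulr_gt0.
apply: le_trans (coef_far n0 y0 hz h1 h2).
by rewrite ler_peMl// ler1n.
Qed.

(** For [n >= 2], [n y - yb >= (3/5 n - 11/10) tau >= n tau / 20], and [tau >= 3600]. *)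
Lemma far_yb y n : 3 / 5 * tau <= y -> (2 <= n)%N ->
  yb <= n%:R * y /\ 126 * n%:R <= 3 / 2 * (n%:R * y - yb).
Proof.
move=> hy n2; have n2' : 2 <= n%:R :> R by rewrite ler_nat.
have h : n%:R * (3 / 5 * tau) <= n%:R * y by rewrite ler_wpM2l.
have h2 : 0 <= (n%:R - 2) * tau by rewrite mulr_ge0 ?subr_ge0//; move: tau_ge; lra.
have h3 : 0 <= n%:R * (tau - 60 * 60) by rewrite mulr_ge0// subr_ge0.
rewrite /yb; move: (n%:R : R) n2' h h2 h3 tau_ge => w n2' h h2 h3 tg.
split; lra.
Qed.

Lemma far_mul (k : nat) y n : 3 / 5 * tau <= y -> (2 <= k)%N -> (k <= 4)%N -> (k < n)%N ->
  k%:R * y <= n%:R * y /\ 126 * n%:R <= 3 / 2 * (n%:R * y - k%:R * y).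
Proof.
move=> hy k2 k4 kn; have n1 : k%:R + 1 <= n%:R :> R by rewrite natr1 ler_nat.
have k4' : k%:R <= 4 :> R by rewrite ler_nat.
have hy2 : 60 * 36 <= y by move: tau_ge hy; lra.
have h : 0 <= (n%:R - k%:R) * (y - 60 * 36).
  by rewrite mulr_ge0 ?subr_ge0//; move: n1; lra.
move: (n%:R : R) (k%:R : R) n1 k4' h hy2 => w k' n1 k4' h hy2.
split; nra.
Qed.

Lemma k_yb (k : nat) y : 3 / 5 * tau <= y -> (2 <= k)%N -> yb <= k%:R * y.
Proof. by move=> hy k2; case: (far_yb hy k2). Qed.

End Barriers.

(** * Heights that act as barriers, and opposite signs between them *)

Section BarrierSequence.
Context {R : realType} (t : R) (phi : R * R -> R).
Hypothesis maass : even_hecke_maass_cusp_form t phi.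
Implicit Types (x y z : R) (n m : nat).
Local Notation coef := (maass_coef phi).
Local Notation u := (maass_coef phi 1).
Let tau := t / (2 * pi).
Hypothesis tau_ge : 60 * 60 <= tau.
Let yb := 11 / 10 * tau.
Let U := `|u yb|.

Let tau0 : 0 < tau. Proof. by move: tau_ge; lra. Qed.

Lemma range_gt0 y : 3 / 5 * tau <= y -> 0 < y.
Proof. by apply: lt_le_trans; rewrite mulr_gt0. Qed.

Lemma maass_fourier N y x (C : R) : 0 < y -> 0 <= C ->
  (forall n, (N <= n)%N -> `|coef n y| <= C * 32^-1 ^+ n) -> 0 <= x <= 2^-1 ->
  `|phi (x, y) - fsum (fun n => coef n y) N x| <= 3 * C * 32^-1 ^+ N.
Proof.
move=> y0 C0 hC hx.
have r1 : 0 <= (32^-1 : R) < 1 by apply/andP; split; lra.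
apply: le_trans (@fourier_tail R (fun x => phi (x, y)) C 32^-1 N x
  (maass_slice_continuous maass y0) (fun x => maass_periodic maass x y0)
  (fun x => maass_slice_even maass x y0) (maass_coef0 maass y0) r1 C0 hC hx) _.
have : 0 <= C * 32^-1 ^+ N by rewrite mulr_ge0// exprn_ge0.
move: (32^-1 ^+ N) => e Ce0.
have -> : 2 * C * e / (1 - 32^-1) = 64 / 31 * (C * e) by field.
by rewrite -mulrA; lra.
Qed.

Lemma quarter_in : 0 <= (4^-1 : R) <= 2^-1.
Proof. by apply/andP; split; lra. Qed.

Lemma fsum3_quarter y : 0 < y -> fsum (fun n => coef n y) 3 4^-1 = - (2 * coef 2 y).
Proof.
move=> y0; rewrite /fsum !big_ord_recl big_ord0 /= /bump/= !add1n.
rewrite (maass_coef0 maass y0) cosn1_quarter cosnSS_quarter cosn0.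
by move: (coef 2 y) => c; ring.
Qed.

Lemma fsum5_quarter y : 0 < y ->
  fsum (fun n => coef n y) 5 4^-1 = - (2 * coef 2 y) + 2 * coef 4 y.
Proof.
move=> y0; rewrite /fsum !big_ord_recl big_ord0 /= /bump/= !add1n.
rewrite (maass_coef0 maass y0) !cosnSS_quarter cosn1_quarter cosn0.
by move: (coef 2 y) (coef 3 y) (coef 4 y) => c d e; ring.
Qed.

(** At [x = 1/4] the partial sum is [- 2 coef 2], of size at least [|u (2 y)|], against a tail of at
    most [3 |u (2 y)| / 32^3]. *)
Lemma quarter_neq0_of_coef2 y : 3 / 5 * tau <= y ->
  2^-1 * `|u (2 * y)| <= `|coef 2 y| -> phi (4^-1, y) != 0.
Proof.
move=> hy h2; have y0 := range_gt0 hy.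
have hz := k_yb tau_ge hy (isT : (2 <= 2)%N).
have U2 : 0 < `|u (2 * y)| by rewrite normr_gt0; exact: (u_neq0 maass tau_ge hz).
have tl := coef_tail maass tau_ge hy hz (isT : (2 <= 3)%N)
  (fun n hn => far_mul tau_ge hy (isT : (2 <= 2)%N) (isT : (2 <= 4)%N) hn).
have := maass_fourier y0 (ltW U2) tl quarter_in.
rewrite fsum3_quarter// => H; apply/eqP => f0; move: H.
rewrite f0 sub0r opprK normrM ger0_norm//.
have -> : 32^-1 ^+ 3 = (32 * 32 * 32)^-1 :> R by rewrite exprVn; congr (_^-1); ring.
move: `|coef 2 y| `|u (2 * y)| U2 h2 => a b; lra.
Qed.

(** At [x = 1/4] the partial sum is [2 (coef 4 - coef 2)], with a tail measured against [u (4 y)]; a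
    ratio of two in either direction excludes cancellation. *)
Lemma quarter_neq0_of_coef4 y : 3 / 5 * tau <= y ->
  4^-1 * `|u (4 * y)| <= `|coef 4 y| ->
  2 * `|coef 4 y| <= `|coef 2 y| \/ 2 * `|coef 2 y| <= `|coef 4 y| ->
  phi (4^-1, y) != 0.
Proof.
move=> hy h4 h24; have y0 := range_gt0 hy.
have hz := k_yb tau_ge hy (isT : (2 <= 4)%N).
have U4 : 0 < `|u (4 * y)| by rewrite normr_gt0; exact: (u_neq0 maass tau_ge hz).
have tl := coef_tail maass tau_ge hy hz (isT : (2 <= 5)%N)
  (fun n hn => far_mul tau_ge hy (isT : (2 <= 4)%N) (isT : (4 <= 4)%N) hn).
have := maass_fourier y0 (ltW U4) tl quarter_in.
rewrite fsum5_quarter// => H; apply/eqP => f0; move: H.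
rewrite f0 sub0r opprD opprK.
have -> : 32^-1 ^+ 5 = (32 * 32 * 32 * 32 * 32)^-1 :> R by rewrite exprVn; congr (_^-1); ring.
have d1 := lerB_dist (2 * coef 2 y) (2 * coef 4 y).
have d2 := lerB_dist (2 * coef 4 y) (2 * coef 2 y).
rewrite distrC !normrM !(ger0_norm (_ : 0 <= 2))// in d2.
rewrite !normrM !(ger0_norm (_ : 0 <= 2))// in d1.
move: `|2 * coef 2 y - 2 * coef 4 y| d1 d2 => e d1 d2.
move: `|coef 2 y| `|coef 4 y| `|u (4 * y)| U4 h4 h24 d1 d2 => a b c U4 h4 h24 d1 d2.
case: h24; lra.
Qed.

(* On one of the two halves of the transition range the line [x = 1 / 4] is
   free of zeros: there [coef 2] and [coef 4] have ratio monotone in [y]. *)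
Lemma quarter_line_neq0 : exists2 lo, 3 / 5 * tau <= lo <= 19 / 25 * tau &
  forall y, lo <= y <= lo + 7 / 50 * tau -> phi (4^-1, y) != 0.
Proof.
have [al [h1 _ h4]] := hecke_coefs maass.
have c2 y : 3 / 5 * tau <= y -> coef 2 y = al 2%N * u (2 * y).
  by move=> hy; rewrite (h1 2%N y isT (range_gt0 hy)).
have c4 y : 3 / 5 * tau <= y -> coef 4 y = al 4%N * u (4 * y).
  by move=> hy; rewrite (h1 4%N y isT (range_gt0 hy)).
have [a2|a2] := leP 2^-1 `|al 2%N|.
  exists (3 / 5 * tau); first by apply/andP; split; move: tau0; lra.
  move=> y /andP[hy _]; apply: quarter_neq0_of_coef2 => //.
  by rewrite c2// normrM ler_wpM2r.
have a4 : 4^-1 <= `|al 4%N|.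
  have : al 2%N ^+ 2 <= 4^-1.
    rewrite -[leLHS]real_normK ?num_real// (_ : 4^-1 = 2^-1 ^+ 2) ?ler_sqr ?nnegrE//; first exact: ltW.
    by field.
  rewrite h4 => h; rewrite ler0_norm; lra.
have q4 y : 3 / 5 * tau <= y -> 4^-1 * `|u (4 * y)| <= `|coef 4 y|.
  by move=> hy; rewrite c4// normrM ler_wpM2r.
(* The candidate ranges [[3/5, 37/50] tau] and [[19/25, 9/10] tau] lie on either side, at distance
   [tau / 100 >= 36], more than the unit length used by [ratio]. *)
pose ym := 3 / 4 * tau.
have hym : 3 / 5 * tau <= ym by rewrite /ym; move: tau0; lra.
have hpi := pi_ge2 R.
(* the ratio |coef 4| / |coef 2| is at least halved over a unit length *)
have ratio y y' : 3 / 5 * tau <= y -> y + 1 <= y' ->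
    exists2 e : R, 0 < e & e * `|coef 2 y| <= `|coef 2 y'| /\
      2 * `|coef 4 y'| <= e * `|coef 4 y|.
  move=> hy yy; have hy' : 3 / 5 * tau <= y' by lra.
  exists (expR (- (2 * pi * (2 * y' - 2 * y)))); first exact: expR_gt0.
  have k2 : 2 * y <= 2 * y' by lra.
  have k4 : 4 * y <= 4 * y' by lra.
  have k12 : 12 / 5 * tau <= 4 * y by lra.
  have d2 := u_decay_le maass tau_ge (k_yb tau_ge hy (isT : (2 <= 2)%N)) k2.
  have d4 := u_decay4 maass tau_ge k12 k4.
  rewrite !c2// !c4// !normrM; split.
    by rewrite mulrCA ler_wpM2l.
  rewrite mulrCA [leRHS]mulrCA ler_wpM2l//.
  have -> : - (2 * pi * (2 * y' - 2 * y)) =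
      - (3 / 2 * pi * (4 * y' - 4 * y)) + 2 * pi * (y' - y).
    by move: (pi : R) => p; field.
  rewrite expRD; have g2 : 2 <= expR (2 * pi * (y' - y)).
    apply: le_trans (expR_ge1Dx _); have : 2 * 1 <= pi * (y' - y) by apply: ler_pM => //; lra.
    lra.
  apply: (@le_trans _ _ (2 * (expR (- (3 / 2 * pi * (4 * y' - 4 * y))) * `|u (4 * y)|))).
    by rewrite ler_wpM2l.
  by rewrite [leRHS]mulrAC [leRHS]mulrC ler_wpM2r// mulr_ge0 ?expR_ge0.
have [BA|AB] := leP `|coef 4 ym| `|coef 2 ym|.
  exists (19 / 25 * tau); first by apply/andP; split; move: tau0; lra.
  move=> y /andP[hy _]; have hy' : 3 / 5 * tau <= y by move: tau0; lra.
  apply: quarter_neq0_of_coef4 => //; first exact: q4.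
  left; have hm : ym + 1 <= y by rewrite /ym; move: tau_ge; lra.
  have [e e0 [e1 e2]] := ratio ym y hym hm.
  apply: (le_trans e2); apply: le_trans e1; rewrite ler_wpM2l//; exact: ltW.
exists (3 / 5 * tau); first by apply/andP; split; move: tau0; lra.
move=> y /andP[hy hy2]; apply: quarter_neq0_of_coef4 => //; first exact: q4.
right; have hm : y + 1 <= ym by rewrite /ym; move: tau_ge; lra.
have [e e0 [e1 e2]] := ratio y ym hy hm.
rewrite -(ler_pM2l e0) mulrCA; apply: le_trans e2; rewrite ler_wpM2l//.
exact: le_trans (ltW AB).
Qed.

Lemma good_sum y : 3 / 5 * tau <= y -> forall n, (2 <= n)%N ->
  n%:R * `|coef n y| <= U * 32^-1 ^+ n.
Proof.
move=> hy n n2; have [f1 f2] := far_yb tau_ge hy n2.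
by apply: (coef_far maass tau_ge) => //; [exact: ltnW|exact: range_gt0].
Qed.

Lemma good_tail y : 3 / 5 * tau <= y -> forall n, (2 <= n)%N ->
  `|coef n y| <= U * 32^-1 ^+ n.
Proof.
move=> hy n n2; apply: le_trans (good_sum hy n2).
by rewrite ler_peMl// ler1n ltnW.
Qed.

Let U0 : 0 <= U. Proof. exact: normr_ge0. Qed.

Lemma axis_sign (s : bool) y : 3 / 5 * tau <= y -> U / 8 <= `|u y| ->
  0 < (-1) ^+ s * u y -> 0 < (-1) ^+ s * phi (0, y).
Proof.
move=> hy hU hs; have y0 := range_gt0 hy.
have Up : 0 < U by exact: (U_gt0 maass tau_ge).
have h0 : 0 <= (0 : R) <= 2^-1 by apply/andP; split; lra.
have := maass_fourier y0 U0 (good_tail hy) h0.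
rewrite /fsum !big_ord_recl big_ord0 /= /bump/= (maass_coef0 maass y0) mulr0 mul0r add0r addr0.
rewrite /cosn mulr0 cos0 mulr1 add1n.
have -> : 32^-1 ^+ 2 = (32 * 32)^-1 :> R by rewrite exprVn; congr (_^-1); ring.
have nu : `|u y| = (-1) ^+ s * u y.
  by rewrite -(ger0_norm (ltW hs)) normrM normr_sign mul1r.
rewrite nu in hU; move: hU hs U0 Up {nu}; move: (phi (0, y)) (u y) U => p w V hU hs V0 Vp.
rewrite ler_norml => /andP[k1 k2].
by case: s hU hs; rewrite ?mulN1r ?mul1r; lra.
Qed.

(** [phi (x, y) - phi (1/4, y)] is [2 u cos (2 pi x)] plus differences of higher terms, together at
    most [U / 8 * cos (2 pi x)]. Hence [(-1)^s phi] is at least as large at [x] as at [1/4]. *)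
Lemma barrier_sign (s : bool) y x : 3 / 5 * tau <= y -> U / 8 <= `|u y| ->
  0 < (-1) ^+ s * u y -> 0 < (-1) ^+ s * phi (4^-1, y) -> `|x| <= 4^-1 ->
  0 < (-1) ^+ s * phi (x, y).
Proof.
move=> hy hU hs hq hx; have y0 := range_gt0 hy.
wlog x0 : x hx / 0 <= x.
  move=> H; have [/H|/ltW x0] := leP 0 x; first exact.
  by rewrite -(maass_slice_even maass)//; apply: H; rewrite ?normrN ?oppr_ge0.
rewrite ger0_norm// in hx; apply: (lt_le_trans hq).
have hx2 : 0 <= x <= 2^-1 by apply/andP; split; lra.
have r1 : 0 <= (32^-1 : R) < 1 by apply/andP; split; lra.
(* Two truncation errors of size [3 U * 32^(-N)], at [x] and at [1/4]. *)
have K0 : 0 <= 6 * U by rewrite mulr_ge0.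
apply: (le_of_geometric r1 K0) => N N1.
have hN n : (N <= n)%N -> `|coef n y| <= U * 32^-1 ^+ n.
  by move=> Nn; apply: good_tail => //; exact: leq_trans Nn.
have f1 := maass_fourier y0 U0 hN hx2.
have f2 := maass_fourier y0 U0 hN quarter_in.
have c0 : 0 <= cosn 1 x.
  apply: cos_ge0_pihalf; have := pi_gt0 R; move: (pi : R) => p p0.
  apply/andP; split.
    by have : 0 <= p * x; [rewrite mulr_ge0// ltW|lra].
  by have : p * x <= p * 4^-1; [rewrite ler_wpM2l// ltW|lra].
have key : `|fsum (fun n => coef n y) N x - fsum (fun n => coef n y) N 4^-1
    - 2 * u y * cosn 1 x| <= U / 8 * cosn 1 x.
  rewrite /fsum -!(big_mkord xpredT (fun n => 2 * coef n y * cosn n _)).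
  rewrite -sumrB (big_ltn (ltnW N1)) (big_ltn N1).
  rewrite (maass_coef0 maass y0) !mulr0 !mul0r subrr add0r cosn1_quarter mulr0 subr0.
  rewrite addrAC subrr add0r.
  apply: le_trans (ler_norm_sum _ _ _) _.
  apply: (@le_trans _ _ (\sum_(2 <= n < N) 2 * U * cosn 1 x * 32^-1 ^+ n)).
    rewrite !big_nat; apply: ler_sum => n /andP[n2 _].
    rewrite -mulrBr normrM normrM ger0_norm//.
    have g1 := good_sum hy n2; have g2 := cosn_quarter_dist n c0.
    have := ler_wpM2l (normr_ge0 (coef n y)) g2.
    have := ler_wpM2r c0 g1.
    move: `|coef n y| `|cosn n x - _| (32^-1 ^+ n) (n%:R : R) (cosn 1 x) => a b e m c.
    lra.
  rewrite -mulr_sumr; have g := geometric_tail 2 N r1.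
  apply: le_trans (ler_wpM2l _ g) _; first by rewrite !mulr_ge0.
  have : 0 <= U * cosn 1 x by rewrite mulr_ge0.
  have -> : 32^-1 ^+ 2 / (1 - 32^-1) = (32 * 31)^-1 :> R by field.
  rewrite -mulrA [U / 8 * _]mulrAC; move: (U * cosn 1 x) => w w0; lra.
have nu : `|u y| = (-1) ^+ s * u y.
  by rewrite -(ger0_norm (ltW hs)) normrM normr_sign mul1r.
rewrite nu in hU.
have hUc := ler_wpM2r c0 hU.
move: hUc key f1 f2; rewrite !ler_norml.
move: (fsum _ N x) (fsum _ N 4^-1) (phi (x, y)) (phi (4^-1, y)) => a b p q.
rewrite -[(-1) ^+ s * u y * _]mulrA -[2 * u y * _]mulrA.
rewrite -[3 * U * _]mulrA -[6 * U * _]mulrA.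
move: (u y * cosn 1 x) (U * 32^-1 ^+ N) => w e.
have : 0 <= U / 8 * cosn 1 x by rewrite mulr_ge0// divr_ge0.
move: (U / 8 * cosn 1 x) => v v0 h /andP[h1 h2] /andP[h3 h4] /andP[h5 h6].
by case: {hs hq hU nu} s h; rewrite ?mulN1r ?mul1r => h; lra.
Qed.

(** The range is cut into windows of length 16. Window [2 i] yields [b i], where [c_1] has the sign
    [s] of [phi (1/4, _)]; window [2 i + 1] yields [p i], where it has the other sign. *)
Lemma barrier_sequence : exists (K : nat) (b p : nat -> R) (s : bool),
  [/\ t / 800 / (2 * pi) <= K%:R,
   forall i, (i <= K)%N -> 2 <= b i,
   forall i x, (i <= K)%N -> `|x| <= 4^-1 -> 0 < (-1) ^+ s * phi (x, b i) &
   forall i, (i < K)%N -> [/\ b i <= p i <= b i.+1, (-1) ^+ s * phi (0, p i) < 0 &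
     forall y, b i <= y <= b i.+1 -> 0 < (-1) ^+ s * phi (4^-1, y)]].
Proof.
have [lo /andP[lo1 lo2] hlo] := quarter_line_neq0.
have cf : {within `[lo, lo + 7 / 50 * tau], continuous (fun y => phi (4^-1, y))}.
  apply: continuous_in_subspaceT => y; rewrite inE/= in_itv/= => /andP[h _].
  have y0 : 0 < y by apply: range_gt0; exact: le_trans h.
  exact: (@continuous_slice2 R phi 4^-1 y (@maass_continuous _ _ _ maass) y0).
have [s hs] := sign_constant cf hlo.
(* The [2 K + 1] windows occupy at most [2/25 tau + 16], within the [7/50 tau] available. *)
pose K := Num.truncn (tau / 400).
have t400 : 0 <= tau / 400.
  by apply: mulr_ge0; [exact: ltW|rewrite invr_ge0; exact: ler0n].
have /andP[K1 K2] := truncn_itv t400; rewrite -/K in K1 K2.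
have {}K2 : tau / 400 < K%:R + 1 by rewrite natr1.
have win m : (m <= 2 * K)%N -> lo + 16 * m%:R + 16 <= lo + 7 / 50 * tau.
  move=> mK; have : m%:R <= 2 * K%:R :> R by rewrite -natrM ler_nat.
  move: tau_ge; lra.
have lo_m (m : nat) : 3 / 5 * tau <= lo + 16 * m%:R.
  by have : 0 <= m%:R :> R by []; lra.
have ex (s' : bool) m : (m <= 2 * K)%N -> exists y,
    [/\ lo + 16 * m%:R <= y <= lo + 16 * m%:R + 16, 0 < (-1) ^+ s' * u y & U / 8 <= `|u y|].
  move=> mK; apply: (u_good maass tau_ge) => //.
  by have := win m mK; rewrite -/tau; lra.
have [i|b hb] := @choice nat R (fun i y => (i <= K)%N ->
    [/\ lo + 16 * (2 * i)%:R <= y <= lo + 16 * (2 * i)%:R + 16, 0 < (-1) ^+ s * u y &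
      U / 8 <= `|u y|]).
  have [iK|iK] := leqP i K; last by exists 0.
  by have [|y hy] := ex s (2 * i)%N; [rewrite leq_mul2l iK|exists y].
have [i|p hp] := @choice nat R (fun i y => (i < K)%N ->
    [/\ lo + 16 * (2 * i).+1%:R <= y <= lo + 16 * (2 * i).+1%:R + 16,
        0 < (-1) ^+ (~~ s) * u y & U / 8 <= `|u y|]).
  have [iK|iK] := ltnP i K; last by exists 0.
  have [|y hy] := ex (~~ s) (2 * i).+1; last by exists y.
  by rewrite (@leq_trans (2 * i.+1))// ?leq_mul2l// mulnS addnC addn2.
have bin i : (i <= K)%N -> lo <= b i <= lo + 7 / 50 * tau.
  move=> iK; have [/andP[b1 b2] _ _] := hb i iK.
  have h0 : 0 <= (2 * i)%:R :> R by [].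
  have h1 : lo + 16 * (2 * i)%:R + 16 <= lo + 7 / 50 * tau by apply: win; rewrite leq_mul2l iK.
  by move: (_%:R) h0 h1 b1 b2 => w h0 h1 b1 b2; apply/andP; split; lra.
exists K, b, p, s; split.
- have -> : t / 800 / (2 * pi) = tau / 800.
    by rewrite /tau; move: (2 * pi) => q; rewrite mulrAC.
  apply: (@le_trans _ _ (tau / 400 - 1)); last by move: K2; move: (K%:R) => k; lra.
  by move: tau_ge; lra.
- move=> i iK; have /andP[b1 _] := bin i iK; move: tau_ge; lra.
- move=> i x iK hx; have [_ b2 b3] := hb i iK; have bi := bin i iK.
  apply: barrier_sign => //; last exact: hs.
  by case/andP: bi => h _; exact: le_trans h.
move=> i iK; have [/andP[b1 b2] _ _] := hb i (ltnW iK).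
have [/andP[p1 p2] p3 p4] := hp i iK; have [/andP[b3 b4] _ _] := hb i.+1 iK.
have e1 : (2 * i).+1%:R = (2 * i)%:R + 1 :> R by rewrite natr1.
have e2 : (2 * i.+1)%:R = (2 * i)%:R + 2 :> R by rewrite mulnS natrD addrC.
rewrite e1 in p1 p2; rewrite e2 in b3 b4.
split.
- by apply/andP; split; move: (_%:R) b1 b2 p1 p2 b3 b4 => w; lra.
- have hpl : 3 / 5 * tau <= p i.
    apply: le_trans p1.
    by have : 0 <= (2 * i)%:R :> R by []; move: lo1; lra.
  have := axis_sign hpl p4 p3.
  by case: (s); rewrite ?mulN1r ?mul1r; lra.
move=> y /andP[y1 y2]; apply: hs; apply/andP; split.
  by apply: le_trans y1; case/andP: (bin i (ltnW iK)).
by apply: (le_trans y2); case/andP: (bin i.+1 iK).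
Qed.

End BarrierSequence.

(** * Continuity and local finiteness of the modular action *)

Section MobiusTopology.
Context {R : realType}.
Implicit Types (g h : 'M[int]_2) (z w : R * R) (S : set (R * R)).

Lemma mobius_norm_gt0 g z : \det g = 1 -> 0 < z.2 -> 0 < mobius_norm g z.
Proof.
move=> dg z0; rewrite /mobius_norm lt_neqAle addr_ge0 ?sqr_ge0// andbT eq_sym.
rewrite paddr_eq0 ?sqr_ge0// !sqrf_eq0; apply/negP => /andP[/eqP e1 /eqP e2].
move: e2 => /eqP; rewrite mulf_eq0 (gt_eqF z0) orbF => /eqP c0.
move: e1; rewrite c0 mul0r add0r => /eqP; rewrite intr_eq0 => /eqP d0.
move/eqP: c0; rewrite intr_eq0 => /eqP c0.
by move: dg; rewrite det2 c0 d0 !mulr0 subr0 => /eqP.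
Qed.

Lemma mobius_continuous g z : \det g = 1 -> 0 < z.2 -> {for z, continuous (mobius g)}.
Proof.
move=> dg z0.
have cx : (fun w : R * R => w.1) @ z --> z.1 by exact: cvg_fst.
have cy : (fun w : R * R => w.2) @ z --> z.2 by exact: cvg_snd.
have cl (a b : R) : (fun w : R * R => a * w.1 + b) @ z --> a * z.1 + b.
  by apply: cvgD; [apply: cvgM; [exact: cvg_cst|]|exact: cvg_cst].
have cm (a : R) : (fun w : R * R => a * w.2) @ z --> a * z.2.
  by apply: cvgM; [exact: cvg_cst|].
have cN : mobius_norm g @ z --> mobius_norm g z.
  have ->: mobius_norm g = fun w : R * R => ((g 1 0)%:~R * w.1 + (g 1 1)%:~R) *
     ((g 1 0)%:~R * w.1 + (g 1 1)%:~R) + (g 1 0)%:~R * w.2 * ((g 1 0)%:~R * w.2).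
    by apply/funext => w; rewrite /mobius_norm !expr2.
  by apply: cvgD; apply: cvgM.
have cV : (fun w => (mobius_norm g w)^-1) @ z --> (mobius_norm g z)^-1.
  by apply: cvgV => //; rewrite gt_eqF// mobius_norm_gt0.
pose F w : R * R := ((((g 0 0)%:~R * w.1 + (g 0 1)%:~R) * ((g 1 0)%:~R * w.1 + (g 1 1)%:~R)
      + (g 0 0)%:~R * (g 1 0)%:~R * (w.2 * w.2)) / mobius_norm g w, w.2 / mobius_norm g w).
have cF : F @ z --> F z.
  have c2 : (fun w => w.2 / mobius_norm g w) @ z --> z.2 / mobius_norm g z by exact: cvgM.
  have cs : (fun w : R * R => (g 0 0)%:~R * (g 1 0)%:~R * (w.2 * w.2)) @ z -->
      (g 0 0)%:~R * (g 1 0)%:~R * (z.2 * z.2).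
    by apply: cvgM; [exact: cvg_cst|exact: cvgM].
  have c1 : (fun w => (F w).1) @ z --> (F z).1.
    exact: (cvgM (cvgD (cvgM (cl _ _) (cl _ _)) cs) cV).
  have c3 : (fun w => ((F w).1, w.2 / mobius_norm g w)) @ z --> ((F z).1, z.2 / mobius_norm g z).
    exact: (cvg_pair c1 c2).
  exact: c3.
have E w : 0 < w.2 -> F w = mobius g w by move=> w0; rewrite mobiusE// expr2.
have : F @ z --> mobius g z by rewrite -E.
apply: cvg_trans; apply: near_eq_cvg.
have : nbhs z (upper_half_plane R).
  by apply: open_nbhs_nbhs; split => //; exact: half_plane_open.
by apply: filterS => w /E.
Qed.

(* Above height one the only identifications are the integer translations. *)
Lemma mobius_high g z : \det g = 1 -> 1 < z.2 -> 1 < (mobius g z).2 ->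
  exists n : int, mobius g z = (z.1 + n%:~R, z.2).
Proof.
move=> dg z1; have z0 : 0 < z.2 by exact: lt_trans z1.
have N0 := mobius_norm_gt0 dg z0.
rewrite mobiusE//= ltr_pdivlMr// mul1r => hN.
have c0 : g 1 0 = 0.
  (* Otherwise [|c z + d|^2 >= y^2 >= y], and the image would have height at most 1. *)
  apply: contrapT => /eqP c0.
  have : 1 <= (g 1 0)%:~R ^+ 2 :> R.
    have : 1 <= `|(g 1 0)%:~R| :> R by rewrite -intr_norm ler1z -gtz0_ge1 normr_gt0.
    by rewrite -[_ ^+ 2]real_normK ?num_real// => h; exact: exprn_ege1.
  move=> c1; move: hN; apply/negP; rewrite -leNgt /mobius_norm exprMn.
  apply: (@le_trans _ _ (z.2 ^+ 2)); first by rewrite expr2 ler_peMr// ltW.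
  by rewrite ler_wpDl ?sqr_ge0// ler_peMl// sqr_ge0.
move: dg; rewrite det2 c0 mulr0 subr0 => dg.
exists (g 0 1 * g 1 1); rewrite /mobius_norm c0 !(mul0r, mulr0) add0r expr0n !addr0.
have d2 : g 1 1 ^+ 2 = 1.
  have := congr1 absz dg; rewrite abszM => /eqP; rewrite muln_eq1 => /andP[_ /eqP e].
  by rewrite -[LHS]real_normK ?num_real// -abszE e.
rewrite -rmorphXn/= d2 !divr1; congr pair.
by rewrite mulrDl mulrAC -!intrM dg mul1r.
Qed.

(** The neighbourhood does not depend on [g]. With [A = c x + d] and [B = c (x' - x)],
    [(A + B)^2 >= 3/4 A^2 - 3 B^2], and the loss is paid by [c^2 y'^2]. *)
Lemma mobius_norm_near g z w : 0 < z.2 -> `|z.1 - w.1| < z.2 / 16 -> `|z.2 - w.2| < z.2 / 16 ->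
  3 / 4 * mobius_norm g z <= mobius_norm g w.
Proof.
case: z w => x y [x' y'] /= y0; rewrite /mobius_norm /=.
move: (_%:~R : R) ((g 1 1)%:~R : R) => c d.
rewrite ltr_norml => /andP[h1 h2]; rewrite ltr_norml => /andP[h3 h4].
have k1 : (x' - x) ^+ 2 <= y ^+ 2 / 256 by nra.
have k2 : 225 / 256 * y ^+ 2 <= y' ^+ 2 by nra.
have c2 : 0 <= c ^+ 2 by exact: sqr_ge0.
have k3 : c ^+ 2 * (x' - x) ^+ 2 <= c ^+ 2 * (y ^+ 2 / 256) by exact: ler_wpM2l.
have k4 : c ^+ 2 * (225 / 256 * y ^+ 2) <= c ^+ 2 * y' ^+ 2 by exact: ler_wpM2l.
have k5 : 0 <= c ^+ 2 * y ^+ 2 by rewrite mulr_ge0// sqr_ge0.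
have k6 : 0 <= ((c * x + d) / 2 + 2 * (c * (x' - x))) ^+ 2 by exact: sqr_ge0.
rewrite !exprMn; nra.
Qed.

Definition orbit_set S : set (R * R) :=
  [set z | exists g, \det g = 1 /\ S (mobius g z)].

Lemma orbit_set_mobius S h z : \det h = 1 -> 0 < z.2 ->
  orbit_set S (mobius h z) <-> orbit_set S z.
Proof.
move=> dh z0; split=> -[g [dg]].
  by rewrite -mobiusM// => hS; exists (g *m h); rewrite det_mulmx dg dh mulr1.
move=> hS; exists (g *m \adj h).
have hadj : \adj h *m h = 1%:M by rewrite mul_adj_mx dh.
split; last first.
  by rewrite -mobiusM// -mulmxA hadj mulmx1.
have := congr1 determinant hadj; rewrite det_mulmx dh mulr1 det1 => da.
by rewrite det_mulmx dg da mulr1.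
Qed.

Lemma orbit_set_open S z : open S -> 0 < z.2 -> orbit_set S z -> nbhs z (orbit_set S).
Proof.
move=> oS z0 [g [dg hS]].
have : nbhs z (mobius g @^-1` S) := @mobius_continuous g z dg z0 S (open_nbhs_nbhs (conj oS hS)).
by apply: filterS => w hw; exists g.
Qed.

(* If some translate of z has height above 1 only integer translations matter near it;
   otherwise all translates of points near z stay below height 2. *)
Lemma orbit_set_closed S z : closed S -> (forall w, S w -> 2 <= w.2) ->
  (forall w (n : int), S (w.1 + n%:~R, w.2) -> S w) -> 0 < z.2 ->
  ~ orbit_set S z -> nbhs z (~` orbit_set S).
Proof.
move=> cS S2 ST z0 nz.
have [[h [dh h1]]|low] := pselect (exists h, \det h = 1 /\ 1 < (mobius h z).2).
  have nS : ~ S (mobius h z) by move=> hS; apply: nz; exists h.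
  have o1 : open (~` S `&` [set w : R * R | 1 < w.2]).
    have o2 : open [set w : R * R | 1 < w.2].
      rewrite openE => w /= w1; apply: filterS (nbhsx_ballx w (w.2 - 1) _); last by rewrite subr_gt0.
      by move=> v /ball_pairE[_]; rewrite ltr_norml /= => /andP[]; lra.
    exact: (openI (closed_openC cS) o2).
  have ch : nbhs z (mobius h @^-1` (~` S `&` [set w : R * R | 1 < w.2])) :=
    @mobius_continuous h z dh z0 _ (open_nbhs_nbhs (conj o1 (conj nS h1))).
  have hp : nbhs z (upper_half_plane R).
    by apply: open_nbhs_nbhs; split => //; exact: half_plane_open.
  apply: filterS2 ch hp => w [nw w1] w0 hw.
  have /(orbit_set_mobius S dh w0) [g [dg gS]] := hw.
  have [n e] : exists n : int, mobius g (mobius h w) = ((mobius h w).1 + n%:~R, (mobius h w).2).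
    by apply: mobius_high => //; apply: lt_le_trans (S2 _ gS); rewrite ltr1n.
  by apply: nw; apply: (ST _ n); rewrite -e.
apply: filterS (nbhsx_ballx z (z.2 / 16) _); last by rewrite divr_gt0.
move=> w /ball_pairE[h1 h2] [g [dg hS]].
have w0 : 0 < w.2 by move: h2; rewrite ltr_norml => /andP[]; lra.
have := S2 _ hS; apply/negP; rewrite -ltNge mobiusE//=.
rewrite ltr_pdivrMr ?mobius_norm_gt0//.
(* Translates of [z] have height at most 1, so those of [w] stay below
   [(17/16) / (3/4) = 17/12 < 2]. *)
have := mobius_norm_near g z0 h1 h2.
have : z.2 <= mobius_norm g z.
  rewrite leNgt; apply/negP => hN; apply: low; exists g; split => //.
  by rewrite mobiusE//= ltr_pdivlMr ?mobius_norm_gt0// mul1r.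
move: h2; rewrite ltr_norml => /andP[]; lra.
Qed.

End MobiusTopology.

(** * Open and closed sets of the modular surface *)

Section ModularSurfaceTopology.
Context {R : realType}.
Local Notation HH := (set_type (upper_half_plane R)).
Local Notation X := (modular_surface R).
Local Notation pi_X := (\pi_X : HH -> X).
Implicit Types (S W : set (R * R)) (z : HH) (q : X).

Definition half_plane_point (w : R * R) (w0 : 0 < w.2) : HH :=
  exist (fun x => x \in upper_half_plane R) w (mem_set w0).

Lemma surface_open (A : set X) W : (forall z, A (pi_X z) <-> W (set_val z)) ->
  (forall w, 0 < w.2 -> W w -> nbhs w W) -> open A.
Proof.
move=> AW nW; have e : (pi_X @^-1` A) = set_val @^-1` (W^°).
  apply/seteqP; split=> z /=.
    by move=> /AW Wz; apply: nW => //; exact: upper_half_planeP.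
  by move=> /interior_subset Wz; exact/AW.
rewrite /open/= /quotient_open -/(pi_X @^-1` A) e.
by exists W^° => //; exact: open_interior.
Qed.

Lemma sigma_continuous : continuous (@sigma R).
Proof.
have cr : continuous (@reflection R).
  move=> w; have c2 : (fun w : R * R => w.2) @ w --> w.2 by exact: cvg_snd.
  have c1 : (fun w : R * R => - w.1) @ w --> - w.1 by apply: cvgN; exact: cvg_fst.
  exact: (cvg_pair c1 c2).
have cH : continuous (@reflectionH R).
  apply/continuousP => _ [B oB <-]; exists (@reflection R @^-1` B) => //.
  by move/continuousP: cr; exact.
apply/quotient_continuous.
have -> : @sigma R \o pi_X = pi_X \o @reflectionH R by apply/funext => z /=; rewrite sigma_pi.
move=> z; apply: continuous_comp; [exact: cH|exact: pi_continuous].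
Qed.

Lemma sigmaK : involutive (@sigma R).
Proof.
move=> q; rewrite -[q]reprK !sigma_pi; congr (\pi _); apply: val_inj => /=.
by rewrite /reflection /= opprK -surjective_pairing reprK.
Qed.

Definition orbit_image S : set X := [set q | orbit_set S (set_val (repr q))].

Lemma orbit_image_pi S z : orbit_image S (pi_X z) <-> orbit_set S (set_val z).
Proof.
have /modular_equivP[g [dg e]] := repr_modular z.
by rewrite /orbit_image/= e orbit_set_mobius//; exact: upper_half_planeP.
Qed.

Lemma orbit_image_open S : open S -> open (orbit_image S).
Proof.
move=> oS; apply: (surface_open (orbit_image_pi S)) => w; exact: orbit_set_open.
Qed.

Lemma orbit_image_closed S : closed S -> (forall w, S w -> 2 <= w.2) ->
  (forall w (n : int), S (w.1 + n%:~R, w.2) -> S w) -> closed (orbit_image S).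
Proof.
move=> cS S2 ST; rewrite -[orbit_image S]setCK; apply: open_closedC.
apply: (@surface_open _ (~` orbit_set S)).
  by move=> z; split=> h1 h2; apply: h1; exact/orbit_image_pi.
by move=> w w0; exact: orbit_set_closed.
Qed.

Lemma cosnD_int n (x : R) (m : int) : cosn n (x + m%:~R) = cosn n x.
Proof.
have N (k : nat) y : cosn n (y + k%:R) = cosn n y :> R.
  exact: (periodic_nat (@cosnD1 R n)).
case: m => m; first exact: N.
by rewrite NegzE rmorphN/= -[LHS](N m.+1) subrK.
Qed.

Lemma cosn1_sign (x : R) : 0 <= x <= 2^-1 ->
  (cosn 1 x < 0) = (4^-1 < x) /\ (0 < cosn 1 x) = (x < 4^-1).
Proof.
move=> hx; have p0 := @pi_gt0 R.
have in_pi (v : R) : 0 <= v <= 2^-1 -> 2 * pi * v \in `[0, pi].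
  move=> /andP[v0 v1]; rewrite in_itv/= !mulr_ge0 ?(ltW p0)//=.
  by rewrite mulrAC ger_pMl//; lra.
have h4 : 2 * pi * 4^-1 \in `[0, pi : R] by apply: in_pi; apply/andP; split; lra.
rewrite -(@cosn1_quarter R) /cosn mulr1 !ltr_cos// ?in_pi//.
by rewrite !ltr_pM2l// mulr_gt0.
Qed.

(** The cosine condition is [|x| < 1/4] modulo one. The box thus contains its integer translates, a
    property that [orbit_image_closed] demands of the closed version. *)
Definition open_box (b c : R) : set (R * R) := [set w | 0 < cosn 1 w.1 /\ b < w.2 < c].
Definition closed_box (b c : R) : set (R * R) := [set w | 0 <= cosn 1 w.1 /\ b <= w.2 <= c].

Lemma half_planes_open (a : R) : [/\ open [set w : R * R | 0 < cosn 1 w.1],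
  open [set w : R * R | cosn 1 w.1 < 0], open [set w : R * R | a < w.2] &
  open [set w : R * R | w.2 < a]].
Proof.
have c2 : continuous (fun w : R * R => w.2) by move=> w; exact: cvg_snd.
have c1 : continuous (fun w : R * R => cosn 1 w.1).
  move=> w; apply: (@continuous_comp _ _ _ (fun w : R * R => w.1) (@cosn R 1)).
    exact: cvg_fst.
  exact: cosn_continuous.
split.
- by apply: (open_comp _ (@open_gt R 0)) => w _; exact: c1.
- by apply: (open_comp _ (@open_lt R 0)) => w _; exact: c1.
- by apply: (open_comp _ (@open_gt R a)) => w _; exact: c2.
by apply: (open_comp _ (@open_lt R a)) => w _; exact: c2.
Qed.

Lemma open_box_open b c : open (open_box b c).
Proof.
have [gt_c _ opn2 _] := half_planes_open b; have [_ _ _ opn3] := half_planes_open c.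
have -> : open_box b c = [set w : R * R | 0 < cosn 1 w.1] `&`
    ([set w : R * R | b < w.2] `&` [set w : R * R | w.2 < c]).
  by apply/seteqP; split=> w [h1]; [case/andP|case=> ? ?; split => //; apply/andP].
exact: (openI gt_c (openI opn2 opn3)).
Qed.

Lemma closed_box_closed b c : closed (closed_box b c).
Proof.
have [_ opn1 _ opn2] := half_planes_open b; have [_ _ opn3 _] := half_planes_open c.
have -> : closed_box b c = ~` [set w : R * R | cosn 1 w.1 < 0] `&`
    (~` [set w : R * R | w.2 < b] `&` ~` [set w : R * R | c < w.2]).
  apply/seteqP; split=> w /=.
    by move=> [h1 /andP[h2 h3]]; split; [|split]; apply/negP; rewrite -leNgt.
  by move=> [/negP h1 [/negP h2 /negP h3]]; rewrite -!leNgt in h1 h2 h3; split => //; apply/andP.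
by apply: closedI; [|apply: closedI]; exact: open_closedC.
Qed.

End ModularSurfaceTopology.

(** * Nodal domains trapped in boxes, and their count *)

Section InertDomains.
Context {R : realType} (t : R) (phi : R * R -> R).
Hypothesis maass : even_hecke_maass_cusp_form t phi.
Local Notation HH := (set_type (upper_half_plane R)).
Local Notation X := (modular_surface R).
Local Notation pi_X := (\pi_X : HH -> X).

Lemma descend_continuous : continuous (descend phi : X -> R).
Proof.
apply/continuousP => U oU; apply: (@surface_open _ _ (phi @^-1` U)).
  by move=> z; rewrite /preimage/= descend_pi//; exact: maass_modular maass.
move=> w w0 Uw; apply: (@maass_continuous _ _ _ maass w w0).
exact: open_nbhs_nbhs.
Qed.

Lemma descend_sigma (q : X) : descend phi (sigma q) = descend phi q.
Proof.
rewrite -[q]reprK sigma_pi !descend_pi; try exact: (maass_modular maass).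
by apply: (maass_even maass); exact: upper_half_planeP.
Qed.

(** The value for [p <= 0] is a default; [axis_pointE] gives the meaning for [p > 0]. *)
Definition axis_point (p : R) : X :=
  if pselect (0 < p) is left p0 then pi_X (half_plane_point (w := (0, p)) p0)
  else pi_X (half_plane_point (w := (0, 1)) ltr01).

Lemma axis_pointE p (p0 : 0 < p) :
  axis_point p = pi_X (half_plane_point (w := (0, p)) p0).
Proof.
rewrite /axis_point; case: pselect => // p0'; congr pi_X; exact: val_inj.
Qed.

Lemma sigma_axis_point p : 0 < p -> sigma (axis_point p) = axis_point p.
Proof.
move=> p0; rewrite !(axis_pointE p0) sigma_pi; congr pi_X; apply: val_inj => /=.
by rewrite /reflection/= oppr0.
Qed.

Lemma descend_axis_point p : 0 < p -> descend phi (axis_point p) = phi (0, p).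
Proof. by move=> p0; rewrite (axis_pointE p0) descend_pi//; exact: maass_modular maass. Qed.

Lemma orbit_image_axis_point S p : 0 < p ->
  orbit_image S (axis_point p) <-> orbit_set S (0, p).
Proof. by move=> p0; rewrite (axis_pointE p0) orbit_image_pi. Qed.

Definition axis_domain p := connected_component (nonvanishing phi) (axis_point p).

(** [sigma] fixes the axis point and preserves the nonvanishing locus, so it maps the component into
    itself, and onto because it is an involution. *)
Lemma axis_domain_inert p : 0 < p -> phi (0, p) != 0 ->
  inert_nodal_domains phi (axis_domain p).
Proof.
move=> p0 nz; have nv : nonvanishing phi (axis_point p).
  by rewrite /nonvanishing/= descend_axis_point.
split; first by exists (axis_point p).
have sub : @sigma R @` axis_domain p `<=` axis_domain p.
  apply: connected_component_max.
  - exists (axis_point p); last exact: sigma_axis_point.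
    exact: connected_component_refl.
  - move=> _ [q /connected_component_sub nq <-].
    by rewrite /nonvanishing/= descend_sigma.
  apply: connected_continuous_connected; first exact: component_connected.
  exact: continuous_subspaceT sigma_continuous.
apply/seteqP; split => // q Dq; exists (sigma q); last exact: sigmaK.
by apply: sub; exists q.
Qed.

(* The boundary of the box carries the sign opposite to phi (0, p), so inside the nonvanishing
   locus the part of the box with the sign of phi (0, p) is both open and closed. *)
Lemma axis_domain_sub_box (s : bool) (b c p : R) : 2 <= b -> b <= p <= c ->
  (-1) ^+ s * phi (0, p) < 0 ->
  (forall x, `|x| <= 4^-1 -> 0 < (-1) ^+ s * phi (x, b)) ->
  (forall x, `|x| <= 4^-1 -> 0 < (-1) ^+ s * phi (x, c)) ->
  (forall y, b <= y <= c -> 0 < (-1) ^+ s * phi (4^-1, y)) ->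
  axis_domain p `<=` orbit_image (open_box b c).
Proof.
move=> b2 /andP[bp pc] sp sb sc s4.
have p0 : 0 < p by lra.
have q0 : 0 <= (4^-1 : R) by lra.
pose f (q : X) := (-1) ^+ s * descend phi q.
have cf : continuous f.
  move=> q; apply: (@continuous_comp _ _ _ (descend phi) ( *%R ((-1) ^+ s))).
    exact: descend_continuous.
  exact: mulrl_continuous.
(* After reduction to [0 <= x' <= 1/2] the boundary consists of [y = b], [y = c] and [x' = 1/4],
   where the sign hypotheses apply. *)
have bdry w : closed_box b c w -> (-1) ^+ s * phi w < 0 -> open_box b c w.
  case: w => x y [/= cx /andP[by_ yc]] neg.
  have y0 : 0 < y by lra.
  have [x' /andP[x0 x1] hx] := even_periodic_reduce x.
  have ec := hx (cosn 1) (@cosnD1 R 1) (@cosnN R 1).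
  have ep : phi (x, y) = phi (x', y) := hx (fun x => phi (x, y))
    (fun x => maass_periodic maass x y0) (fun x => maass_slice_even maass x y0).
  have [c4n c4p] : _ /\ _ := cosn1_sign (introT andP (conj x0 x1)).
  have x4 : x' <= 4^-1 by rewrite leNgt -c4n -leNgt -ec.
  have nx4 : `|x'| <= 4^-1 by rewrite ger0_norm.
  rewrite ep in neg.
  have nb : y != b by apply: contraTneq neg => ->; rewrite -leNgt ltW// sb.
  have nc : y != c by apply: contraTneq neg => ->; rewrite -leNgt ltW// sc.
  have nx : cosn 1 x' != 0.
    apply: contraTneq neg => c0; rewrite -leNgt ltW//.
    suff -> : x' = 4^-1 by apply: s4; rewrite by_.
    by apply/eqP; rewrite eq_le x4 leNgt -c4p c0 ltxx.
  rewrite /open_box/= ec lt_neqAle eq_sym nx -ec cx; split => //.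
  by rewrite !lt_neqAle nc yc by_ eq_sym nb.
have shift (w : R * R) (n : int) : closed_box b c (w.1 + n%:~R, w.2) -> closed_box b c w.
  by rewrite /closed_box/= cosnD_int.
have cB : closed (orbit_image (closed_box b c)).
  apply: orbit_image_closed => //; first exact: closed_box_closed.
  by move=> w [_ /andP[h _]]; exact: le_trans h.
have oU : open (orbit_image (open_box b c) `&` f @^-1` [set v | v < 0]).
  apply: openI; first exact: orbit_image_open (@open_box_open _ b c).
  by apply: open_comp (@open_lt R 0) => q _; exact: cf.
have cF : closed (~` (f @^-1` [set v | 0 < v] `|` ~` orbit_image (closed_box b c))).
  apply: open_closedC; apply: openU; last exact: closed_openC.
  by apply: open_comp (@open_gt R 0) => q _; exact: cf.
(* Where [phi] does not vanish, not positive means negative, and [bdry] removes the boundary of the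
   box; so an open and a closed set agree there. *)
have UF q : nonvanishing phi q ->
    (orbit_image (open_box b c) `&` f @^-1` [set v | v < 0]) q <->
    (~` (f @^-1` [set v | 0 < v] `|` ~` orbit_image (closed_box b c))) q.
  move=> nz; split.
    move=> [[g [dg [h1 /andP[h2 h3]]]] fq] [|]; first by rewrite /preimage/= ltNge (ltW fq).
    by apply; exists g; split => //; split; [exact: ltW|rewrite !ltW].
  move=> /not_orP[/negP nf /contrapT [g [dg gB]]].
  have fq : f q < 0.
    by rewrite lt_neqAle leNgt nf andbT /f mulf_eq0 signr_eq0.
  split => //; exists g; split => //; apply: bdry => //.
  by rewrite (maass_modular maass)//; exact: upper_half_planeP.
have pU : (orbit_image (open_box b c) `&` f @^-1` [set v | v < 0]) (axis_point p).
  have fp : f (axis_point p) < 0 by rewrite /f descend_axis_point.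
  split => //; apply/orbit_image_axis_point => //; exists 1%:M; rewrite det1 mobius1; split => //.
  apply: bdry => //; split => /=; last by rewrite bp.
  by rewrite /cosn mulr0 cos0.
have nv : nonvanishing phi (axis_point p).
  by rewrite /nonvanishing/= descend_axis_point//; apply: contraTneq sp => ->; rewrite mulr0 ltxx.
have sub := @connected_component_sub _ (nonvanishing phi) (axis_point p).
suff e : axis_domain p `&` (orbit_image (open_box b c) `&` f @^-1` [set v | v < 0]) = axis_domain p.
  by move=> q; rewrite -e => -[_ []].
apply: (@component_connected _ (nonvanishing phi) (axis_point p)).
- by exists (axis_point p); split => //; exact: connected_component_refl.
- by exists (orbit_image (open_box b c) `&` f @^-1` [set v | v < 0]).
exists (~` (f @^-1` [set v | 0 < v] `|` ~` orbit_image (closed_box b c))) => //.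
by apply/seteqP; split=> q [Dq hq]; split => //; apply/UF => //; exact: sub.
Qed.

Lemma inert_sub_nodal : (num_inert phi <= num_nodal phi)%E.
Proof.
rewrite /num_inert /num_nodal /counting.
have sub : inert_nodal_domains phi `<=` nodal_domains phi by move=> D [].
case: asboolP => fi; case: asboolP => fn; rewrite ?leey//.
  by rewrite lee_fin ler_nat finmap.fsubset_leq_card// -fset_set_sub.
by case: fi; exact: sub_finite_set sub fn.
Qed.

Lemma num_inert_ge (K : nat) (D : nat -> set X) :
  (forall i, (i < K)%N -> inert_nodal_domains phi (D i)) ->
  (forall i j, (i < j < K)%N -> D i <> D j) -> (K%:R%:E <= num_inert phi)%E.
Proof.
move=> inD neD; rewrite /num_inert /counting; case: asboolP => fi; last exact: leey.
rewrite lee_fin ler_nat -[leqLHS](size_iota 0) -(size_map D).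
apply: uniq_leq_size.
  rewrite map_inj_in_uniq ?iota_uniq// => i j; rewrite !mem_iota !add0n /= => iK jK e.
  by case: (ltngtP i j) => // h; [case: (@neD i j)|case: (@neD j i)]; rewrite ?h.
move=> _ /mapP[i + ->]; rewrite mem_iota add0n /= => iK.
by rewrite in_fset_set// inE; exact: inD.
Qed.

Lemma orbit_box_high (b c p : R) : 2 <= b -> 1 < p -> orbit_set (open_box b c) (0, p) -> b < p < c.
Proof.
move=> b2 p1 [g [dg [_ gb]]]; have /andP[gb1 _] := gb.
have [|n e] := @mobius_high R g (0, p) dg p1; first by apply: lt_trans gb1; lra.
by move: gb; rewrite e.
Qed.

Lemma num_inert_large : 60 * 60 <= t / (2 * pi) -> ((t / 800 / (2 * pi))%:E <= num_inert phi)%E.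
Proof.
move=> ht; have [K [b [p [s [hK b2 sb hp]]]]] := barrier_sequence maass ht.
apply: (@le_trans _ _ K%:R%:E); first by rewrite lee_fin.
have ple i : (i < K)%N -> 2 <= p i.
  by move=> iK; have [/andP[h _] _ _] := hp i iK; apply: le_trans h; exact: b2 (ltnW iK).
have p0 i : (i < K)%N -> 0 < p i by move=> iK; apply: lt_le_trans (ple i iK); lra.
apply: (@num_inert_ge K (axis_domain \o p)) => [i iK|i j /andP[ij jK]] /=.
  apply: axis_domain_inert; first exact: p0.
  by have [_ h _] := hp i iK; apply: contraTneq h => ->; rewrite mulr0 ltxx.
have iK := ltn_trans ij jK.
have [pin neg s4] := hp i iK.
have sub := axis_domain_sub_box (b2 i (ltnW iK)) pin neg
  (fun x => sb i x (ltnW iK)) (fun x => sb i.+1 x iK) s4.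
(* Equal domains would put [p j] in the image of the [i]-th box, hence
   [p j < b (i + 1) <= b j <= p j]. *)
move=> e; have : axis_domain (p i) (axis_point (p j)).
  rewrite e; apply: connected_component_refl; rewrite /nonvanishing/= descend_axis_point ?p0//.
  by have [_ h _] := hp j jK; apply: contraTneq h => ->; rewrite mulr0 ltxx.
move=> /sub /orbit_image_axis_point => /(_ (p0 j jK)).
have pj1 : 1 < p j by apply: lt_le_trans (ple j jK); lra.
move=> /(orbit_box_high (b2 i (ltnW iK)) pj1) /andP[_]; apply/negP; rewrite -leNgt.
have mono k : (i.+1 + k <= j)%N -> b i.+1 <= b (i.+1 + k)%N.
  elim: k => [|k IH] hk; first by rewrite addn0.
  rewrite addnS in hk *; have kK : (i.+1 + k < K)%N by apply: ltn_trans jK.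
  apply: (le_trans (IH (ltnW hk))).
  by have [/andP[h1 h2] _ _] := hp _ kK; exact: le_trans h2.
have [/andP[h _] _ _] := hp j jK; apply: le_trans h.
by have := mono (j - i.+1)%N; rewrite subnKC//; apply.
Qed.

End InertDomains.

Theorem theorem4p1 (R : realType) :
  exists2 c : R, 0 < c & exists T : R,
    forall (t : R) (phi : R * R -> R), even_hecke_maass_cusp_form t phi ->
      (num_inert phi <= num_nodal phi)%E /\
      (T <= t -> ((c * t)%:E <= num_inert phi)%E).
Proof.
have p0 : 0 < 2 * pi :> R by rewrite mulr_gt0 ?pi_gt0.
exists ((800 : R)^-1 / (2 * pi)); first by apply: divr_gt0; [rewrite invr_gt0 ltr0n|].
exists (60 * 60 * (2 * pi)) => t phi maass; split; first exact: inert_sub_nodal.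
move=> ht; have := num_inert_large maass; rewrite ler_pdivlMr// => /(_ ht).
by rewrite [_ * t]mulrC mulrA.
Qed.
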